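(* We have $$\sup\Big\{\int_{\mathbb R}\big(e^{\pi u^2}-1\big)dx\;:\;u\in H^{\frac12,2}(\mathbb R),\ \|u\|_{H^{\frac12,2}(\mathbb R)}\le1\Big\}<\infty .$$ Moreover, for every function $h:[0,\infty)\to[0,\infty)$ with $\lim_{t\to\infty}t^{-2}h(t)=\infty$, $$\sup\Big\{\int_{\mathbb R}h(|u|)\big(e^{\pi u^2}-1\big)dx\;:\;u\in H^{\frac12,2}(\mathbb R),\ \|u\|_{H^{\frac12,2}(\mathbb R)}\le1\Big\}=\infty.$$ In particular the constant $\pi$ in the first inequality is sharp.
   Context: $(-\Delta)^{1/4}$ is the fractional Laplacian defined by $\widehat{(-\Delta)^{1/4}u}=|\xi|^{1/2}\hat u$ (in the sense of tempered distributions). $H^{\frac12,2}(\mathbb R)=\{u\in L^2(\mathbb R):(-\Delta)^{1/4}u\in L^2(\mathbb R)\}$ with norm $\|u\|^2_{H^{\frac12,2}(\mathbb R)}=\|u\|^2_{L^2(\mathbb R)}+\|(-\Delta)^{1/4}u\|^2_{L^2(\mathbb R)}$. *)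

(* Defs.v *)
From HB Require Import structures.
From mathcomp Require Import all_boot all_order all_algebra.
From mathcomp Require Import all_classical all_reals all_analysis.
Set Implicit Arguments. Unset Strict Implicit. Unset Printing Implicit Defensive.
Import Order.TTheory GRing.Theory Num.Theory.
Import numFieldNormedType.Exports.
Local Open Scope classical_set_scope.
Local Open Scope ring_scope.

(* Fourier transform convention (unitary, angular frequency):
     \hat u (xi) = (2 pi)^{-1/2} \int e^{-i x xi} u(x) dx,
   so that -Delta has symbol |xi|^2 and (-Delta)^{1/4} has symbol |xi|^{1/2}.
   For u in L^2 the transform is the L^2-limit (Plancherel) of the truncated
   transforms over [-n, n]; we split it into real and imaginary parts. *)

Definition ft_re (R : realType) (u : R -> R) (n : nat) (xi : R) : R :=
  (Num.sqrt (2 * pi))^-1 *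
  Rintegral (@lebesgue_measure R) `[- n%:R, n%:R] (fun x => u x * cos (x * xi)).

Definition ft_im (R : realType) (u : R -> R) (n : nat) (xi : R) : R :=
  - ((Num.sqrt (2 * pi))^-1 *
  Rintegral (@lebesgue_measure R) `[- n%:R, n%:R] (fun x => u x * sin (x * xi))).

Definition is_L2_fourier (R : realType) (u fr fi : R -> R) : Prop :=
  measurable_fun setT fr /\ measurable_fun setT fi /\
  ((fun n : nat => \int[@lebesgue_measure R]_xi
      (((fr xi - ft_re u n xi) ^+ 2 + (fi xi - ft_im u n xi) ^+ 2)%:E))
    @ \oo --> 0)%E.

(* squared H^{1/2,2} norm: ||u||_2^2 + ||(-Delta)^{1/4} u||_2^2
   = \int u^2 + \int |xi| |\hat u(xi)|^2 dxi  (in \bar R) *)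
Definition H12_sqnorm (R : realType) (u fr fi : R -> R) : \bar R :=
  (\int[@lebesgue_measure R]_x ((u x) ^+ 2)%:E +
   \int[@lebesgue_measure R]_xi ((`|xi| * (fr xi ^+ 2 + fi xi ^+ 2))%:E))%E.

Definition H12_unit_ball (R : realType) : set (R -> R) :=
  [set u | measurable_fun setT u /\
     exists fr fi : R -> R, is_L2_fourier u fr fi /\ (H12_sqnorm u fr fi <= 1)%E].

(* Main.v *)
(* First claim.  For u in the unit ball, Plancherel gives nrm + E <= 1 with nrm
   the squared L^2 norm and the Gagliardo integral of u bounded by 2 pi E.  Test
   the layer of |u| between heights s < s' against the uniform density on
   {|u| > s'}, and compare Poisson extensions at heights 0 and b: this is a
   logarithmic capacity inequality (H - c)^2 <= e (1 + ln (b / m) / pi), where m is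
   the measure of {|u| > s'}.  Since L^2 norm and energy are superadditive over
   layers, at the heights s_k = sqrt (k / pi) it yields
     |{|u| > s_k}| = C exp (- k - G_k),  G_k >= 0,
   a norm defect of at most G_k / k above s_k, and for a < b
     (b - a)^2 <= 64 b (G_a / a) (1 + (b - a) + G_b).
   As in Garsia's proof of Moser's inequality, the k with small G_k / k then
   cluster around one index, so \sum_k exp (- G_k) is bounded by a constant, and
   this sum dominates the exponential integral.
   Second claim.  The Fourier transform u of a multiple of 1/|xi| on
   1 <= |xi| <= N satisfies pi u^2 >= ln N - 3 on [-1/N, 1/N]. *)

(* Since pi is critical, the capacity estimate must keep the exact coefficient 1/pi of the logarithm
   and may lose only additive constants. Both energies are therefore reached through the Poisson
   semigroup exp (- t |xi|): as t decreases to 0, (1 - exp (- t |xi|)) / t increases to |xi| in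
   frequency, and pi / t times the Poisson kernel increases to 1 / z^2 in space, so Fatou passes to
   the limit on either side. Capacity replaces symmetrization: only the measures of superlevel sets
   are compared. The energy is nonlocal and does not split over layers, but truncations and layers
   are nondecreasing functions of |u|, so the cross terms have a sign and superadditivity survives.
   The bound G_k >= 0 alone makes each layer contribute O(1), and the sum over k could diverge. The
   inequality for pairs a < b repairs this: a small G_a means that almost the whole unit budget is
   spent below s_a, too little remains for the rise to s_b, and hence {|u| > s_b} is much smaller
   than exp (- b). This step may lose any constant factor. *)
Require Import Defs.
From HB Require Import structures.
From mathcomp Require Import all_boot all_order all_algebra.
From mathcomp Require Import all_classical all_reals all_analysis.
From mathcomp Require Import measurable_realfun ring lra.
Import Order.TTheory GRing.Theory Num.Theory.
Import numFieldNormedType.Exports.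
Local Open Scope classical_set_scope.
Local Open Scope ring_scope.
Set Implicit Arguments. Unset Strict Implicit. Unset Printing Implicit Defensive.

(** * Integrals and the Poisson kernel *)

Section ge0_le.
Context d (T : measurableType d) (R : realType) (mu : {measure set T -> \bar R}).
Local Open Scope ereal_scope.

(* The weight h of the second claim is an arbitrary function. *)
Lemma le_ge0_integralT (f g : T -> \bar R) :
  (forall x, 0 <= f x) -> (forall x, f x <= g x) ->
  \int[mu]_x f x <= \int[mu]_x g x.
Proof.
move=> f0 fg.
have g0 x : 0 <= g x by exact: le_trans (fg x).
rewrite !ge0_integralTE//.
apply: ge_ereal_sup => _ [h /= hf <-].
by apply: ereal_sup_ubound; exists h => // x; exact: le_trans (fg x).
Qed.
End ge0_le.

Lemma measurable_cos {R : realType} : measurable_fun setT (@cos R).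
Proof. by apply: continuous_measurable_fun; exact: continuous_cos. Qed.

Lemma measurable_sin {R : realType} : measurable_fun setT (@sin R).
Proof. by apply: continuous_measurable_fun; exact: continuous_sin. Qed.

(** The [pose] fails when the matched body still mentions the bound variable, so only genuine
    constants pass; the next tactic uses the same test on the head function. *)
Ltac solve_measurable_cst :=
  match goal with
  | |- measurable_fun _ (fun z => ?c) =>
      let y := fresh "y" in
      assert_succeeds (pose (y := c)); exact: measurable_cst
  end.

Ltac solve_measurable_comp :=
  match goal with
  | |- measurable_fun _ (fun z => ?f z) =>
      let y := fresh "y" in
      assert_succeeds (pose (y := f)); change (measurable_fun setT f)
  | |- measurable_fun _ (fun z => ?f (@?g z)) =>
      let y := fresh "y" in
      assert_succeeds (pose (y := f)); apply: (@measurableT_comp _ _ _ _ _ _ f _ g)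
  end.

Ltac solve_measurable_hyp :=
  match goal with
  | H : measurable_fun _ ?f |- measurable_fun _ ?F => constr_eq f F; exact: H
  end.

Ltac solve_measurable1 := first [ solve_measurable_cst | solve_measurable_hyp |
  lazymatch goal with
  | |- measurable_fun _ (fun z => z) => exact: measurable_id
  | |- measurable_fun _ (fun z => z.1) => exact: measurable_fst
  | |- measurable_fun _ (fun z => z.2) => exact: measurable_snd
  | |- measurable_fun _ (fun z => (@?f z, @?g z)) => apply: measurable_fun_pair
  | |- measurable_fun _ (fun z => EFin (@?f z)) => apply/measurable_EFinP
  | |- measurable_fun _ (EFin \o _) => apply/measurable_EFinP
  | |- measurable_fun _ (fun z => (@?f z) + (@?g z)) => apply: measurable_funD
  | |- measurable_fun _ (fun z => - (@?f z)) =>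
      apply: (@measurableT_comp _ _ _ _ _ _ _ _ f); first exact: oppr_measurable
  | |- measurable_fun _ (fun z => (@?f z) * (@?g z)) => apply: measurable_funM
  | |- measurable_fun _ (fun z => (@?f z) ^+ _) => apply: measurable_funX
  | |- measurable_fun _ (fun z => `|(@?f z)|) =>
      apply: (@measurableT_comp _ _ _ _ _ _ _ _ f); first exact: normr_measurable
  | |- measurable_fun _ (fun z => Num.max (@?f z) (@?g z)) => apply: measurable_maxr
  | |- measurable_fun _ (fun z => Num.min (@?f z) (@?g z)) => apply: measurable_minr
  | |- measurable_fun _ (fun z => (_ * (@?f z))%E) => apply: measurable_funeM
  | |- measurable_fun _ (fun z => ((@?f z) + (@?g z))%E) => apply: emeasurable_funD
  | |- measurable_fun _ fst => exact: measurable_fst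
  | |- measurable_fun _ snd => exact: measurable_snd
  | |- measurable_fun _ (@expR _) => exact: measurable_expR
  | |- measurable_fun _ (@cos _) => exact: measurable_cos
  | |- measurable_fun _ (@sin _) => exact: measurable_sin
  | |- measurable_fun _ (@ln _) => exact: measurable_ln
  | |- _ => solve_measurable_comp
  end ].

Ltac solve_measurable := repeat solve_measurable1.

Section poisson_kernel.
Context {R : realType}.
Notation mu := (@lebesgue_measure R).

(** Convolution kernel of the semigroup exp (- t sqrt(-Delta)), whose Fourier multiplier is [ew t]
    below. *)
Definition poisson (t z : R) : R := t / (pi * (t ^+ 2 + z ^+ 2)).

Lemma sqD_gt0 (t z : R) : 0 < t -> 0 < t ^+ 2 + z ^+ 2.
Proof. by move=> t0; rewrite ltr_pwDl ?exprn_gt0// sqr_ge0. Qed.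

Lemma pi_neq0 : (pi : R) != 0.
Proof. by rewrite gt_eqF ?pi_gt0. Qed.

Lemma poisson_gt0 t z : 0 < t -> 0 < poisson t z.
Proof. by move=> t0; rewrite divr_gt0// mulr_gt0 ?pi_gt0 ?sqD_gt0. Qed.

Lemma poisson_ge0 t z : 0 < t -> 0 <= poisson t z.
Proof. by move=> t0; exact/ltW/poisson_gt0. Qed.

Lemma poisN t z : poisson t (- z) = poisson t z.
Proof. by rewrite /poisson sqrrN. Qed.

Lemma continuous_poisson t : 0 < t -> continuous (poisson t).
Proof.
move=> t0 z; apply: cvgM; first exact: cvg_cst.
apply: cvgV; first by rewrite gt_eqF// mulr_gt0 ?pi_gt0 ?sqD_gt0.
apply: cvgM; first exact: cvg_cst.
by apply: cvgD; [exact: cvg_cst|exact: exprn_continuous].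
Qed.

Lemma measurable_poisson t : 0 < t -> measurable_fun setT (poisson t).
Proof. by move=> t0; apply: continuous_measurable_fun; exact: continuous_poisson. Qed.

Lemma int_pois1 : (\int[mu]_x (poisson 1 x)%:E = 1)%E.
Proof.
rewrite ge0_symfun_integralT; last 3 first.
- by move=> x; exact: poisson_ge0.
- exact: continuous_poisson.
- by move=> x /=; rewrite /poisson sqrrN.
rewrite -set_itvcy.
rewrite (@ge0_continuous_FTC2y _ (poisson 1) (fun x => pi^-1 * atan x) 0
  (pi^-1 * (pi / 2))).
- rewrite atan0 mulr0 -EFinB subr0 mulrA mulVf ?pi_neq0// mul1r -EFinM.
  by congr EFin; rewrite mulfV.
- by move=> x _; exact: poisson_ge0.
- exact/continuous_subspaceT/continuous_poisson.
- by apply: cvgMr; exact: cvgy_atan.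
- by move=> x _; apply: derivableM => //; exact: derivable_atan.
- by apply: cvg_at_right_filter; apply: cvgMr; exact: continuous_atan.
- move=> x _; rewrite derive1E.
  rewrite [LHS](@derive_val _ _ _ _ _ _ _ (is_deriveZ pi^-1 (is_derive1_atan x))).
  by rewrite /poisson /GRing.scale /= expr1n mul1r invfM.
Qed.

Lemma int_poisson t x : 0 < t -> (\int[mu]_y (poisson t (x - y))%:E = 1)%E.
Proof.
move=> t0; rewrite -int_pois1.
have dF (y : R) : is_derive y 1 (fun y : R => (y - x) / t) t^-1.
  apply: is_derive_eq.
  by rewrite /GRing.scale /=; ring.
have F1 : (fun y : R => (y - x) / t)^`()%classic = cst t^-1.
  by apply/funext => y; rewrite derive1E; exact: derive_val.
rewrite [RHS](@increasing_ge0_integration_by_substitutionT _ (fun y => (y - x) / t)).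
- apply: eq_integral => y _; rewrite F1 /poisson/=; congr EFin.
  rewrite -[X in _ = _ / (_ * X) * _](_ : (t ^+ 2 + (x - y) ^+ 2) / t ^+ 2 = _).
    have p0 := pi_neq0; have h := gt_eqF (sqD_gt0 (x - y) t0).
    have t0' : t != 0 by rewrite gt_eqF.
    by rewrite /cst; move: p0; generalize (pi : R) => p p0; field; rewrite t0' h.
  have t0' : t != 0 by rewrite gt_eqF.
  by field.
- by move=> a b ab; rewrite ltr_pM2r ?invr_gt0// ltrD2r.
- by rewrite F1; exact: cst_continuous.
- by rewrite F1; exact: is_cvg_cst.
- by rewrite F1; exact: is_cvg_cst.
- by move=> y; exact: ex_derive.
- apply/cvgrNyPle => A; near=> y; rewrite ler_pdivrMr// lerBlDr.
  by near: y; apply: nbhs_ninfty_le; rewrite num_real.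
- apply/cvgryPge => A; near=> y; rewrite ler_pdivlMr// lerBrDr.
  by near: y; apply: nbhs_pinfty_ge; rewrite num_real.
- exact: continuous_poisson.
- by move=> y; exact: poisson_ge0.
Unshelve. all: by end_near. Qed.

Definition ew (t x : R) : R := expR (- (t * `|x|)).

Lemma ew_ge0 t x : 0 <= ew t x. Proof. exact: expR_ge0. Qed.
Lemma ew_le1 t x : 0 <= t -> ew t x <= 1.
Proof. by move=> t0; rewrite /ew -expR0 ler_expR oppr_le0 mulr_ge0. Qed.
Lemma ewD s t x : ew (s + t) x = ew s x * ew t x.
Proof. by rewrite /ew -expRD mulrDl opprD. Qed.

Lemma continuous_ew t : continuous (ew t).
Proof.
move=> x; apply: (@continuous_comp _ _ _ (fun x => - (t * `|x|)) expR); last exact: continuous_expR.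
apply: cvgN; apply: cvgMr; exact: norm_continuous.
Qed.

Lemma measurable_ew t : measurable_fun setT (ew t).
Proof. by apply: continuous_measurable_fun; exact: continuous_ew. Qed.

Lemma expR_cvgy0 (t : R) : 0 < t -> expR (- (t * x)) @[x --> +oo] --> (0 : R).
Proof.
move=> t0; apply: (@cvg_comp _ _ _ (fun x => t * x) (fun x => expR (- x)) _ +oo); last exact: cvgr_expR.
exact: gt0_cvgMry.
Qed.

(* The 1 makes the integrand nonnegative, as the improper fundamental theorem of
   calculus requires. *)
Lemma int_ew_1cos t z : 0 < t ->
  (\int[mu]_x (ew t x * (1 + cos (z * x)))%:E =
   (2 * (t^-1 + t / (t ^+ 2 + z ^+ 2)))%:E)%E.
Proof.
move=> t0.
have t0' : t != 0 by rewrite gt_eqF.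
have h := gt_eqF (sqD_gt0 z t0).
have cf : continuous (fun x : R => ew t x * (1 + cos (z * x))).
  move=> x; apply: cvgM; first exact: continuous_ew.
  apply: cvgD; first exact: cvg_cst.
  apply: (@continuous_comp _ _ _ (fun x => z * x) cos); last exact: continuous_cos.
  exact: mulrl_continuous.
have f0 (x : R) : 0 <= ew t x * (1 + cos (z * x)).
  by rewrite mulr_ge0 ?ew_ge0//; have := cos_geN1 (z * x); lra.
rewrite ge0_symfun_integralT//; last first.
  by move=> x /=; rewrite /ew normrN mulrN cosN.
rewrite -set_itvcy.
pose F x := expR (- (t * x)) * (- t^-1 + (z * sin (z * x) - t * cos (z * x)) / (t ^+ 2 + z ^+ 2)).
have dF (x : R) : is_derive x 1 F (expR (- (t * x)) * (1 + cos (z * x))).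
  rewrite /F; apply: is_derive_eq.
  rewrite /GRing.scale /=. by field; rewrite h t0'.
rewrite (@ge0_continuous_FTC2y _ _ F 0 0).
- rewrite /F !mulr0 oppr0 expR0 sin0 cos0 -EFinB -EFinM; congr EFin.
  by field; rewrite t0' h.
- by [].
- exact: continuous_subspaceT.
(* [M] bounds the bracket in [F] uniformly in x, so [F] decays like exp (- t x). *)
- pose M := t^-1 + (`|z| + t) / (t ^+ 2 + z ^+ 2).
  rewrite /F.
  apply: (@squeeze_cvgr _ _ _ _ (fun x => - (expR (- (t * x)) * M)) (fun x => expR (- (t * x)) * M)).
  + apply: nearW => x; rewrite -ler_norml normrM ger0_norm ?expR_ge0//.
    rewrite ler_wpM2l ?expR_ge0//.
    apply: (le_trans (ler_normD _ _)); rewrite normrN ger0_norm ?invr_ge0 ?(ltW t0)//.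
    rewrite lerD2l normrM ler_pM//.
      rewrite (le_trans (ler_normB _ _))// !normrM (ger0_norm (ltW t0)) lerD//.
        by rewrite ler_piMr// ler_norml sin_geN1 sin_le1.
      by rewrite ler_piMr ?(ltW t0)// ler_norml cos_geN1 cos_le1.
    by rewrite ger0_norm// invr_ge0 ltW// sqD_gt0.
  + rewrite -[X in _ --> X]oppr0 -(mul0r M).
    by apply: cvgN; apply: cvgMl; exact: expR_cvgy0.
  + by rewrite -(mul0r M); apply: cvgMl; exact: expR_cvgy0.
- by move=> x _; exact: ex_derive.
- apply: cvg_at_right_filter; apply: differentiable_continuous.
  exact/derivable1_diffP/ex_derive.
- move=> x; rewrite in_itv/= andbT => x0.
  by rewrite derive1E derive_val /ew gtr0_norm.
Qed.

Lemma int_ew t : 0 < t -> (\int[mu]_x (ew t x)%:E = (2 / t)%:E)%E.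
Proof.
move=> t0; have := int_ew_1cos 0 t0.
under eq_integral => x _ do rewrite mul0r cos0 EFinM muleC.
rewrite ge0_integralZl_EFin//=; last 2 first.
  by move=> x _; rewrite lee_fin ew_ge0.
  by apply/measurable_EFinP; exact: measurable_ew.
have t0' : t != 0 by rewrite gt_eqF.
have -> : (2 * (t^-1 + t / (t ^+ 2 + 0 ^+ 2))) = (1 + 1) * (2 / t) by field.
move/(congr1 (fun y => (2^-1)%:E * y)%E).
by rewrite muleA -!EFinM !mulrA mulVf ?mul1r ?mul1e.
Qed.

End poisson_kernel.

(** * Fourier transforms of integrable functions *)

Section fubini_real.
Context {R : realType}.
Notation mu := (@lebesgue_measure R).
Notation mu2 := (mu \x mu)%E.

Lemma integrableP_real (f g : R -> R) : measurable_fun setT f ->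
  (forall x, `|f x| <= g x) -> mu.-integrable setT (EFin \o g) ->
  mu.-integrable setT (EFin \o f).
Proof.
move=> mf fg; apply: le_integrable => //; first by solve_measurable.
by move=> x _ /=; rewrite lee_fin (le_trans (fg x))// ler_norm.
Qed.

Lemma ge0_integrable (f : R -> R) : measurable_fun setT f ->
  (forall x, 0 <= f x) -> (\int[mu]_x (f x)%:E < +oo)%E ->
  mu.-integrable setT (EFin \o f).
Proof.
move=> mf f0 foo; apply/integrableP; split; first by solve_measurable.
by under eq_integral => x _ do rewrite /= ger0_norm//.
Qed.

Lemma integrable_fune (f : R -> R) : mu.-integrable setT (EFin \o f) ->
  (\int[mu]_x (f x)%:E)%E = (\int[mu]_x f x)%:E.
Proof. by move=> fi; rewrite /Rintegral fineK//; exact: integrable_fin_num. Qed.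

Lemma measurable_integrable (f : R -> R) : mu.-integrable setT (EFin \o f) ->
  measurable_fun setT f.
Proof. by move=> /measurable_int /measurable_EFinP. Qed.

Lemma integrable_scale c (f : R -> R) : mu.-integrable setT (EFin \o f) ->
  mu.-integrable setT (EFin \o (fun x => c * f x)).
Proof. by move=> /(integrableZl measurableT c); apply: eq_integrable. Qed.

Lemma integrable_norm (f : R -> R) : mu.-integrable setT (EFin \o f) ->
  mu.-integrable setT (EFin \o (fun x => `|f x|)).
Proof. by move=> /integrable_abse; apply: eq_integrable. Qed.

Lemma integrable_add (f g : R -> R) : mu.-integrable setT (EFin \o f) ->
  mu.-integrable setT (EFin \o g) ->
  mu.-integrable setT (EFin \o (fun z => f z + g z)).
Proof. by move=> fi gi; have := integrableD measurableT fi gi; apply: eq_integrable. Qed.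

Lemma integrableP_real2 (f g : R * R -> R) : measurable_fun setT f ->
  (forall x, `|f x| <= g x) -> mu2.-integrable setT (EFin \o g) ->
  mu2.-integrable setT (EFin \o f).
Proof.
move=> mf fg; apply: le_integrable => //; first by solve_measurable.
by move=> x _ /=; rewrite lee_fin (le_trans (fg x))// ler_norm.
Qed.

Lemma ge0_integrable2 (f : R * R -> R) : measurable_fun setT f ->
  (forall x, 0 <= f x) -> (\int[mu2]_x (f x)%:E < +oo)%E ->
  mu2.-integrable setT (EFin \o f).
Proof.
move=> mf f0 foo; apply/integrableP; split; first by solve_measurable.
by under eq_integral => x _ do rewrite /= ger0_norm//.
Qed.

Lemma integrable_fune2 (f : R * R -> R) : mu2.-integrable setT (EFin \o f) ->
  (\int[mu2]_x (f x)%:E)%E = (\int[mu2]_x f x)%:E.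
Proof. by move=> fi; rewrite /Rintegral fineK//; exact: integrable_fin_num. Qed.

Lemma integrable_scale2 c (f : R * R -> R) : mu2.-integrable setT (EFin \o f) ->
  mu2.-integrable setT (EFin \o (fun x => c * f x)).
Proof. by move=> /(integrableZl measurableT c); apply: eq_integrable. Qed.

Lemma integrable_add2 (f g : R * R -> R) : mu2.-integrable setT (EFin \o f) ->
  mu2.-integrable setT (EFin \o g) ->
  mu2.-integrable setT (EFin \o (fun z => f z + g z)).
Proof. by move=> fi gi; have := integrableD measurableT fi gi; apply: eq_integrable. Qed.

Section swap.
Variables (f w : R -> R) (k : R * R -> R).
Hypothesis fi : mu.-integrable setT (EFin \o f).
Hypothesis wi : mu.-integrable setT (EFin \o w).
Hypothesis mk : measurable_fun setT k.
Hypothesis kw : forall x y, `|k (x, y)| <= w y.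

Let mf : measurable_fun setT f := measurable_integrable fi.

Let F (z : R * R) : \bar R := (f z.1 * k z)%:E.

Let mF : measurable_fun setT F.
Proof. by rewrite /F; solve_measurable. Qed.

Let Fi : (mu \x mu)%E.-integrable setT F.
Proof.
apply/integrable12ltyP => //.
apply: (@le_lt_trans _ _ (\int[mu]_x (`|f x| * \int[mu]_y w y)%:E)%E).
  apply: le_ge0_integralT => x; first exact: integral_ge0.
  rewrite /F /=.
  under eq_integral => y _ do rewrite normrM EFinM.
  rewrite ge0_integralZl_EFin//; last first.
    have mkx : measurable_fun setT (fun y => k (x, y)) by exact: measurableT_comp.
    by solve_measurable.
  rewrite EFinM lee_wpmul2l ?lee_fin//.
  rewrite -integrable_fune//; apply: le_ge0_integralT => y; rewrite lee_fin//.
under eq_integral => x _ do rewrite EFinM muleC.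
rewrite ge0_integralZl_EFin//; last 2 first.
- by solve_measurable.
- by apply: Rintegral_ge0 => y _; rewrite (le_trans _ (kw 0 y)).
rewrite lte_mul_pinfty//.
- by rewrite lee_fin; apply: Rintegral_ge0 => y _; rewrite (le_trans _ (kw 0 y)).
- by case/integrableP : fi.
Qed.

Let ki1 x : mu.-integrable setT (EFin \o (fun y => k (x, y))).
Proof. by apply: (integrableP_real _ (kw x) wi); exact: measurableT_comp. Qed.

Let ki2 y : mu.-integrable setT (EFin \o (fun x => f x * k (x, y))).
Proof.
apply: (@integrableP_real _ (fun x => `|w y| * `|f x|)).
- have mkx : measurable_fun setT (fun x => k (x, y)) by exact: measurableT_comp.
  by solve_measurable.
- by move=> x; rewrite normrM mulrC ler_wpM2r// (le_trans (kw x y))// ler_norm.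
- exact/integrable_scale/integrable_norm.
Qed.

Let FE1 x : fubini_F mu F x = (f x * \int[mu]_y k (x, y))%:E.
Proof.
rewrite /fubini_F /F /= -RintegralZl// integrable_fune//.
exact: integrable_scale.
Qed.

Let FE2 y : fubini_G mu F y = (\int[mu]_x (f x * k (x, y)))%:E.
Proof. exact: integrable_fune. Qed.

Lemma swap_integrable1 :
  mu.-integrable setT (EFin \o (fun x => f x * \int[mu]_y k (x, y))).
Proof.
have := integrable_fubini_F Fi; apply: eq_integrable => // x _.
exact: FE1.
Qed.

Lemma swap_integrable2 :
  mu.-integrable setT (EFin \o (fun y => \int[mu]_x (f x * k (x, y)))).
Proof.
apply: (@integrableP_real _ (fun y => \int[mu]_x `|f x| * w y)).
- apply/measurable_EFinP; have := measurable_fubini_G Fi.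
  by apply: eq_measurable_fun => y _; exact: FE2.
- move=> y; rewrite (le_trans (le_normr_Rintegral _ (ki2 y)))//.
  rewrite mulrC -RintegralZl//; last exact: integrable_norm.
  apply: le_Rintegral => //; first exact: integrable_norm.
    exact/integrable_scale/integrable_norm.
  by move=> x _; rewrite normrM mulrC ler_wpM2r.
- exact: integrable_scale.
Qed.

(** Fubini under a domination by a function of y alone. In the uses, [w] is a multiple of an
    exponential weight, or the modulus of a cut function in the extremal example. *)
Lemma swap_Rintegral : \int[mu]_x (f x * \int[mu]_y k (x, y)) =
  \int[mu]_y \int[mu]_x (f x * k (x, y)).
Proof.
apply: EFin_inj.
rewrite -(integrable_fune swap_integrable1) -(integrable_fune swap_integrable2).
transitivity (\int[mu]_x fubini_F mu F x)%E.
  by apply: eq_integral => x _; exact/esym/FE1.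
transitivity (\int[mu]_x fubini_G mu F x)%E; first exact: Fubini.
by apply: eq_integral => x _; exact: FE2.
Qed.

End swap.

Definition cosT (f : R -> R) (xi : R) := \int[mu]_x (f x * cos (x * xi)).
Definition sinT (f : R -> R) (xi : R) := \int[mu]_x (f x * sin (x * xi)).

Lemma integrable_ew t : 0 < t -> mu.-integrable setT (EFin \o (@ew R t)).
Proof.
move=> t0; apply: ge0_integrable; [exact: measurable_ew|exact: ew_ge0|].
by rewrite int_ew// ltry.
Qed.

Lemma normr_cos (x : R) : `|cos x| <= 1.
Proof. by rewrite ler_norml cos_geN1 cos_le1. Qed.

Lemma normr_sin (x : R) : `|sin x| <= 1.
Proof. by rewrite ler_norml sin_geN1 sin_le1. Qed.

Lemma integrableMb (f h : R -> R) : mu.-integrable setT (EFin \o f) ->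
  measurable_fun setT h -> (forall x, `|h x| <= 1) ->
  mu.-integrable setT (EFin \o (fun x => f x * h x)).
Proof.
move=> fi mh h1; have mf := measurable_integrable fi.
apply: (@integrableP_real _ (fun x => `|f x|)).
- by solve_measurable.
- by move=> x; rewrite normrM ler_piMr.
- exact: integrable_norm.
Qed.

(** The cosine kernel is not integrable in the frequency, so Fubini is applied to the kernel damped
    by [ew 1], and the damping is divided out afterwards. *)
Lemma measurable_cosT f : mu.-integrable setT (EFin \o f) ->
  measurable_fun setT (cosT f).
Proof.
move=> fi.
have mk : measurable_fun setT (fun z : R * R => ew 1 z.2 * cos (z.1 * z.2)).
  have me := @measurable_ew R 1; by solve_measurable.
have kw (x y : R) : `|ew 1 y * cos (x * y)| <= ew 1 y.
  by rewrite normrM (ger0_norm (ew_ge0 _ _)) ler_piMr ?ew_ge0 ?normr_cos.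
have := measurable_integrable (swap_integrable2 fi (integrable_ew ltr01) mk kw).
move=> mh.
have -> : cosT f = (fun y => expR `|y| * \int[mu]_x (f x * (ew 1 y * cos (x * y)))).
  apply/funext => y; rewrite -RintegralZl//.
    apply: eq_Rintegral => x _.
    by rewrite mulrCA [expR _ * (_ * _)]mulrA /ew mul1r -expRD subrr expR0 mul1r.
  apply: integrableMb => //.
    by have me := @measurable_ew R 1; solve_measurable.
  by move=> x; rewrite (le_trans (kw _ _))// ew_le1.
by solve_measurable.
Qed.

Lemma measurable_sinT f : mu.-integrable setT (EFin \o f) ->
  measurable_fun setT (sinT f).
Proof.
move=> fi.
have mk : measurable_fun setT (fun z : R * R => ew 1 z.2 * sin (z.1 * z.2)).
  have me := @measurable_ew R 1; by solve_measurable.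
have kw (x y : R) : `|ew 1 y * sin (x * y)| <= ew 1 y.
  by rewrite normrM (ger0_norm (ew_ge0 _ _)) ler_piMr ?ew_ge0 ?normr_sin.
have := measurable_integrable (swap_integrable2 fi (integrable_ew ltr01) mk kw).
move=> mh.
have -> : sinT f = (fun y => expR `|y| * \int[mu]_x (f x * (ew 1 y * sin (x * y)))).
  apply/funext => y; rewrite -RintegralZl//.
    apply: eq_Rintegral => x _.
    by rewrite mulrCA [expR _ * (_ * _)]mulrA /ew mul1r -expRD subrr expR0 mul1r.
  apply: integrableMb => //.
    by have me := @measurable_ew R 1; solve_measurable.
  by move=> x; rewrite (le_trans (kw _ _))// ew_le1.
by solve_measurable.
Qed.

Definition absnorm (f : R -> R) := \int[mu]_x `|f x|.

Lemma cosT_le f xi : mu.-integrable setT (EFin \o f) -> `|cosT f xi| <= absnorm f.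
Proof.
move=> fi; have mf := measurable_integrable fi.
have h : mu.-integrable setT (EFin \o (fun x => f x * cos (x * xi))).
  by apply: integrableMb => //; [solve_measurable|move=> x; exact: normr_cos].
rewrite (le_trans (le_normr_Rintegral _ h))//.
apply: le_Rintegral => //.
- exact: integrable_norm.
- exact: integrable_norm.
- by move=> x _; rewrite normrM ler_piMr// normr_cos.
Qed.

Lemma sinT_le f xi : mu.-integrable setT (EFin \o f) -> `|sinT f xi| <= absnorm f.
Proof.
move=> fi; have mf := measurable_integrable fi.
have h : mu.-integrable setT (EFin \o (fun x => f x * sin (x * xi))).
  by apply: integrableMb => //; [solve_measurable|move=> x; exact: normr_sin].
rewrite (le_trans (le_normr_Rintegral _ h))//.
apply: le_Rintegral => //.
- exact: integrable_norm.
- exact: integrable_norm.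
- by move=> x _; rewrite normrM ler_piMr// normr_sin.
Qed.

(** Removes the 1 that was added to the cosine in [int_ew_1cos], by subtracting [int_ew]. *)
Lemma Rint_ew_cos t z : 0 < t ->
  \int[mu]_x (ew t x * cos (z * x)) = 2 * pi * poisson t z.
Proof.
move=> t0.
have iew := integrable_ew t0.
have i1 : mu.-integrable setT (EFin \o (fun x => ew t x * cos (z * x))).
  by apply: integrableMb => //; [solve_measurable|move=> x; exact: normr_cos].
have := int_ew_1cos z t0.
under eq_integral => x _ do rewrite mulrDr mulr1 EFinD.
rewrite integralD_EFin// int_ew// integrable_fune// -EFinD => e0.
have {e0}e := EFin_inj e0; rewrite /poisson.
have h := gt_eqF (sqD_gt0 z t0).
have p0 := @pi_neq0 R.
have t0' : t != 0 by rewrite gt_eqF.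
transitivity (2 * (t^-1 + t / (t ^+ 2 + z ^+ 2)) - 2 / t); first by rewrite -e; ring.
by move: p0; generalize (pi : R) => p p0; field; rewrite ?p0 ?h ?t0' ?p0.
Qed.

(** The bilinear form of the Poisson semigroup: f paired with the Poisson extension of g at height
    t. *)
Definition poisson_form t (f g : R -> R) :=
  \int[mu]_x (f x * \int[mu]_y (g y * poisson t (x - y))).

Section fourier_poisson.
Variables (t : R) (f g : R -> R).
Hypothesis t0 : 0 < t.
Hypothesis fi : mu.-integrable setT (EFin \o f).
Hypothesis gi : mu.-integrable setT (EFin \o g).

(** Integrated in x against [f], this kernel gives the damped product of the two transforms ([kE2]);
    integrated in the frequency, it gives 2 pi times the Poisson extension of [g] ([kE1]). Fubini
    equates the two. *)
Let k (z : R * R) := ew t z.2 * (cos (z.1 * z.2) * cosT g z.2 + sin (z.1 * z.2) * sinT g z.2).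

Let mk : measurable_fun setT k.
Proof.
have me := @measurable_ew R t.
have mc := measurable_cosT gi; have ms := measurable_sinT gi.
by rewrite /k; solve_measurable.
Qed.

Let kw x y : `|k (x, y)| <= 2 * absnorm g * ew t y.
Proof.
rewrite /k /= normrM (ger0_norm (ew_ge0 _ _)) mulrC ler_wpM2r ?ew_ge0//.
rewrite (le_trans (ler_normD _ _))// !normrM.
have h1 : `|cos (x * y)| * `|cosT g y| <= 1 * absnorm g.
  by apply: ler_pM => //; [exact: normr_cos|exact: cosT_le].
have h2 : `|sin (x * y)| * `|sinT g y| <= 1 * absnorm g.
  by apply: ler_pM => //; [exact: normr_sin|exact: sinT_le].
by lra.
Qed.

Let wi : mu.-integrable setT (EFin \o (fun y => 2 * absnorm g * ew t y)).
Proof.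
exact/integrable_scale/integrable_ew.
Qed.

Let icos (h : R -> R) y : mu.-integrable setT (EFin \o h) ->
  mu.-integrable setT (EFin \o (fun x => h x * cos (x * y))).
Proof.
by move=> hi; apply: integrableMb => //; [solve_measurable|move=> x; exact: normr_cos].
Qed.

Let isin (h : R -> R) y : mu.-integrable setT (EFin \o h) ->
  mu.-integrable setT (EFin \o (fun x => h x * sin (x * y))).
Proof.
by move=> hi; apply: integrableMb => //; [solve_measurable|move=> x; exact: normr_sin].
Qed.

Let kE2 y : \int[mu]_x (f x * k (x, y)) =
  ew t y * (cosT f y * cosT g y + sinT f y * sinT g y).
Proof.
rewrite mulrDr.
transitivity (\int[mu]_x ((ew t y * cosT g y) * (f x * cos (x * y)) +
   (ew t y * sinT g y) * (f x * sin (x * y)))).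
  by apply: eq_Rintegral => x _; rewrite /k /=; ring.
rewrite RintegralD//.
- rewrite !RintegralZl//; [|exact: isin|exact: icos].
  by rewrite /cosT /sinT; ring.
- apply: integrable_scale.
  exact: icos.
- apply: integrable_scale.
  exact: isin.
Qed.

Let kE1 x : \int[mu]_y k (x, y) = 2 * pi * \int[mu]_y (g y * poisson t (x - y)).
Proof.
(* A second exchange, of y and the frequency; the addition formula for the cosine then separates x
   from y. *)
pose k' (z : R * R) := ew t z.2 * cos ((x - z.1) * z.2).
have mk' : measurable_fun setT k'.
  by have me := @measurable_ew R t; rewrite /k'; solve_measurable.
have kw' y xi : `|k' (y, xi)| <= ew t xi.
  by rewrite /k' normrM (ger0_norm (ew_ge0 _ _)) ler_piMr ?ew_ge0 ?normr_cos.
have k'E y : \int[mu]_xi k' (y, xi) = 2 * pi * poisson t (x - y).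
  exact: (Rint_ew_cos (x - y) t0).
transitivity (\int[mu]_xi \int[mu]_y (g y * k' (y, xi))).
  apply: eq_Rintegral => xi _; rewrite /k /k' /=.
  rewrite (_ : (fun y => _) = (fun y => (ew t xi * cos (x * xi)) * (g y * cos (y * xi)) +
     (ew t xi * sin (x * xi)) * (g y * sin (y * xi)))).
    rewrite RintegralD//.
    - rewrite !RintegralZl//; [|exact: isin|exact: icos].
      by rewrite /cosT /sinT; ring.
    - apply: integrable_scale.
      exact: icos.
    - apply: integrable_scale.
      exact: isin.
  by apply/funext => y; rewrite mulrBl cosB; ring.
rewrite -(swap_Rintegral gi (integrable_ew t0) mk' kw').
rewrite -RintegralZl//; last first.
  have := swap_integrable1 gi (integrable_ew t0) mk' kw'.
  move=> /(@integrableZl _ _ _ _ _ measurableT (2 * pi)^-1); apply: eq_integrable => // y _.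
  rewrite /= k'E -EFinM; congr EFin.
  by move: (@pi_neq0 R); generalize (pi : R) => p p0; field.
by apply: eq_Rintegral => y _; rewrite k'E; ring.
Qed.

Lemma fourier_poisson_integrable : mu.-integrable setT
  (EFin \o (fun y => ew t y * (cosT f y * cosT g y + sinT f y * sinT g y))).
Proof.
have := swap_integrable2 fi wi mk kw; apply: eq_integrable => // y _.
by rewrite /= kE2.
Qed.

(** Parseval's identity damped by exp (- t |xi|). The damping makes every double integral converge
    absolutely for merely integrable [f] and [g]. *)
Lemma fourier_poisson :
  \int[mu]_y (ew t y * (cosT f y * cosT g y + sinT f y * sinT g y)) =
  2 * pi * poisson_form t f g.
Proof.
transitivity (\int[mu]_y \int[mu]_x (f x * k (x, y))).
  by apply: eq_Rintegral => y _; rewrite kE2.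
rewrite -(swap_Rintegral fi wi mk kw) /poisson_form -RintegralZl//; last first.
  have := swap_integrable1 fi wi mk kw.
  move=> /(@integrableZl _ _ _ _ _ measurableT (2 * pi)^-1); apply: eq_integrable => // y _.
  rewrite /= kE1 -EFinM; congr EFin.
  by move: (@pi_neq0 R); generalize (pi : R) => p p0; field.
by apply: eq_Rintegral => x _; rewrite kE1; ring.
Qed.

End fourier_poisson.

End fubini_real.

(** * Poisson energies and Plancherel *)

Section energy_identity.
Context {R : realType}.
Notation mu := (@lebesgue_measure R).
Notation mu2 := (mu \x mu)%E.
Implicit Types (f g w : R -> R) (t : R).

Lemma poisson_le t z : 0 < t -> @poisson R t z <= (pi * t)^-1.
Proof.
move=> t0; rewrite /poisson ler_pdivrMr ?mulr_gt0 ?pi_gt0 ?sqD_gt0//.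
rewrite invfM mulrACA mulVf ?pi_neq0// mul1r mulrDr.
by rewrite expr2 mulKf ?gt_eqF// lerDl mulr_ge0 ?invr_ge0 ?sqr_ge0// ltW.
Qed.

Lemma int2_pois1 t g : 0 < t -> measurable_fun setT g -> (forall x, 0 <= g x) ->
  (\int[mu2]_z (poisson t (z.1 - z.2) * g z.1)%:E = \int[mu]_x (g x)%:E)%E.
Proof.
move=> t0 mg g0; have mp := measurable_poisson t0.
rewrite fubini_tonelli1; last 2 first.
- by solve_measurable.
- by move=> z; rewrite lee_fin mulr_ge0// poisson_ge0.
apply: eq_integral => x _; rewrite /fubini_F /=.
under eq_integral => y _ do rewrite mulrC EFinM.
rewrite ge0_integralZl_EFin//; last 2 first.
- by move=> y _; rewrite lee_fin poisson_ge0.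
- by solve_measurable.
by rewrite int_poisson// mule1.
Qed.

Lemma int2_pois2 t g : 0 < t -> measurable_fun setT g -> (forall x, 0 <= g x) ->
  (\int[mu2]_z (poisson t (z.1 - z.2) * g z.2)%:E = \int[mu]_x (g x)%:E)%E.
Proof.
move=> t0 mg g0; have mp := measurable_poisson t0.
rewrite fubini_tonelli2; last 2 first.
- by solve_measurable.
- by move=> z; rewrite lee_fin mulr_ge0// poisson_ge0.
apply: eq_integral => x _; rewrite /fubini_G /=.
under eq_integral => y _ do rewrite mulrC EFinM -opprB poisN.
rewrite ge0_integralZl_EFin//; last 2 first.
- by move=> y _; rewrite lee_fin poisson_ge0.
- by solve_measurable.
by rewrite int_poisson// mule1.
Qed.

Definition sqnorm w := \int[mu]_x (w x ^+ 2).
Definition poisson_energy t w :=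
  (\int[mu2]_z (poisson t (z.1 - z.2) * (w z.1 - w z.2) ^+ 2)%:E)%E.

Definition L2 w := measurable_fun setT w /\
  mu.-integrable setT (EFin \o (fun x => w x ^+ 2)).

(** L^1 intersected with L^2: integrability gives pointwise transforms [cosT] and [sinT], square
    integrability gives Plancherel. *)
Definition L12 w := mu.-integrable setT (EFin \o w) /\
  mu.-integrable setT (EFin \o (fun x => w x ^+ 2)).

Lemma L12_L2 w : L12 w -> L2 w.
Proof. by case=> /measurable_integrable. Qed.

Lemma L2P w : measurable_fun setT w -> (\int[mu]_x (w x ^+ 2)%:E < +oo)%E -> L2 w.
Proof.
by move=> mw woo; split=> //; apply: ge0_integrable => //; [solve_measurable|move=> x; exact: sqr_ge0].
Qed.

Lemma nrm2E w : L2 w -> (\int[mu]_x (w x ^+ 2)%:E)%E = (sqnorm w)%:E.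
Proof. by case=> mw wi; rewrite integrable_fune. Qed.

Lemma sqnorm_ge0 w : 0 <= sqnorm w.
Proof. by apply: Rintegral_ge0 => x _; exact: sqr_ge0. Qed.

Lemma poisson_sq1_integrable t w : 0 < t -> L2 w ->
  mu2.-integrable setT (EFin \o (fun z => poisson t (z.1 - z.2) * w z.1 ^+ 2)).
Proof.
move=> t0 [mw wi]; have mp := measurable_poisson t0; apply: ge0_integrable2.
- by solve_measurable.
- by move=> z; rewrite mulr_ge0 ?poisson_ge0 ?sqr_ge0.
rewrite (@int2_pois1 t (fun x => w x ^+ 2))//.
- by rewrite integrable_fune// ltry.
- by solve_measurable.
- by move=> x; exact: sqr_ge0.
Qed.

Lemma poisson_sq2_integrable t w : 0 < t -> L2 w ->
  mu2.-integrable setT (EFin \o (fun z => poisson t (z.1 - z.2) * w z.2 ^+ 2)).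
Proof.
move=> t0 [mw wi]; have mp := measurable_poisson t0; apply: ge0_integrable2.
- by solve_measurable.
- by move=> z; rewrite mulr_ge0 ?poisson_ge0 ?sqr_ge0.
rewrite (@int2_pois2 t (fun x => w x ^+ 2))//.
- by rewrite integrable_fune// ltry.
- by solve_measurable.
- by move=> x; exact: sqr_ge0.
Qed.

Lemma ler_normM_sq (a b : R) : `|a * b| <= a ^+ 2 + b ^+ 2.
Proof.
rewrite ler_norml; apply/andP; split.
  by rewrite -subr_ge0; have := sqr_ge0 (a + b); have := sqr_ge0 a; have := sqr_ge0 b; nra.
by rewrite -subr_ge0; have := sqr_ge0 (a - b); have := sqr_ge0 a; have := sqr_ge0 b; nra.
Qed.

Lemma poisson_prod_integrable t f g : 0 < t -> L2 f -> L2 g ->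
  mu2.-integrable setT (EFin \o (fun z => poisson t (z.1 - z.2) * (f z.1 * g z.2))).
Proof.
move=> t0 Lf Lg; have mp := measurable_poisson t0.
apply: (@integrableP_real2 _ _ (fun z => poisson t (z.1 - z.2) * f z.1 ^+ 2 +
   poisson t (z.1 - z.2) * g z.2 ^+ 2)).
- by case: Lf => mf _; case: Lg => mg _; solve_measurable.
- move=> z; rewrite normrM ger0_norm ?poisson_ge0// -mulrDr ler_wpM2l ?poisson_ge0//.
  exact: ler_normM_sq.
- by apply: integrable_add2; [exact: poisson_sq1_integrable|exact: poisson_sq2_integrable].
Qed.

Lemma poisson_conv_integrable t g x : 0 < t -> mu.-integrable setT (EFin \o g) ->
  mu.-integrable setT (EFin \o (fun y => g y * poisson t (x - y))).
Proof.
move=> t0 gi; have mp := measurable_poisson t0; have mg := measurable_integrable gi.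
apply: (@integrableP_real _ _ (fun y => (pi * t)^-1 * `|g y|)).
- by solve_measurable.
- by move=> y; rewrite normrM mulrC ler_wpM2r// ger0_norm ?poisson_ge0// poisson_le.
- exact/integrable_scale/integrable_norm.
Qed.

Section poisson_form_fubini.
Variables (t : R) (f g : R -> R).
Hypotheses (t0 : 0 < t) (Lf : L2 f) (Lg : L12 g).
Let I := poisson_prod_integrable t0 Lf (L12_L2 Lg).

Let FE x : fubini_F mu
    (EFin \o (fun z : R * R => poisson t (z.1 - z.2) * (f z.1 * g z.2))) x =
  (f x * \int[mu]_y (g y * poisson t (x - y)))%:E.
Proof.
transitivity ((\int[mu]_y (f x * (g y * poisson t (x - y))))%:E); last first.
  by rewrite RintegralZl//; exact: (poisson_conv_integrable x t0 (proj1 Lg)).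
rewrite -integrable_fune; last first.
  exact: (integrable_scale _ (poisson_conv_integrable x t0 (proj1 Lg))).
by apply: eq_integral => y _ /=; congr EFin; ring.
Qed.

Lemma BtE : poisson_form t f g = \int[mu2]_z (poisson t (z.1 - z.2) * (f z.1 * g z.2)).
Proof.
apply: (congr1 fine); rewrite -(integral12_prod_meas1 I).
by apply: eq_integral => x _; exact/esym/FE.
Qed.

Lemma poisson_form_integrable : mu.-integrable setT
  (EFin \o (fun x => f x * \int[mu]_y (g y * poisson t (x - y)))).
Proof.
by have := integrable_fubini_F I; apply: eq_integrable => // x _; exact: FE.
Qed.

End poisson_form_fubini.

(** Expand the square: the kernel has mass 1 in each variable, so both diagonal terms equal the
    squared norm, and the cross term is the Poisson form. *)
Lemma DtE t w : 0 < t -> L12 w -> poisson_energy t w = (2 * (sqnorm w - poisson_form t w w))%:E.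
Proof.
move=> t0 Lw; have L := L12_L2 Lw.
have I1 := poisson_sq1_integrable t0 L; have I2 := poisson_sq2_integrable t0 L.
have I3 := poisson_prod_integrable t0 L L.
rewrite /poisson_energy.
have E z : poisson t (z.1 - z.2) * (w z.1 - w z.2) ^+ 2 =
  (poisson t (z.1 - z.2) * w z.1 ^+ 2 + poisson t (z.1 - z.2) * w z.2 ^+ 2) +
  (-2) * (poisson t (z.1 - z.2) * (w z.1 * w z.2)) by ring.
under eq_integral => z _ do rewrite E.
rewrite integrable_fune2; last first.
  by apply: integrable_add2; [exact: integrable_add2|exact: integrable_scale2].
rewrite RintegralD//; [|exact: integrable_add2|exact: integrable_scale2].
rewrite RintegralD// RintegralZl// -BtE//.
have mw := proj1 L.
have -> : \int[mu2]_z (poisson t (z.1 - z.2) * w z.1 ^+ 2) = sqnorm w.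
  apply: EFin_inj; rewrite -integrable_fune2// -nrm2E//.
  by rewrite (@int2_pois1 t (fun x => w x ^+ 2))// => [|x]; [solve_measurable|exact: sqr_ge0].
have -> : \int[mu2]_z (poisson t (z.1 - z.2) * w z.2 ^+ 2) = sqnorm w.
  apply: EFin_inj; rewrite -integrable_fune2// -nrm2E//.
  by rewrite (@int2_pois2 t (fun x => w x ^+ 2))// => [|x]; [solve_measurable|exact: sqr_ge0].
by congr EFin; ring.
Qed.

Lemma poisson_energy_ge0 t w : 0 < t -> (0 <= poisson_energy t w)%E.
Proof.
by move=> t0; apply: integral_ge0 => z _; rewrite lee_fin mulr_ge0 ?poisson_ge0 ?sqr_ge0.
Qed.

Lemma poisson_energy_add t f g : 0 < t -> measurable_fun setT f -> measurable_fun setT g ->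
  (poisson_energy t (fun x => (f x + g x)%R) <= 2%:E * poisson_energy t f + 2%:E * poisson_energy t g)%E.
Proof.
move=> t0 mf mg; have mp := measurable_poisson t0.
have ge0 w z : (0 <= (poisson t (z.1 - z.2) * (w z.1 - w z.2) ^+ 2)%:E)%E.
  by rewrite lee_fin mulr_ge0 ?poisson_ge0 ?sqr_ge0.
rewrite /poisson_energy -!ge0_integralZl_EFin//; [|by solve_measurable|by solve_measurable].
rewrite -ge0_integralD//; last 4 first.
- by move=> z _; rewrite mule_ge0// ?lee_fin//; exact: ge0.
- by solve_measurable.
- by move=> z _; rewrite mule_ge0// ?lee_fin//; exact: ge0.
- by solve_measurable.
apply: le_ge0_integralT => z; first exact: (ge0 (fun x => f x + g x)%R).
rewrite -!EFinM -EFinD lee_fin !(mulrCA 2) -mulrDr ler_wpM2l ?poisson_ge0//.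
rewrite -subr_ge0 (_ : _ - _ = ((f z.1 - f z.2) - (g z.1 - g z.2)) ^+ 2).
  exact: sqr_ge0.
by ring.
Qed.

(** From (a - b)^2 <= 2 a^2 + 2 b^2 and the unit mass of the kernel. The bound is uniform in t,
    which allows an approximation argument as t tends to 0. *)
Lemma poisson_energy_le t w : 0 < t -> measurable_fun setT w ->
  (poisson_energy t w <= 4%:E * \int[mu]_x (w x ^+ 2)%:E)%E.
Proof.
move=> t0 mw; have mp := measurable_poisson t0.
have e1 := @int2_pois1 t (fun x => w x ^+ 2) t0.
have e2 := @int2_pois2 t (fun x => w x ^+ 2) t0.
have -> : (4%:E = 2%:E + 2%:E :> \bar R)%E by rewrite -EFinD; congr EFin; ring.
rewrite ge0_muleDl ?lee_fin// -{1}e1; last 2 first.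
- by solve_measurable.
- by move=> x; exact: sqr_ge0.
rewrite -e2; last 2 first.
- by solve_measurable.
- by move=> x; exact: sqr_ge0.
have ge0 a z : (0 <= (poisson t (z.1 - z.2) * (w a) ^+ 2)%:E)%E.
  by rewrite lee_fin mulr_ge0 ?poisson_ge0 ?sqr_ge0.
rewrite /poisson_energy -!ge0_integralZl_EFin//; last 2 first.
- by solve_measurable.
- by solve_measurable.
rewrite -ge0_integralD//; last 4 first.
- by move=> z _; rewrite mule_ge0// ?lee_fin//; exact: ge0.
- by solve_measurable.
- by move=> z _; rewrite mule_ge0// ?lee_fin//; exact: ge0.
- by solve_measurable.
apply: le_ge0_integralT => z; first by rewrite lee_fin mulr_ge0 ?poisson_ge0 ?sqr_ge0.
rewrite -!EFinM -EFinD lee_fin !(mulrCA 2) -mulrDr ler_wpM2l ?poisson_ge0//.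
rewrite -subr_ge0 (_ : _ - _ = (w z.1 + w z.2) ^+ 2); first exact: sqr_ge0.
by ring.
Qed.

End energy_identity.

(** Fatou's lemma in the form used for every limit below. The bound holds only eventually, hence the
    shift of the sequence by [N]. *)
Lemma fatou_le d (T : measurableType d) (R : realType)
    (m : {measure set T -> \bar R}) (f_ : nat -> T -> R) (f : T -> R) (C : \bar R) :
  (forall n, measurable_fun setT (f_ n)) -> (forall n x, 0 <= f_ n x) ->
  (forall x, f_ ^~ x @ \oo --> f x) ->
  (\forall n \near \oo, (\int[m]_x (f_ n x)%:E <= C)%E) ->
  (\int[m]_x (f x)%:E <= C)%E.
Proof.
move=> mf f0 fl [N _ NC].
pose F n x := (f_ (n + N)%N x)%:E.
have Fl x : F ^~ x @ \oo --> (f x)%:E.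
  apply: cvg_EFin; first exact: nearW.
  have := fl x; rewrite -(cvg_shiftn N); exact.
have -> : (\int[m]_x (f x)%:E = \int[m]_x limn_einf (F ^~ x))%E.
  by apply: eq_integral => x _; rewrite (cvg_limn_einf_sup (Fl x)).1.
apply: (le_trans (fatou m measurableT _ _)).
- by move=> n; rewrite /F; apply/measurable_EFinP; exact: mf.
- by move=> n x _; rewrite lee_fin.
- rewrite limn_einf_lim; apply: lime_le; first exact: is_cvg_einfs.
  apply: nearW => n; apply: (@le_trans _ _ (\int[m]_x F n x)%E).
    by apply: ereal_inf_lbound; exists n => /=.
  by apply: NC => /=; rewrite leq_addl.
Qed.

(** * Truncation, approximation in L^2 and the limit of the Poisson forms at height 0 *)

Section clip.
Context {R : realType}.
Implicit Types (c a b y : R).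

Definition clip c y := Num.max (- c) (Num.min c y).

Lemma clip_id c y : `|y| <= c -> clip c y = y.
Proof.
by rewrite /clip ler_norml => /andP[h1 h2]; rewrite min_r// max_r.
Qed.

Lemma normr_clip c y : 0 <= c -> `|clip c y| <= c.
Proof.
move=> c0; rewrite /clip ler_norml le_max lexx /= ge_max ge_min lexx /= andbT.
by rewrite lerNl (le_trans _ c0)// lerNl oppr0.
Qed.

Lemma clip_lip c a b : `|clip c a - clip c b| <= `|a - b|.
Proof.
rewrite /clip ler_norml.
by case: (ger0P (a - b)) => ab; apply/andP; split; case: (lerP c a) => ?;
  case: (lerP c b) => ?;
  repeat match goal with |- context [Num.max ?p ?q] => case: (lerP p q) => ? end;
  lra.
Qed.

Lemma clip_sub_le c y : 0 <= c -> `|y - clip c y| <= `|y|.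
Proof.
move=> c0; rewrite /clip; have [h|h] := lerP c y.
  rewrite max_r; last by lra.
  by rewrite !ger0_norm; lra.
have [h'|h'] := lerP (- c) y; first by rewrite subrr normr0.
by rewrite !ler0_norm; lra.
Qed.

Lemma continuous_clip c : continuous (clip c).
Proof.
move=> y; apply: (@continuous_max _ _ (cst (- c)) (fun y => Num.min c y)).
  exact: cst_continuous.
apply: (@continuous_min _ _ (cst c) id); first exact: cst_continuous.
exact: cvg_id.
Qed.

Lemma measurable_clip c : measurable_fun setT (clip c).
Proof. by apply: continuous_measurable_fun; exact: continuous_clip. Qed.

End clip.

Section plancherel.
Context {R : realType}.
Notation mu := (@lebesgue_measure R).
Notation mu2 := (mu \x mu)%E.
Implicit Types (f g h w : R -> R) (t d z M x y e : R).

Definition tn (n : nat) : R := n.+1%:R^-1.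

Lemma tn_gt0 n : 0 < tn n. Proof. by rewrite /tn invr_gt0. Qed.

Lemma tn_cvg : tn @ \oo --> (0 : R).
Proof. exact: cvg_harmonic. Qed.

(** For |z| >= d one has 1 + z^2 <= (1 + d^-2) z^2. So away from the origin the kernel is O(t) times
    the kernel at height 1, whose mass is known, and no tail integral has to be computed. *)
Lemma poisson_tail t d z : 0 < t -> 0 < d -> d <= `|z| ->
  poisson t z <= (1 + d ^- 2) * t * poisson 1 z.
Proof.
move=> t0 d0 dz; rewrite /poisson expr1n mul1r.
have z2 : d ^+ 2 <= z ^+ 2.
  by rewrite -[leRHS]real_normK ?num_real// !expr2 ler_pM// ltW.
have h : 1 <= d ^- 2 * z ^+ 2.
  by rewrite mulrC ler_pdivlMr ?exprn_gt0// mul1r.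
have A0 := sqD_gt0 z t0; have B0 : 0 < 1 + z ^+ 2 by have := sqD_gt0 z ltr01; rewrite expr1n.
rewrite ler_pdivrMr ?mulr_gt0 ?pi_gt0// mulrAC ler_pdivlMr ?mulr_gt0 ?pi_gt0//.
rewrite -subr_ge0 (_ : _ - _ = t * pi * ((1 + d ^- 2) * (t ^+ 2 + z ^+ 2) - (1 + z ^+ 2))); last by ring.
rewrite mulr_ge0// ?mulr_ge0 ?pi_ge0 ?(ltW t0)//.
have d20 : 0 <= d ^- 2 by rewrite invr_ge0 sqr_ge0.
have t20 := sqr_ge0 t.
by rewrite mulrDl mul1r mulrDr; have := mulr_ge0 d20 t20; lra.
Qed.

Lemma poisson_shift_integrable t x : 0 < t ->
  mu.-integrable setT (EFin \o (fun y => poisson t (x - y))).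
Proof.
move=> t0; have mp := measurable_poisson t0; apply: ge0_integrable.
- by solve_measurable.
- by move=> y; exact: poisson_ge0.
- by rewrite int_poisson// ltry.
Qed.

Lemma Rint_poisson t x : 0 < t -> \int[mu]_y poisson t (x - y) = 1.
Proof.
move=> t0; apply: EFin_inj.
by rewrite -integrable_fune ?int_poisson//; exact: poisson_shift_integrable.
Qed.

Lemma Pconv_le h M t x : 0 < t -> (forall y, `|h y| <= M) ->
  mu.-integrable setT (EFin \o h) ->
  `|\int[mu]_y (h y * poisson t (x - y))| <= M.
Proof.
move=> t0 hM hi; have pci := poisson_conv_integrable x t0 hi.
rewrite (le_trans (le_normr_Rintegral _ pci))//.
rewrite -[leRHS]mulr1 -(Rint_poisson x t0) -RintegralZl//; last exact: poisson_shift_integrable.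
apply: le_Rintegral => //; first exact: integrable_norm.
  exact/integrable_scale/poisson_shift_integrable.
by move=> y _; rewrite normrM (ger0_norm (poisson_ge0 _ t0)) ler_wpM2r// poisson_ge0.
Qed.

(** Approximate identity: continuity controls the points within d of x, and [poisson_tail] makes the
    remaining ones cost at most C times the height. *)
Lemma Pconv_cvg h M x : continuous h -> (forall y, `|h y| <= M) ->
  mu.-integrable setT (EFin \o h) ->
  (fun n => \int[mu]_y (h y * poisson (tn n) (x - y))) @ \oo --> h x.
Proof.
move=> ch hM hi; apply/cvgrPdist_le => e e0.
have e20 : 0 < e / 2 by rewrite divr_gt0.
have /cvgrPdist_le/(_ _ e20)/nbhs_ballP[d /= d0 dh] := ch x.
pose C := 2 * M * (1 + d ^- 2).
have M0 : 0 <= M by rewrite (le_trans _ (hM 0)).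
have C0 : 0 <= C by rewrite /C !mulr_ge0// addr_ge0// invr_ge0 sqr_ge0.
have [N _ hN] : \forall n \near \oo, C * tn n <= e / 2.
  have : (fun n => C * tn n) @ \oo --> C * 0 by apply: cvgMr; exact: tn_cvg.
  rewrite mulr0 => /cvgrPdist_le/(_ _ e20)[N _ hN]; exists N => // n /hN.
  by rewrite sub0r normrN; apply: le_trans; rewrite ler_norm.
exists N => // n /hN hn /=.
have t0 := tn_gt0 n.
have pi1 := poisson_shift_integrable x t0.
have pci := poisson_conv_integrable x t0 hi.
have mp := measurable_poisson t0; have mh := measurable_integrable hi.
rewrite -[h x]mulr1 -(Rint_poisson x t0) -RintegralZl// -RintegralB//; last exact: integrable_scale.
have hb : mu.-integrable setT (EFin \o (fun y => h x * poisson (tn n) (x - y) - h y * poisson (tn n) (x - y))).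
  have := integrableB measurableT (integrable_scale (h x) pi1) pci.
  by apply: eq_integrable.
rewrite (le_trans (le_normr_Rintegral _ hb))//.
have p11 := poisson_shift_integrable x (@ltr01 R).
apply: (@le_trans _ _ (\int[mu]_y (e / 2 * poisson (tn n) (x - y) + (C * tn n) * poisson 1 (x - y)))).
  apply: le_Rintegral => //; first exact: integrable_norm.
    by apply: integrable_add; exact: integrable_scale.
  move=> y _; rewrite -mulrBl normrM (ger0_norm (poisson_ge0 _ t0)).
  have [dxy|dxy] := ltrP `|x - y| d.
    rewrite (@le_trans _ _ (e / 2 * poisson (tn n) (x - y)))//.
      by rewrite ler_wpM2r ?poisson_ge0//; apply: dh.
    by rewrite lerDl mulr_ge0 ?poisson_ge0// mulr_ge0// ltW.
  rewrite (@le_trans _ _ (C * tn n * poisson 1 (x - y)))//; last first.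
    by rewrite lerDr mulr_ge0 ?poisson_ge0// ltW.
  have hxy : `|h x - h y| <= 2 * M.
    by rewrite (le_trans (ler_normB _ _))//; have := hM x; have := hM y; lra.
  apply: (le_trans (ler_pM _ _ hxy (poisson_tail t0 d0 dxy))) => //; first exact: poisson_ge0.
  by rewrite /C !mulrA.
rewrite RintegralD//; [|exact: integrable_scale|exact: integrable_scale].
rewrite [X in X + _]RintegralZl// [X in _ + X]RintegralZl// !Rint_poisson// !mulr1.
by lra.
Qed.

Lemma dominated_cvg_Rintegral (f_ : nat -> R -> R) f g :
  (forall n, measurable_fun setT (f_ n)) ->
  (forall x, f_ ^~ x @ \oo --> f x) ->
  mu.-integrable setT (EFin \o g) -> (forall n x, `|f_ n x| <= g x) ->
  (fun n => \int[mu]_x f_ n x) @ \oo --> \int[mu]_x f x.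
Proof.
move=> mf fl gi fg.
have mlim : measurable_fun setT f.
  exact: (measurable_fun_cvg mf (fun x _ => fl x)).
have [] := @dominated_convergence _ _ _ mu setT measurableT
  (fun n x => (f_ n x)%:E) (EFin \o f) (EFin \o g).
- by move=> n; have := mf n => m1; solve_measurable.
- by solve_measurable.
- by apply: aeW => x _ /=; apply: cvg_EFin; [exact: nearW|exact: fl].
- exact: gi.
- by apply: aeW => x n _ /=; rewrite lee_fin.
move=> fi _; rewrite (integrable_fune fi) => /fine_cvg.
exact.
Qed.

Lemma poisson_form_cvg_continuous h M : continuous h -> (forall y, `|h y| <= M) -> L12 h ->
  (fun n => poisson_form (tn n) h h) @ \oo --> sqnorm h.
Proof.
move=> ch hM Lh; have [hi h2] := Lh; have mh := measurable_integrable hi.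
have M0 : 0 <= M by rewrite (le_trans _ (hM 0)).
rewrite /poisson_form /sqnorm.
apply: (@dominated_cvg_Rintegral _ _ (fun x => M * `|h x|)).
- move=> n; exact: (measurable_integrable (poisson_form_integrable (tn_gt0 n) (L12_L2 Lh) Lh)).
- by move=> x; rewrite expr2; apply: cvgMr; exact: (Pconv_cvg ch hM hi).
- exact/integrable_scale/integrable_norm.
- by move=> n x; rewrite normrM mulrC ler_wpM2r//; exact: (Pconv_le _ (tn_gt0 n) hM hi).
Qed.

Lemma L2_le f g : measurable_fun setT f -> (forall x, `|f x| <= `|g x|) -> L2 g -> L2 f.
Proof.
move=> mf fg [mg gi]; split=> //; apply: (integrableP_real _ _ gi); first by solve_measurable.
move=> x; rewrite ger0_norm ?sqr_ge0// -[f x ^+ 2]real_normK ?num_real//.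
by rewrite -[g x ^+ 2]real_normK ?num_real// !expr2 ler_pM.
Qed.

Lemma L2_truncation w e : L2 w -> 0 < e -> exists N : nat,
  (\int[mu]_x ((w x - \1_(`[- N%:R, N%:R]) x * clip N%:R (w x)) ^+ 2)%:E <= e%:E)%E.
Proof.
move=> [mw w2] e0.
pose v n x := \1_(`[- n%:R, n%:R]) x * clip n%:R (w x) : R.
have mv n : measurable_fun setT (v n).
  have m1 : measurable_fun setT (\1_(`[- n%:R, n%:R]) : R -> R) by exact: measurable_indic.
  by have mc := @measurable_clip R n%:R; rewrite /v; solve_measurable.
have wv n x : `|w x - v n x| <= `|w x|.
  rewrite /v indicE; case: (x \in _); rewrite ?mul1r ?mul0r ?subr0//.
  exact: clip_sub_le.
have wv2 n x : `|(w x - v n x) ^+ 2| <= w x ^+ 2.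
  rewrite normrX; rewrite -[w x ^+ 2]real_normK ?num_real// !expr2.
  by rewrite ler_pM.
have : (fun n => \int[mu]_x ((w x - v n x) ^+ 2)) @ \oo --> \int[mu]_x (cst (0 : R) x).
  apply: (dominated_cvg_Rintegral _ _ w2 wv2).
  - by move=> n; have := mv n => m1; solve_measurable.
  - move=> x; apply: cvg_near_cst; near=> n.
    rewrite /v clip_id; last first.
      by near: n; exact: nbhs_infty_ger.
    rewrite indicE mem_set ?mul1r ?subrr ?expr0n//= in_itv/= -ler_norml.
    by near: n; exact: nbhs_infty_ger.
rewrite Rintegral_cst// mul0r => /cvgrPdist_le/(_ _ e0)[N _ /(_ N (leqnn _))].
rewrite sub0r normrN => hN; exists N.
rewrite integrable_fune ?lee_fin ?(le_trans _ hN) ?ler_norm//.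
apply: (integrableP_real _ (wv2 N) w2).
by have := mv N => m1; solve_measurable.
Unshelve. all: by end_near. Qed.


Lemma int_le_real f g : (forall x, 0 <= f x) -> (forall x, f x <= g x) ->
  (\int[mu]_x (f x)%:E <= \int[mu]_x (g x)%:E)%E.
Proof. by move=> f0 fg; apply: le_ge0_integralT => x; rewrite lee_fin. Qed.

Lemma int_scale k f : 0 <= k -> measurable_fun setT f -> (forall x, 0 <= f x) ->
  (\int[mu]_x (k * f x)%:E = k%:E * \int[mu]_x (f x)%:E)%E.
Proof.
move=> k0 mf f0; under eq_integral => x _ do rewrite EFinM.
rewrite ge0_integralZl_EFin//; first by move=> x _; rewrite lee_fin.
by solve_measurable.
Qed.

Lemma int_addZ_le f g k (a b : R) : measurable_fun setT f ->
  (forall x, 0 <= f x) -> measurable_fun setT g -> (forall x, 0 <= g x) ->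
  0 <= k -> (\int[mu]_x (f x)%:E <= a%:E)%E -> (\int[mu]_x (g x)%:E <= b%:E)%E ->
  (\int[mu]_x (k * f x + k * g x)%:E <= (k * a + k * b)%:E)%E.
Proof.
move=> mf f0 mg g0 k0 fa gb.
under eq_integral => x _ do rewrite EFinD.
rewrite ge0_integralD//; last 4 first.
- by move=> x _; rewrite lee_fin mulr_ge0.
- by solve_measurable.
- by move=> x _; rewrite lee_fin mulr_ge0.
- by solve_measurable.
rewrite !int_scale//.
by rewrite EFinD !EFinM leeD// lee_wpmul2l ?lee_fin.
Qed.

Lemma integrable_bounded_support f N M : measurable_fun setT f -> 0 <= M ->
  (forall x, `|f x| <= M) -> (forall x, N < `|x| -> f x = 0) ->
  mu.-integrable setT (EFin \o f).
Proof.
move=> mf M0 fM f0.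
pose E : set R := `[- N, N]%classic.
apply: (@integrableP_real _ _ (fun x => M * \1_E x)) => //.
  move=> x; rewrite indicE; have [xE|xE] := boolP (x \in E); first by rewrite mulr1.
  rewrite f0 ?normr0 ?mulr0// ltNge; apply/negP => xN; move/negP: xE; apply.
  by rewrite inE /E /= in_itv/= -ler_norml.
have mE : measurable E by exact: measurable_itv.
apply: integrable_scale; apply: ge0_integrable.
- exact: measurable_indic.
- by move=> x; rewrite indicE.
have muE : (mu E < +oo)%E.
  by rewrite lebesgue_measure_itv/=; case: ifP => _; rewrite ?ltry.
by rewrite integral_indic// setIT.
Qed.

Lemma L12_bounded_support f N M : measurable_fun setT f -> 0 <= M ->
  (forall x, `|f x| <= M) -> (forall x, N < `|x| -> f x = 0) -> L12 f.
Proof.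
move=> mf M0 fM f0; split; first exact: (integrable_bounded_support mf M0 fM f0).
apply: (@integrable_bounded_support _ N (M ^+ 2)).
- by solve_measurable.
- exact: sqr_ge0.
- by move=> x; rewrite normrX !expr2 ler_pM.
- by move=> x /f0 ->; rewrite expr0n.
Qed.

(** After truncation to a bounded function of bounded support, approximation in L^1 suffices: once
    the approximant is clipped to the same bound n, the squared difference is at most 2 n times the
    difference. *)
Lemma L2_approx w e : L2 w -> 0 < e -> exists h M,
  [/\ continuous h, (forall x, `|h x| <= M), L12 h &
    (\int[mu]_x ((w x - h x) ^+ 2)%:E <= e%:E)%E].
Proof.
move=> Lw e0; have [mw _] := Lw.
have e40 : 0 < e / 4 by rewrite divr_gt0.
have [N hN] := L2_truncation Lw e40.
set n : R := N%:R in hN.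
have n0 : 0 <= n by rewrite /n ler0n.
pose v x : R := \1_(`[- n, n]) x * clip n (w x).
have mc := @measurable_clip R n.
have mv : measurable_fun setT v.
  have m1 : measurable_fun setT (\1_(`[- n, n]) : R -> R) by exact: measurable_indic.
  by rewrite /v; solve_measurable.
have vn x : `|v x| <= n.
  by rewrite /v indicE; case: (x \in _); rewrite ?mul1r ?mul0r ?normr0//; exact: normr_clip.
have v0 x : n < `|x| -> v x = 0.
  move=> nx; rewrite /v indicE memNset ?mul0r//= in_itv/= -ler_norml.
  by apply/negP; rewrite -ltNge.
have vclip x : clip n (v x) = v x by rewrite clip_id.
pose E : set R := `[- (n + 1), n + 1]%classic.
have mE : measurable E by exact: measurable_itv.
have muE : (mu E < +oo)%E.
  by rewrite lebesgue_measure_itv/=; case: ifP => _; rewrite ?ltry.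
have vE : mu.-integrable E (EFin \o v).
  apply: (@integrableS _ _ _ mu setT) => //.
  exact: (integrable_bounded_support mv n0 vn v0).
have [g_ [cg _ gv]] := approximation_continuous_integrable mE muE vE.
(* Chosen so that 2 n eta <= e / 4. *)
pose eta := e / (8 * (n + 1)).
have eta0 : 0 < eta by rewrite divr_gt0// mulr_gt0// ltr_wpDl.
have [k hk] : exists k, (\int[mu]_(z in E) `|(v z - g_ k z)%:E| <= eta%:E)%E.
  move/fine_cvgP : gv => [[N1 _ hN1] /cvgrPdist_le/(_ _ eta0)[N2 _ hN2]].
  exists (maxn N1 N2).
  have := hN1 (maxn N1 N2) (leq_maxl _ _); have := hN2 (maxn N1 N2) (leq_maxr _ _).
  rewrite /= sub0r normrN => h1 h2.
  by rewrite -(fineK h2) lee_fin (le_trans _ h1)// ler_norm.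
set g := g_ k in hk.
(* A trapezoid, equal to 1 on the support of [v]: it makes the approximant vanish far out without
   spoiling its continuity or its distance to [v]. *)
pose chi x : R := Num.max 0 (Num.min 1 (n + 1 - `|x|)).
have cchi : continuous chi.
  move=> x; apply: (@continuous_max _ _ (cst 0) (fun y => Num.min 1 (n + 1 - `|y|))).
    exact: cst_continuous.
  apply: (@continuous_min _ _ (cst 1) (fun y => n + 1 - `|y|)); first exact: cst_continuous.
  by apply: cvgB; [exact: cvg_cst|exact: norm_continuous].
have chi01 x : 0 <= chi x <= 1.
  by rewrite /chi le_max lexx /= ge_max ler01 ge_min lexx.
have chi1 x : `|x| <= n -> chi x = 1.
  by move=> xn; rewrite /chi min_l ?max_r//; lra.
have chi0 x : n + 1 < `|x| -> chi x = 0.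
  by move=> xn; rewrite /chi max_l// ge_min; apply/orP; right; lra.
pose h x := clip n (g x) * chi x.
have ch : continuous h.
  move=> x; apply: cvgM; last exact: cchi.
  by apply: (@continuous_comp _ _ _ g (clip n)); [exact: cg|exact: continuous_clip].
have mh : measurable_fun setT h by exact: continuous_measurable_fun.
have hn x : `|h x| <= n.
  have /andP[c0 c1] := chi01 x.
  by rewrite /h normrM (ger0_norm c0) -[leRHS]mulr1 ler_pM// normr_clip.
have h0 x : n + 1 < `|x| -> h x = 0 by move=> /chi0; rewrite /h => ->; rewrite mulr0.
have Lh := L12_bounded_support mh n0 hn h0.
have mg : measurable_fun setT g by apply: continuous_measurable_fun; exact: cg.
exists h, n; split => //.
have vh : (\int[mu]_x ((v x - h x) ^+ 2)%:E <= (e / 4)%:E)%E.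
  apply: (@le_trans _ _ (\int[mu]_x ((2 * n)%:E * ((EFin \o (fun z => `|v z - g z|)%R) \_ E) x))%E).
    apply: le_ge0_integralT => x; first by rewrite lee_fin sqr_ge0.
    rewrite /patch; have [xE|xE] := boolP (x \in E).
      rewrite /= -EFinM lee_fin -[leLHS]real_normK ?num_real// expr2.
      apply: ler_pM => //.
        by rewrite (le_trans (ler_normB _ _))//; have := vn x; have := hn x; lra.
      have vchi : v x = v x * chi x.
        by have [xn|xn] := lerP `|x| n; [rewrite chi1 ?mulr1|rewrite v0 ?mul0r].
      have /andP[c0 c1] := chi01 x.
      rewrite /h [in leLHS]vchi -mulrBl normrM (ger0_norm c0) -[leRHS]mulr1 ler_pM//.
      by rewrite -{1}vclip; exact: clip_lip.
    have xn : n + 1 < `|x|.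
      rewrite ltNge; apply/negP => xN; move/negP: xE; apply.
      by rewrite inE /E /= in_itv/= -ler_norml.
    rewrite h0// v0 ?subrr ?expr0n ?mule0//.
    by rewrite (lt_trans _ xn)// ltrDl.
  rewrite ge0_integralZl_EFin//; last 3 first.
  - by move=> x _; rewrite erestrict_ge0// => y _ /=; rewrite lee_fin.
  - apply/(measurable_restrictT _ _).1 => //; apply: measurable_funTS; by solve_measurable.
  - by rewrite mulr_ge0.
  rewrite -integral_mkcond.
  apply: (@le_trans _ _ ((2 * n)%:E * eta%:E)%E).
    by rewrite lee_wpmul2l// lee_fin mulr_ge0.
  rewrite -EFinM lee_fin /eta.
  rewrite mulrA ler_pdivrMr ?mulr_gt0//; last by rewrite ltr_wpDl.
  by nra.
apply: (@le_trans _ _ (\int[mu]_x (2 * (w x - v x) ^+ 2 + 2 * (v x - h x) ^+ 2)%:E)%E).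
  apply: int_le_real => x; first exact: sqr_ge0.
  rewrite -subr_ge0 (_ : _ - _ = ((w x - v x) - (v x - h x)) ^+ 2); first exact: sqr_ge0.
  by ring.
have -> : e = 2 * (e / 4) + 2 * (e / 4) by field.
apply: int_addZ_le => //; [by solve_measurable|by move=> x; exact: sqr_ge0|by solve_measurable|by move=> x; exact: sqr_ge0].
Qed.

(** The energy of [w - h] is small uniformly in the height by [poisson_energy_le], and that of the
    continuous [h] tends to 0 by [poisson_form_cvg_continuous]. *)
Lemma poisson_energy_cvg0 w e : L12 w -> 0 < e -> \forall n \near \oo, (poisson_energy (tn n) w <= e%:E)%E.
Proof.
move=> Lw e0; have L := L12_L2 Lw; have [mw _] := L.
(* The two terms cost 2 * 4 * e / 16 and 2 * 2 * e / 16, together less than e. *)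
have e16 : 0 < e / 16 by rewrite divr_gt0.
have [h [M [ch hM Lh wh]]] := L2_approx L e16.
have /cvgrPdist_le/(_ _ e16)[N _ hN] := poisson_form_cvg_continuous ch hM Lh.
exists N => // n /hN /= hn.
have mh := measurable_integrable Lh.1.
have t0 := tn_gt0 n.
have -> : w = (fun x => (w x - h x) + h x) by apply/funext => x; rewrite subrK.
have mwh : measurable_fun setT (fun x => w x - h x) by solve_measurable.
apply: (le_trans (poisson_energy_add t0 mwh mh)).
rewrite (DtE t0 Lh).
apply: (@le_trans _ _ (2%:E * (4%:E * (e / 16)%:E) + 2%:E * (2 * (e / 16))%:E)%E).
  apply: leeD.
    rewrite lee_wpmul2l ?lee_fin//; apply: (le_trans (poisson_energy_le t0 mwh)).
    by rewrite lee_wpmul2l ?lee_fin.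
  rewrite lee_wpmul2l ?lee_fin// ler_wpM2l//.
  by rewrite (le_trans _ hn)// ler_norm.
by rewrite -!EFinM -EFinD lee_fin; lra.
Qed.

Lemma poisson_form_cvg w : L12 w -> (fun n => poisson_form (tn n) w w) @ \oo --> sqnorm w.
Proof.
move=> Lw; apply/cvgrPdist_le => e e0.
have [N _ hN] := poisson_energy_cvg0 Lw e0; exists N => // n /hN.
rewrite (DtE (tn_gt0 n) Lw) lee_fin => hn /=.
have := poisson_energy_ge0 w (tn_gt0 n); rewrite (DtE (tn_gt0 n) Lw) lee_fin => hn0.
by rewrite ger0_norm; lra.
Qed.

End plancherel.

(** Keeps the iterated integral accessible by rewriting after [poisson_form] becomes opaque. *)
Lemma BtEiter {R : realType} (t : R) f g :
  poisson_form t f g = \int[lebesgue_measure]_x (f x * \int[lebesgue_measure]_y (g y * poisson t (x - y))).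
Proof. by []. Qed.

(* Unification tends to unfold [poisson_form] and then to diverge. *)
#[local] Opaque poisson_form.

(** * Plancherel and the Gagliardo integral in frequency *)

Section fourier_energy.
Context {R : realType}.
Notation mu := (@lebesgue_measure R).
Notation mu2 := (mu \x mu)%E.
Implicit Types (f g h w u : R -> R) (t d x y e a : R).

(** Squared modulus of the transform without its normalization, hence the factors 2 pi below. *)
Definition fourier_sq w xi := cosT w xi ^+ 2 + sinT w xi ^+ 2.

Lemma fourier_sq_ge0 w xi : 0 <= fourier_sq w xi.
Proof. by rewrite addr_ge0 ?sqr_ge0. Qed.

Lemma measurable_fourier_sq w : mu.-integrable setT (EFin \o w) -> measurable_fun setT (fourier_sq w).
Proof.
move=> wi; have mc := measurable_cosT wi; have ms := measurable_sinT wi.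
by rewrite /fourier_sq; solve_measurable.
Qed.

Lemma int_ew_fourier_sq t w : 0 < t -> mu.-integrable setT (EFin \o w) ->
  (\int[mu]_xi (ew t xi * fourier_sq w xi)%:E = (2 * pi * poisson_form t w w)%:E)%E.
Proof.
move=> t0 wi; rewrite -(fourier_poisson t0 wi wi) -integrable_fune; last first.
  exact: fourier_poisson_integrable.
by apply: eq_integral => xi _; rewrite /fourier_sq !expr2.
Qed.

Lemma poisson_form_le_sqnorm t w : 0 < t -> L12 w -> poisson_form t w w <= sqnorm w.
Proof.
move=> t0 Lw; have := poisson_energy_ge0 w t0; rewrite DtE// lee_fin.
by rewrite pmulr_rge0// subr_ge0.
Qed.

Lemma ew_tn_cvg xi : (fun n => ew (@tn R n) xi) @ \oo --> (1 : R).
Proof.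
rewrite /ew -(@expR0 R).
apply: (@cvg_comp _ _ _ (fun n => - (tn n * `|xi|)) expR); last exact: continuous_expR.
have : (fun n => - (tn n * `|xi|)) @ \oo --> - (0 * `|xi|).
  by apply: cvgN; apply: cvgMl; exact: tn_cvg.
by rewrite mul0r oppr0.
Qed.

Lemma int_fourier_sq_le w : L12 w -> (\int[mu]_xi (fourier_sq w xi)%:E <= (2 * pi * sqnorm w)%:E)%E.
Proof.
move=> Lw; have mf := measurable_fourier_sq Lw.1.
apply: (@fatou_le _ _ _ mu (fun n xi => ew (tn n) xi * fourier_sq w xi)).
- by move=> n; have me := @measurable_ew R (tn n); solve_measurable.
- by move=> n xi; rewrite mulr_ge0 ?ew_ge0 ?fourier_sq_ge0.
- by move=> xi; rewrite -[X in _ --> X]mul1r; apply: cvgMl; exact: ew_tn_cvg.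
- apply: nearW => n; rewrite int_ew_fourier_sq ?tn_gt0//; last exact: Lw.1.
  by rewrite lee_fin ler_wpM2l ?mulr_ge0 ?pi_ge0// poisson_form_le_sqnorm// tn_gt0.
Qed.

Lemma integrable_fourier_sq w : L12 w -> mu.-integrable setT (EFin \o fourier_sq w).
Proof.
move=> Lw; apply: ge0_integrable; [exact: (measurable_fourier_sq Lw.1)|exact: fourier_sq_ge0|].
by apply: le_lt_trans (int_fourier_sq_le Lw) _; rewrite ltry.
Qed.

(** Fatou gives one inequality. For the other, the damped integrals lie below the full one and equal
    2 pi times Poisson forms, which converge to the squared norm. *)
Lemma plancherel w : L12 w -> (\int[mu]_xi (fourier_sq w xi)%:E = (2 * pi * sqnorm w)%:E)%E.
Proof.
move=> Lw; apply/eqP; rewrite eq_le int_fourier_sq_le//=.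
have fi := integrable_fourier_sq Lw.
rewrite integrable_fune// lee_fin.
have h : (fun n => 2 * pi * poisson_form (tn n) w w) @ \oo --> 2 * pi * sqnorm w.
  by apply: cvgMr; exact: poisson_form_cvg.
rewrite -(cvg_lim _ h)//; apply: limr_le; first by apply/cvg_ex; eexists; exact: h.
apply: nearW => n; have t0 := @tn_gt0 R n.
rewrite -lee_fin -int_ew_fourier_sq//; last exact: Lw.1.
rewrite -integrable_fune//; apply: int_le_real => xi.
  by rewrite mulr_ge0 ?ew_ge0 ?fourier_sq_ge0.
by rewrite ler_piMl ?fourier_sq_ge0// ew_le1// ltW.
Qed.

(** Plancherel minus its damped version; [DtE] recognizes the difference as a Poisson energy. *)
Lemma int_1ew_fourier_sq t w : 0 < t -> L12 w ->
  (\int[mu]_xi ((1 - ew t xi) * fourier_sq w xi)%:E = pi%:E * poisson_energy t w)%E.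
Proof.
move=> t0 Lw; have fi := integrable_fourier_sq Lw; have mf := measurable_fourier_sq Lw.1.
have ei : mu.-integrable setT (EFin \o (fun xi => ew t xi * fourier_sq w xi)).
  apply: (integrableP_real _ _ fi); first by have me := @measurable_ew R t; solve_measurable.
  move=> xi; rewrite normrM !ger0_norm ?ew_ge0 ?fourier_sq_ge0//.
  by rewrite ler_piMl ?fourier_sq_ge0// ew_le1// ltW.
under eq_integral => xi _ do rewrite mulrBl mul1r.
rewrite integralB_EFin// plancherel// int_ew_fourier_sq//; last exact: Lw.1.
by rewrite DtE// -EFinB -EFinM; congr EFin; ring.
Qed.

(** Limit of (pi / t) [poisson_energy t w] as t tends to 0, because pi / t times the kernel is 1 /
    (t^2 + z^2). On the diagonal the quotient is 0 / 0, which has the value 0. *)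
Definition gagliardo w : \bar R :=
  (\int[mu2]_z ((w z.1 - w z.2) ^+ 2 / (z.1 - z.2) ^+ 2)%:E)%E.

Lemma gagliardo_approx_le (a z t : R) : 0 < t -> (z = 0 -> a = 0) ->
  pi / t * (poisson t z * a ^+ 2) <= a ^+ 2 / z ^+ 2.
Proof.
move=> t0; have [->|z0 _] := eqVneq z 0.
  by move=> ->//; rewrite expr0n /= mulr0 mulr0 mul0r.
have z20 : 0 < z ^+ 2 by rewrite exprn_even_gt0.
rewrite /poisson mulrA (_ : _ / _ * _ = (t ^+ 2 + z ^+ 2)^-1); last first.
  have h := gt_eqF (sqD_gt0 z t0); have t0' := gt_eqF t0.
  have := @pi_neq0 R; generalize (pi : R) => p p0.
  by field; rewrite ?p0 ?h ?t0'.
rewrite mulrC ler_wpM2l ?sqr_ge0// lef_pV2 ?posrE ?sqD_gt0//.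
by rewrite lerDr sqr_ge0.
Qed.

Lemma gagliardo_approx_cvg (a z : R) : (z = 0 -> a = 0) ->
  (fun n => pi / tn n * (poisson (tn n) z * a ^+ 2)) @ \oo --> a ^+ 2 / z ^+ 2.
Proof.
have [->|z0 _] := eqVneq z 0.
  move=> ->//; rewrite expr0n /= mul0r.
  by under eq_fun do rewrite !mulr0; exact: cvg_cst.
have -> : (fun n => pi / tn n * (poisson (tn n) z * a ^+ 2)) =
    (fun n => a ^+ 2 * (tn n ^+ 2 + z ^+ 2)^-1).
  apply/funext => n; have t0 := @tn_gt0 R n.
  have h := gt_eqF (sqD_gt0 z t0); have t0' := gt_eqF t0.
  rewrite /poisson; have := @pi_neq0 R; generalize (pi : R) => p p0.
  by field; rewrite ?p0 ?h ?t0'.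
apply: cvgMr; apply: cvgV; first by rewrite sqrf_eq0.
rewrite -[X in _ --> X]add0r; apply: cvgD; last exact: cvg_cst.
rewrite -[X in _ --> X](expr0n _ 2).
apply: (@cvg_comp _ _ _ tn (fun x => x ^+ 2)); first exact: tn_cvg.
exact: exprn_continuous.
Qed.

Lemma gagliardo_diag w (z : R * R) : z.1 - z.2 = 0 -> w z.1 - w z.2 = 0.
Proof. by move=> /eqP; rewrite subr_eq0 => /eqP ->; rewrite subrr. Qed.

(** Measurable as a pointwise limit of the Poisson integrands, which have no singularity on the
    diagonal. *)
Lemma measurable_gagliardo w : measurable_fun setT w ->
  measurable_fun setT (fun z : R * R => (w z.1 - w z.2) ^+ 2 / (z.1 - z.2) ^+ 2).
Proof.
move=> mw.
apply: (measurable_fun_cvg _ (fun z _ => gagliardo_approx_cvg (@gagliardo_diag w z))) => n.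
by have mp := measurable_poisson (@tn_gt0 R n); solve_measurable.
Qed.

Lemma poisson_energy_scaled t w : 0 < t -> measurable_fun setT w ->
  (\int[mu2]_z (pi / t * (poisson t (z.1 - z.2) * (w z.1 - w z.2) ^+ 2))%:E =
   (pi / t)%:E * poisson_energy t w)%E.
Proof.
move=> t0 mw; under eq_integral => z _ do rewrite EFinM.
rewrite ge0_integralZl_EFin//.
- by move=> z _; rewrite lee_fin mulr_ge0 ?poisson_ge0 ?sqr_ge0.
- by have mp := measurable_poisson t0; solve_measurable.
- by rewrite divr_ge0 ?pi_ge0// ltW.
Qed.

Lemma poisson_energy_le_gagliardo t w : 0 < t -> measurable_fun setT w ->
  ((pi / t)%:E * poisson_energy t w <= gagliardo w)%E.
Proof.
move=> t0 mw; rewrite -poisson_energy_scaled//; apply: le_ge0_integralT => z; rewrite lee_fin.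
  by rewrite mulr_ge0 ?divr_ge0 ?pi_ge0 ?(ltW t0)// mulr_ge0 ?poisson_ge0 ?sqr_ge0.
by apply: gagliardo_approx_le => //; exact: gagliardo_diag.
Qed.

Lemma gagliardo_le w (C : \bar R) : measurable_fun setT w ->
  (forall t, (0 < t)%R -> (pi / t)%:E * poisson_energy t w <= C)%E -> (gagliardo w <= C)%E.
Proof.
move=> mw h.
apply: (@fatou_le _ _ _ mu2 (fun n z => pi / tn n * (poisson (tn n) (z.1 - z.2) * (w z.1 - w z.2) ^+ 2))).
- by move=> n; have mp := measurable_poisson (@tn_gt0 R n); solve_measurable.
- move=> n z; have t0 := @tn_gt0 R n.
  by rewrite mulr_ge0 ?divr_ge0 ?pi_ge0 ?(ltW t0)// mulr_ge0 ?poisson_ge0 ?sqr_ge0.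
- by move=> z; apply: gagliardo_approx_cvg; exact: gagliardo_diag.
- by apply: nearW => n; rewrite poisson_energy_scaled ?tn_gt0//; apply: h; exact: tn_gt0.
Qed.

Lemma onemew_bounds t a : 0 < t -> 0 <= a ->
  a - t * a ^+ 2 <= t^-1 * (1 - expR (- (t * a))) <= a.
Proof.
move=> t0 a0; have ta0 : 0 <= t * a by rewrite mulr_ge0// ltW.
apply/andP; split; last first.
  by rewrite ler_pdivrMl//; have := expR_ge1Dx (- (t * a)); lra.
rewrite ler_pdivlMl//.
have h : expR (- (t * a)) * (1 + t * a) <= 1.
  rewrite expRN ler_pdivrMl ?expR_gt0// mulr1; exact: expR_ge1Dx.
have e0 := expR_ge0 (- (t * a)).
(* With x = t a, exp (- x) (1 + x) <= 1 <= 1 + x^3 = (1 - x + x^2) (1 + x). *)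
have : expR (- (t * a)) <= 1 - t * a + (t * a) ^+ 2.
  set x := t * a in ta0 h e0 *.
  have : expR (- x) * (1 + x) <= (1 - x + x ^+ 2) * (1 + x).
    rewrite (le_trans h)// -subr_ge0 (_ : _ - _ = x ^+ 3); last by ring.
    by rewrite exprn_ge0.
  by rewrite ler_pM2r//; lra.
by rewrite exprMn; lra.
Qed.

Lemma onemew_cvg a : 0 <= a ->
  (fun n => (tn n)^-1 * (1 - expR (- (tn n * a)))) @ \oo --> a.
Proof.
move=> a0.
apply: (@squeeze_cvgr _ _ _ _ (fun n => a - tn n * a ^+ 2) (fun=> a)).
- by apply: nearW => n; exact: (onemew_bounds (@tn_gt0 R n) a0).
- rewrite -[X in _ --> X]subr0 -(mul0r (a ^+ 2)).
  by apply: cvgB; [exact: cvg_cst|apply: cvgMl; exact: tn_cvg].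
- exact: cvg_cst.
Qed.

(** (1 - exp (- t |xi|)) / t tends to |xi|, and its integral against [fourier_sq w] is (pi / t)
    times a Poisson energy. This direction brings the geometric energy of a layer back to the
    frequency side. *)
Lemma int_abs_fourier_sq_le w : L12 w -> (\int[mu]_xi (`|xi| * fourier_sq w xi)%:E <= gagliardo w)%E.
Proof.
move=> Lw; have mf := measurable_fourier_sq Lw.1; have mw := measurable_integrable Lw.1.
apply: (@fatou_le _ _ _ mu (fun n xi => (tn n)^-1 * (1 - ew (tn n) xi) * fourier_sq w xi)).
- by move=> n; have me := @measurable_ew R (tn n); solve_measurable.
- move=> n xi; have t0 := @tn_gt0 R n.
  by rewrite mulr_ge0 ?fourier_sq_ge0// mulr_ge0 ?invr_ge0 ?(ltW t0)// subr_ge0 ew_le1// ltW.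
- by move=> xi; apply: cvgMl; exact: onemew_cvg.
- apply: nearW => n; have t0 := @tn_gt0 R n.
  under eq_integral => xi _ do rewrite -mulrA.
  rewrite int_scale ?invr_ge0 ?(ltW t0)//; last 2 first.
  + by have me := @measurable_ew R (tn n); solve_measurable.
  + by move=> xi; rewrite mulr_ge0 ?fourier_sq_ge0// subr_ge0 ew_le1// ltW.
  rewrite int_1ew_fourier_sq// muleA -EFinM mulrC.
  exact: poisson_energy_le_gagliardo.
Qed.

End fourier_energy.

(** * The unit ball *)

Section unit_ball.
Context {R : realType}.
Notation mu := (@lebesgue_measure R).
Notation mu2 := (mu \x mu)%E.
Implicit Types (f g h w u : R -> R) (t d x y e a : R).

Definition cut (n : nat) u x : R := \1_(`[- n%:R, n%:R]) x * u x.

Lemma measurable_cut n u : measurable_fun setT u -> measurable_fun setT (cut n u).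
Proof.
move=> mu_; have m1 : measurable_fun setT (\1_(`[- n%:R, n%:R]) : R -> R).
  exact: measurable_indic.
by rewrite /cut; solve_measurable.
Qed.

Lemma cut_le n u x : `|cut n u x| <= `|u x|.
Proof. by rewrite /cut indicE; case: (x \in _); rewrite ?mul1r ?mul0r ?normr0. Qed.

Lemma cut_eq (n : nat) u x : `|x| <= n%:R -> cut n u x = u x.
Proof. by move=> xn; rewrite /cut indicE mem_set ?mul1r//= in_itv/= -ler_norml. Qed.

Lemma cut_cvg u x : (fun n => cut n u x) @ \oo --> u x.
Proof.
apply: cvg_near_cst; near=> n; apply: cut_eq.
by near: n; exact: nbhs_infty_ger.
Unshelve. all: by end_near. Qed.

Lemma L12_cut n u : L2 u -> L12 (cut n u).
Proof.
move=> Lu; have [mu_ u2] := Lu; have mc := measurable_cut n mu_.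
have Lc : L2 (cut n u) by apply: (L2_le mc _ Lu) => x; exact: cut_le.
split; last by case: Lc.
have m1 : measurable_fun setT (\1_(`[- n%:R, n%:R]) : R -> R) by exact: measurable_indic.
have i1 : mu.-integrable setT (EFin \o (\1_(`[- n%:R, n%:R]) : R -> R)).
  apply: (@integrable_bounded_support _ _ n%:R 1) => //.
  - by move=> x; rewrite indicE; case: (x \in _); rewrite ?normr1 ?normr0.
  - move=> x nx; rewrite indicE memNset//= in_itv/= -ler_norml.
    by apply/negP; rewrite -ltNge.
apply: (@integrableP_real _ _ (fun x => u x ^+ 2 + \1_(`[- n%:R, n%:R]) x)) => //.
  move=> x; rewrite /cut indicE; case: (x \in _); last first.
    by rewrite mul0r normr0 addr0 sqr_ge0.
  rewrite mul1r -[u x ^+ 2]real_normK ?num_real//.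
  rewrite mulr1n; have := sqr_ge0 (`|u x| - 1); have := normr_ge0 (u x); set a := `|u x|; nra.
exact: integrable_add.
Qed.

Lemma ft_reE u n xi : ft_re u n xi = (Num.sqrt (2 * pi))^-1 * cosT (cut n u) xi.
Proof.
rewrite /ft_re /cosT; congr (_ * _); rewrite Rintegral_mkcond.
apply: eq_Rintegral => x _; rewrite /patch /cut indicE.
by case: (x \in _); rewrite ?mul1r ?mul0r.
Qed.

Lemma ft_imE u n xi : ft_im u n xi = - ((Num.sqrt (2 * pi))^-1 * sinT (cut n u) xi).
Proof.
rewrite /ft_im /sinT; congr (- (_ * _)); rewrite Rintegral_mkcond.
apply: eq_Rintegral => x _; rewrite /patch /cut indicE.
by case: (x \in _); rewrite ?mul1r ?mul0r.
Qed.

Lemma twopi_gt0 : 0 < 2 * pi :> R.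
Proof. by rewrite mulr_gt0 ?pi_gt0. Qed.

Lemma onem_ew_ge0 t x : 0 < t -> 0 <= 1 - ew t x.
Proof. by move=> t0; rewrite subr_ge0 ew_le1// ltW. Qed.

Lemma sqrt2pi_sq : (Num.sqrt (2 * pi))^-1 ^+ 2 = (2 * pi)^-1 :> R.
Proof. by rewrite exprVn sqr_sqrtr// ltW// twopi_gt0. Qed.

Lemma ft_sq u n xi : ft_re u n xi ^+ 2 + ft_im u n xi ^+ 2 =
  (2 * pi)^-1 * fourier_sq (cut n u) xi.
Proof. by rewrite ft_reE ft_imE sqrrN !exprMn sqrt2pi_sq -mulrDr. Qed.

Lemma sqrD_weighted (d a b : R) : 0 < d ->
  a ^+ 2 <= (1 + d) * b ^+ 2 + (1 + d^-1) * (b - a) ^+ 2.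
Proof.
move=> d0; rewrite -subr_ge0.
rewrite (_ : _ - _ = d^-1 * ((1 + d) * b - a) ^+ 2); last first.
  by field; rewrite gt_eqF.
by rewrite mulr_ge0 ?sqr_ge0// invr_ge0 ltW.
Qed.

Section gagliardo_bound.
Variables (u fr fi : R -> R) (A : R).
Hypothesis Lu : L2 u.
Hypothesis fF : is_L2_fourier u fr fi.
Hypothesis hA : (\int[mu]_xi (`|xi| * (fr xi ^+ 2 + fi xi ^+ 2))%:E <= A%:E)%E.

Let A0 : 0 <= A.
Proof.
rewrite -lee_fin (le_trans _ hA)//; apply: integral_ge0 => x _.
by rewrite lee_fin mulr_ge0// addr_ge0 ?sqr_ge0.
Qed.

Let mfr : measurable_fun setT fr. Proof. by case: fF. Qed.
Let mfi : measurable_fun setT fi. Proof. by case: fF => _ []. Qed.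
Let mu_ : measurable_fun setT u. Proof. by case: Lu. Qed.

Let mre n : measurable_fun setT (ft_re u n).
Proof.
have mc := measurable_cosT (L12_cut n Lu).1.
have -> : ft_re u n = (fun xi => (Num.sqrt (2 * pi))^-1 * cosT (cut n u) xi).
  by apply/funext => xi; exact: ft_reE.
by solve_measurable.
Qed.

Let mim n : measurable_fun setT (ft_im u n).
Proof.
have mc := measurable_sinT (L12_cut n Lu).1.
have -> : ft_im u n = (fun xi => - ((Num.sqrt (2 * pi))^-1 * sinT (cut n u) xi)).
  by apply/funext => xi; exact: ft_imE.
by solve_measurable.
Qed.

Let err n xi := (fr xi - ft_re u n xi) ^+ 2 + (fi xi - ft_im u n xi) ^+ 2.

Let err_cvg e : 0 < e -> \forall n \near \oo, (\int[mu]_xi (err n xi)%:E <= e%:E)%E.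
Proof.
move=> e0; have [_ [_]] := fF.
move=> /fine_cvgP[[N1 _ hN1]] /cvgrPdist_le/(_ _ e0)[N2 _ hN2].
exists (maxn N1 N2) => // n /=; rewrite geq_max => /andP[n1 n2].
have h1 := hN1 _ n1; have := hN2 _ n2.
rewrite /= sub0r normrN => h2.
by rewrite -(fineK h1) lee_fin (le_trans _ h2)// ler_norm.
Qed.

(** The transform of [u] is given only as an L^2 limit, so that of [cut n u] is compared with it at
    the cost [err]. Young's inequality with parameter d keeps the main term at the factor 1 + d,
    which tends to the sharp constant. *)
Let poisson_energy_cut t d n : 0 < t -> 0 < d ->
  (\int[mu]_xi (err n xi)%:E <= (d ^+ 2)%:E)%E ->
  (poisson_energy t (cut n u) <= (2 * ((1 + d) * (t * A) + (1 + d^-1) * d ^+ 2))%:E)%E.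
Proof.
move=> t0 d0 hn.
have Lc := L12_cut n Lu; have me := @measurable_ew R t.
have mr := mre n; have mi := mim n.
have mf := measurable_fourier_sq Lc.1.
have E : (poisson_energy t (cut n u) = 2%:E *
    \int[mu]_xi ((1 - ew t xi) * (ft_re u n xi ^+ 2 + ft_im u n xi ^+ 2))%:E)%E.
  under eq_integral => xi _ do rewrite ft_sq mulrCA.
  rewrite int_scale; last 3 first.
  - by rewrite invr_ge0 ltW// twopi_gt0.
  - by solve_measurable.
  - by move=> xi; rewrite mulr_ge0 ?fourier_sq_ge0// subr_ge0 ew_le1// ltW.
  rewrite int_1ew_fourier_sq// !muleA -!EFinM.
  rewrite (_ : 2 * (2 * pi)^-1 * pi = 1) ?mul1e//.
  have := @pi_neq0 R; generalize (pi : R) => p p0.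
  by field.
rewrite E EFinM lee_wpmul2l ?lee_fin//.
have h1 : (\int[mu]_xi ((1 - ew t xi) * (fr xi ^+ 2 + fi xi ^+ 2))%:E <= (t * A)%:E)%E.
  apply: (@le_trans _ _ (\int[mu]_xi (t * (`|xi| * (fr xi ^+ 2 + fi xi ^+ 2)))%:E)%E).
    apply: int_le_real => xi.
      by rewrite mulr_ge0 ?onem_ew_ge0// addr_ge0 ?sqr_ge0.
    rewrite mulrA ler_wpM2r ?addr_ge0 ?sqr_ge0//.
    by rewrite /ew; have := expR_ge1Dx (- (t * `|xi|)); lra.
  rewrite int_scale ?(ltW t0)//; last 2 first.
  - by solve_measurable.
  - by move=> xi; rewrite mulr_ge0// addr_ge0 ?sqr_ge0.
  by rewrite EFinM lee_wpmul2l// lee_fin ltW.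
apply: (@le_trans _ _ (\int[mu]_xi
    ((1 + d) * ((1 - ew t xi) * (fr xi ^+ 2 + fi xi ^+ 2)) + (1 + d^-1) * err n xi)%:E)%E).
  apply: int_le_real => xi.
    by rewrite mulr_ge0 ?onem_ew_ge0// addr_ge0 ?sqr_ge0.
  have e1 : 0 <= 1 - ew t xi <= 1.
    by rewrite subr_ge0 ew_le1 ?(ltW t0)//= gerBl ew_ge0.
  have s1 := sqrD_weighted (ft_re u n xi) (fr xi) d0.
  have s2 := sqrD_weighted (ft_im u n xi) (fi xi) d0.
  have er0 : 0 <= (1 + d^-1) * err n xi.
    by rewrite mulr_ge0 ?addr_ge0 ?sqr_ge0 ?invr_ge0 ?(ltW d0).
  rewrite (@le_trans _ _ ((1 - ew t xi) * ((1 + d) * (fr xi ^+ 2 + fi xi ^+ 2) + (1 + d^-1) * err n xi)))//.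
    by case/andP: e1 => ? _; rewrite ler_wpM2l// /err; lra.
  rewrite mulrDr mulrCA lerD2l ler_piMl//.
  by case/andP: e1.
under eq_integral => xi _ do rewrite EFinD.
have d10 : 0 <= 1 + d^-1 by rewrite addr_ge0// invr_ge0 ltW.
have d1 : 0 <= 1 + d by rewrite addr_ge0// ltW.
have e1 xi : 0 <= (1 - ew t xi) * (fr xi ^+ 2 + fi xi ^+ 2).
  by rewrite mulr_ge0 ?onem_ew_ge0// addr_ge0 ?sqr_ge0.
have er0 xi : 0 <= err n xi by rewrite addr_ge0 ?sqr_ge0.
have mer : measurable_fun setT (err n) by rewrite /err; solve_measurable.
rewrite ge0_integralD//; last 4 first.
- by move=> xi _; rewrite lee_fin mulr_ge0.
- by solve_measurable.
- by move=> xi _; rewrite lee_fin mulr_ge0.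
- by solve_measurable.
rewrite !int_scale//; last by solve_measurable.
rewrite [leRHS](_ : _ = (1 + d)%:E * (t * A)%:E + (1 + d^-1)%:E * (d ^+ 2)%:E)%E.
  by rewrite leeD// lee_wpmul2l ?lee_fin.
by rewrite -!EFinM -EFinD.
Qed.

(** A sharp cut may have infinite Gagliardo integral, so n tends to infinity at fixed t, and t tends
    to 0 only afterwards. *)
Lemma poisson_energy_le_fourier t : 0 < t -> (poisson_energy t u <= (2 * (t * A))%:E)%E.
Proof.
move=> t0.
have h d : 0 < d -> (poisson_energy t u <= (2 * ((1 + d) * (t * A) + (1 + d^-1) * d ^+ 2))%:E)%E.
  move=> d0.
  apply: (@fatou_le _ _ _ mu2
    (fun n z => poisson t (z.1 - z.2) * (cut n u z.1 - cut n u z.2) ^+ 2)).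
  - move=> n; have mp := measurable_poisson t0; have mc := measurable_cut n mu_.
    by solve_measurable.
  - by move=> n z; rewrite mulr_ge0 ?poisson_ge0 ?sqr_ge0.
  - move=> z; apply: cvgMr.
    apply: (@cvg_comp _ _ _ (fun n => cut n u z.1 - cut n u z.2) (fun x => x ^+ 2)).
      by apply: cvgB; exact: cut_cvg.
    exact: exprn_continuous.
  - have [N _ hN] := err_cvg (exprn_gt0 2 d0).
    by exists N => // n /hN; exact: poisson_energy_cut.
apply/lee_addgt0Pr => e e0.
(* Since (1 + d^-1) d^2 = d^2 + d and d <= 1, the excess over 2 t A is at most d (2 t A + 4) <=
   e. *)
pose d := Num.min 1 (e / (2 * (t * A) + 4)).
have tA0 : 0 <= t * A by rewrite mulr_ge0// ltW.
have d0 : 0 < d by rewrite lt_min ltr01 divr_gt0//; lra.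
have d1 : d <= 1 by rewrite ge_min lexx.
have de : d * (2 * (t * A) + 4) <= e.
  by rewrite -ler_pdivlMr ?ge_min ?lexx ?orbT//; lra.
apply: (le_trans (h d d0)); rewrite -EFinD lee_fin.
rewrite (_ : (1 + d^-1) * d ^+ 2 = d ^+ 2 + d); last by field; rewrite gt_eqF.
by nra.
Qed.

Lemma gagliardo_le_fourier : (gagliardo u <= (2 * pi * A)%:E)%E.
Proof.
apply: gagliardo_le => // t t0.
rewrite (_ : 2 * pi * A = pi / t * (2 * (t * A))); last by field; rewrite gt_eqF.
rewrite [leRHS]EFinM lee_wpmul2l//; last exact: poisson_energy_le_fourier.
by rewrite lee_fin divr_ge0 ?pi_ge0// ltW.
Qed.

End gagliardo_bound.

(** [E] is the frequency integral of the norm. From here on the first claim sees only [u] and no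
    longer its transform. *)
Lemma unit_ball_gagliardo u : H12_unit_ball u -> exists E : R, [/\ L2 u, 0 <= E,
  sqnorm u + E <= 1 & (gagliardo u <= (2 * pi * E)%:E)%E].
Proof.
move=> [mu_ [fr [fi [fF]]]]; rewrite /H12_sqnorm => h1.
set I1 := (X in (X + _ <= _)%E) in h1; set I2 := (X in (_ + X <= _)%E) in h1.
have I10 : (0 <= I1)%E by apply: integral_ge0 => x _; rewrite lee_fin sqr_ge0.
have I20 : (0 <= I2)%E.
  by apply: integral_ge0 => x _; rewrite lee_fin mulr_ge0// addr_ge0 ?sqr_ge0.
have I1f : I1 \is a fin_num.
  by rewrite ge0_fin_numE// (le_lt_trans (leeDl _ I20))// (le_lt_trans h1)// ltry.
have I2f : I2 \is a fin_num.
  by rewrite ge0_fin_numE// (le_lt_trans (leeDr _ I10))// (le_lt_trans h1)// ltry.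
have Lu : L2 u by apply: L2P => //; rewrite -ge0_fin_numE.
exists (fine I2); split => //.
- by rewrite fine_ge0.
- by rewrite -lee_fin EFinD -nrm2E// fineK.
- by apply: (gagliardo_le_fourier Lu fF); rewrite fineK.
Qed.

End unit_ball.

(** * Logarithmic capacity *)

Section capacity.
Context {R : realType}.
Notation mu := (@lebesgue_measure R).
Notation mu2 := (mu \x mu)%E.
Implicit Types (f g h w u v : R -> R) (t d x y e a s : R).

Lemma L12D v w : L12 v -> L12 w -> L12 (fun x => v x + w x).
Proof.
move=> [v1 v2] [w1 w2]; split; first exact: integrable_add.
have mv := measurable_integrable v1; have mw := measurable_integrable w1.
apply: (@integrableP_real _ _ (fun x => 2 * (v x ^+ 2 + w x ^+ 2))).
- by solve_measurable.
- move=> x; rewrite ger0_norm ?sqr_ge0//.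
  rewrite -subr_ge0 (_ : _ - _ = (v x - w x) ^+ 2); first exact: sqr_ge0.
  by ring.
- by apply: integrable_scale; exact: integrable_add.
Qed.

Definition inner v w := \int[mu]_x (v x * w x).

Lemma integrable_prod v w : L2 v -> L2 w ->
  mu.-integrable setT (EFin \o (fun x => v x * w x)).
Proof.
move=> [mv v2] [mw w2].
apply: (@integrableP_real _ _ (fun x => v x ^+ 2 + w x ^+ 2)).
- by solve_measurable.
- by move=> x; exact: ler_normM_sq.
- exact: integrable_add.
Qed.

Lemma nrm2D v w : L2 v -> L2 w ->
  sqnorm (fun x => v x + w x) = sqnorm v + sqnorm w + 2 * inner v w.
Proof.
move=> Lv Lw; have vw := integrable_prod Lv Lw.
rewrite /sqnorm /inner -RintegralD//; [|by case: Lv|by case: Lw].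
rewrite -RintegralZl// -RintegralD//.
- by apply: eq_Rintegral => x _; ring.
- by apply: integrable_add; [case: Lv|case: Lw].
- exact: integrable_scale.
Qed.

Lemma cosTD v w xi : mu.-integrable setT (EFin \o v) -> mu.-integrable setT (EFin \o w) ->
  cosT (fun x => v x + w x) xi = cosT v xi + cosT w xi.
Proof.
move=> vi wi; rewrite /cosT -RintegralD//; last 2 first.
- by apply: integrableMb => //; [solve_measurable|move=> x; exact: normr_cos].
- by apply: integrableMb => //; [solve_measurable|move=> x; exact: normr_cos].
by apply: eq_Rintegral => x _; rewrite mulrDl.
Qed.

Lemma sinTD v w xi : mu.-integrable setT (EFin \o v) -> mu.-integrable setT (EFin \o w) ->
  sinT (fun x => v x + w x) xi = sinT v xi + sinT w xi.
Proof.
move=> vi wi; rewrite /sinT -RintegralD//; last 2 first.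
- by apply: integrableMb => //; [solve_measurable|move=> x; exact: normr_sin].
- by apply: integrableMb => //; [solve_measurable|move=> x; exact: normr_sin].
by apply: eq_Rintegral => x _; rewrite mulrDl.
Qed.

(** Proved in frequency, where the two mixed terms are visibly equal. *)
Lemma BtD t v w : 0 < t -> L12 v -> L12 w ->
  poisson_form t (fun x => v x + w x) (fun x => v x + w x) =
  poisson_form t v v + poisson_form t w w + 2 * poisson_form t v w.
Proof.
move=> t0 [vi _] [wi _].
have vwi : mu.-integrable setT (EFin \o (fun x => v x + w x)) by exact: integrable_add.
have p0 : (2 * pi : R) != 0 by rewrite gt_eqF// twopi_gt0.
apply: (mulfI p0).
have F1 := fourier_poisson_integrable t0 vi vi.
have F2 := fourier_poisson_integrable t0 wi wi.
have F3 := fourier_poisson_integrable t0 vi wi.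
rewrite -(fourier_poisson t0 vwi vwi) //.
have e1 := fourier_poisson t0 vi vi; have e2 := fourier_poisson t0 wi wi.
have e3 := fourier_poisson t0 vi wi.
transitivity (2 * pi * poisson_form t v v + 2 * pi * poisson_form t w w + 2 * (2 * pi * poisson_form t v w)); last first.
  by move: (poisson_form t v v) (poisson_form t w w) (poisson_form t v w) => p q r; ring.
rewrite -e1 -e2 -e3 -RintegralD//.
rewrite -RintegralZl// -RintegralD//; [|exact: integrable_add|exact: integrable_scale].
by apply: eq_Rintegral => xi _; rewrite !cosTD// !sinTD//; ring.
Qed.

(** Polarization of [poisson_form_cvg]. *)
Lemma poisson_form_cvg_inner v w : L12 v -> L12 w ->
  (fun n => poisson_form (tn n) v w) @ \oo --> inner v w.
Proof.
move=> Lv Lw; have Lvw := L12D Lv Lw.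
have -> : inner v w = 2^-1 * (sqnorm (fun x => v x + w x) - sqnorm v - sqnorm w).
  rewrite (nrm2D (L12_L2 Lv) (L12_L2 Lw)).
  by move: (sqnorm v) (sqnorm w) (inner v w) => p q r; field.
have -> : (fun n => poisson_form (tn n) v w) = (fun n => 2^-1 * (poisson_form (tn n) (fun x => v x + w x) (fun x => v x + w x)
   - poisson_form (tn n) v v - poisson_form (tn n) w w)).
  apply/funext => n; rewrite (BtD (@tn_gt0 R n) Lv Lw).
  by move: (poisson_form _ v v) (poisson_form _ w w) (poisson_form _ v w) => p q r; field.
by apply: cvgMr; apply: cvgB; [apply: cvgB|]; exact: poisson_form_cvg.
Qed.

Section capacity_estimate.
Variables (E : set R) (m : R).
Hypotheses (mE : measurable E) (m0 : 0 < m) (muE : mu E = m%:E).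

Definition unif : R -> R := fun x => m^-1 * \1_E x.

Lemma measurable_unif : measurable_fun setT unif.
Proof.
have m1 : measurable_fun setT (\1_E : R -> R) by exact: measurable_indic.
by rewrite /unif; solve_measurable.
Qed.

Lemma unif_ge0 x : 0 <= unif x.
Proof. by rewrite mulr_ge0// ?invr_ge0 ?(ltW m0)// indicE. Qed.

Lemma unif_le x : unif x <= m^-1.
Proof. by rewrite /unif ler_piMr ?invr_ge0 ?(ltW m0)// indicE; case: (x \in _). Qed.

Lemma int_indE : (\int[mu]_x (\1_E x)%:E = m%:E)%E.
Proof. by rewrite integral_indic// setIT. Qed.

Lemma indE_integrable : mu.-integrable setT (EFin \o (\1_E : R -> R)).
Proof.
apply: ge0_integrable; [exact: measurable_indic|by move=> x; rewrite indicE|].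
by rewrite int_indE ltry.
Qed.

Lemma unif_integrable : mu.-integrable setT (EFin \o unif).
Proof. exact/integrable_scale/indE_integrable. Qed.

Lemma Rint_unif : \int[mu]_x unif x = 1.
Proof.
rewrite /unif RintegralZl//; last exact: indE_integrable.
have -> : \int[mu]_x \1_E x = m by apply: EFin_inj; rewrite -integrable_fune ?int_indE//; exact: indE_integrable.
by rewrite mulVf// gt_eqF.
Qed.

Lemma L12_unif : L12 unif.
Proof.
split; first exact: unif_integrable.
apply: (@integrableP_real _ _ (fun x => m^-1 * unif x)).
- by have mm := measurable_unif; solve_measurable.
- move=> x; rewrite ger0_norm ?sqr_ge0// expr2 ler_wpM2r ?unif_ge0//; exact: unif_le.
- exact/integrable_scale/unif_integrable.
Qed.

Lemma poisson_form_unif_le t f k : 0 < t -> L12 f ->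
  (forall x, \int[mu]_y (f y * poisson t (x - y)) <= k) -> poisson_form t unif f <= k.
Proof.
move=> t0 Lf hk; rewrite BtEiter -[leRHS]mulr1 -Rint_unif -RintegralZl//; last exact: unif_integrable.
apply: le_Rintegral => //.
- exact: (poisson_form_integrable t0 (L12_L2 L12_unif) Lf).
- exact/integrable_scale/unif_integrable.
- by move=> x _; rewrite mulrC ler_wpM2r ?unif_ge0.
Qed.

(** The bound for small heights: the density is at most 1 / m and the kernel has mass 1. *)
Lemma poisson_form_unif_le1 t : 0 < t -> poisson_form t unif unif <= m^-1.
Proof.
move=> t0; apply: poisson_form_unif_le => //; first exact: L12_unif.
move=> x; rewrite -[leRHS]mulr1 -(Rint_poisson x t0) -RintegralZl//; last exact: poisson_shift_integrable.
apply: le_Rintegral => //.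
- exact: (poisson_conv_integrable x t0 unif_integrable).
- exact/integrable_scale/poisson_shift_integrable.
- by move=> y _; rewrite ler_wpM2r ?poisson_ge0 ?unif_le.
Qed.

(** The bound for large heights, with the roles exchanged: the kernel is at most 1 / (pi t) and the
    density has mass 1. Integrated from m to b it produces the logarithm with its exact
    coefficient. *)
Lemma poisson_form_unif_le2 t : 0 < t -> poisson_form t unif unif <= (pi * t)^-1.
Proof.
move=> t0; apply: poisson_form_unif_le => //; first exact: L12_unif.
move=> x; rewrite -[leRHS]mulr1 -Rint_unif -RintegralZl//; last exact: unif_integrable.
apply: le_Rintegral => //.
- exact: (poisson_conv_integrable x t0 unif_integrable).
- exact/integrable_scale/unif_integrable.
- by move=> y _; rewrite mulrC ler_wpM2r ?unif_ge0 ?poisson_le.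
Qed.

Variable b : R.
Hypothesis mb : m <= b.

Let b0 : 0 < b. Proof. exact: lt_le_trans m0 mb. Qed.

(* The integral over heights s in [0, b] of min (1 / m) (1 / (pi s)), which bounds
   the Poisson form of the uniform density at height s. *)
Definition cap_const := 1 + pi^-1 * ln (b / m).

Lemma int_mkind (A : set R) g :
  (\int[mu]_x (\1_A x * g x)%:E = \int[mu]_(x in A) (g x)%:E)%E.
Proof.
rewrite [RHS]integral_mkcond; apply: eq_integral => x _.
by rewrite /patch indicE; case: (x \in A); rewrite ?mul1r ?mul0r.
Qed.

Lemma int_ew_s a : 0 < a ->
  (\int[mu]_s (\1_(`[0%R, b]) s * expR (- (s * a)))%:E = (a^-1 * (1 - expR (- (b * a))))%:E)%E.
Proof.
move=> a0; rewrite int_mkind.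
have dF (s : R) : is_derive s 1 (fun s => - a^-1 * expR (- (s * a))) (expR (- (s * a))).
  apply: is_derive_eq; rewrite /GRing.scale /=.
  by field; rewrite gt_eqF.
have cF : continuous (fun s => - a^-1 * expR (- (s * a))).
  by move=> s; apply: differentiable_continuous; exact/derivable1_diffP/ex_derive.
rewrite (@continuous_FTC2 _ (fun s => expR (- (s * a))) (fun s => - a^-1 * expR (- (s * a))) 0 b)//.
- by rewrite -EFinB; congr EFin; rewrite mul0r oppr0 expR0; ring.
- apply: continuous_subspaceT => s.
  apply: (@continuous_comp _ _ _ (fun s => - (s * a)) expR); last exact: continuous_expR.
  by apply: cvgN; exact: mulrr_continuous.
- split.
  + by move=> s _; exact: ex_derive.
  + exact/cvg_at_right_filter/cF.
  + exact/cvg_at_left_filter/cF.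
- by move=> s _; rewrite derive1E derive_val.
Qed.

Lemma int_inv_s : (\int[mu]_(s in `[m, b]) ((pi * s)^-1)%:E = (pi^-1 * ln (b / m))%:E)%E.
Proof.
have [mb'|bm] := ltrP m b; last first.
  have <- : m = b by apply/eqP; rewrite eq_le mb.
  by rewrite set_itv1 integral_set1 divff ?gt_eqF// ln1 mulr0.
have dF (s : R) : 0 < s -> is_derive s 1 (fun s => pi^-1 * ln s) ((pi * s)^-1).
  move=> s0; rewrite invfM; have := is_deriveZ pi^-1 (is_derive1_ln s0); exact.
have cF (s : R) : 0 < s -> {for s, continuous (fun s => pi^-1 * ln s)}.
  by move=> s0; apply: differentiable_continuous; apply/derivable1_diffP; have := dF s s0 => ?; exact: ex_derive.
rewrite (@continuous_FTC2 _ (fun s => (pi * s)^-1) (fun s => pi^-1 * ln s) m b)//.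
- by rewrite -EFinB; congr EFin; rewrite -mulrBr lnM ?posrE ?invr_gt0// lnV ?posrE.
- apply: continuous_in_subspaceT => s; rewrite inE/= in_itv/= => /andP[ms _].
  have s0 : 0 < s by exact: lt_le_trans ms.
  apply: cvgV; first by rewrite gt_eqF// mulr_gt0 ?pi_gt0.
  exact: mulrl_continuous.
- split.
  + move=> s; rewrite in_itv/= => /andP[ms _].
    by have := dF s (lt_trans m0 ms) => ?; exact: ex_derive.
  + exact/cvg_at_right_filter/cF.
  + exact/cvg_at_left_filter/cF.
- move=> s; rewrite in_itv/= => /andP[ms _].
  by have := dF s (lt_trans m0 ms) => ?; rewrite derive1E derive_val.
Qed.

(** On [m, b] the maximum is s; elsewhere it keeps the function continuous and positive. *)
Definition decay s := (pi * Num.max m s)^-1.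

Lemma measurable_decay : measurable_fun setT decay.
Proof.
apply: continuous_measurable_fun => s; apply: cvgV.
  by rewrite gt_eqF// mulr_gt0 ?pi_gt0// lt_max m0.
apply: cvgMr; apply: (@continuous_max _ _ (cst m) id); first exact: cst_continuous.
exact: cvg_id.
Qed.

Lemma decay_ge0 s : 0 <= decay s.
Proof. by rewrite invr_ge0 mulr_ge0 ?pi_ge0// le_max (ltW m0). Qed.

Lemma decay_id s : m <= s -> decay s = (pi * s)^-1.
Proof. by move=> ms; rewrite /decay max_r. Qed.

Lemma int_profile :
  (\int[mu]_s (\1_(`[0%R, m]) s * m^-1 + \1_(`[m, b]) s * decay s)%:E = cap_const%:E)%E.
Proof.
have mi (A : set R) : measurable A -> measurable_fun setT (\1_A : R -> R) by exact: measurable_indic.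
have m1 := mi _ (measurable_itv `[0%R, m]); have m2 := mi _ (measurable_itv `[m, b]).
have m3 := measurable_decay.
under eq_integral => s _ do rewrite EFinD.
have x0 := decay_ge0.
rewrite ge0_integralD//; last 4 first.
- by move=> s _; rewrite lee_fin mulr_ge0 ?invr_ge0 ?(ltW m0)// indicE.
- by solve_measurable.
- by move=> s _; rewrite lee_fin mulr_ge0// indicE.
- by solve_measurable.
rewrite !int_mkind integral_cst//= lebesgue_measure_itv/= lte_fin m0 oppr0 adde0 -EFinM mulVf ?gt_eqF//.
rewrite (_ : (\int[mu]_(s in `[m, b]) (decay s)%:E)%E = (\int[mu]_(s in `[m, b]) ((pi * s)^-1)%:E)%E).
  by rewrite int_inv_s.
by apply: eq_integral => s; rewrite inE/= in_itv/= => /andP[ms _]; rewrite decay_id.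
Qed.

Section tonelli.
Variable t : R.
Hypothesis t0 : 0 < t.

Let F (z : R * R) : R := fourier_sq unif z.1 * ew t z.1 * (\1_(`[0%R, b]) z.2 * expR (- (z.2 * `|z.1|))).

Let mF : measurable_fun setT F.
Proof.
have mi : measurable_fun setT (\1_(`[0%R, b]) : R -> R) by exact: measurable_indic.
have mf := measurable_fourier_sq unif_integrable; have me := @measurable_ew R t.
by rewrite /F; solve_measurable.
Qed.

Let F0 z : 0 <= F z.
Proof.
by rewrite /F !mulr_ge0 ?fourier_sq_ge0 ?ew_ge0 ?expR_ge0// indicE.
Qed.

(* As \int_0^b exp (- s |xi|) ds = (1 - exp (- b |xi|)) / |xi|, this is a spectral
   density that Tonelli turns into Poisson forms at heights t + s. *)
Definition strip_mass xi : \bar R := (\int[mu]_s (F (xi, s))%:E)%E.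

Lemma measurable_strip_mass : measurable_fun setT strip_mass.
Proof.
apply: (@measurable_fun_fubini_tonelli_F _ _ _ _ _ mu (EFin \o F)).
- by solve_measurable.
- by move=> z; rewrite /= lee_fin.
Qed.

Lemma KintE xi : xi != 0 ->
  strip_mass xi = (fourier_sq unif xi * ew t xi * (`|xi|^-1 * (1 - ew b xi)))%:E.
Proof.
move=> xi0; rewrite /strip_mass /F /=.
have mi : measurable_fun setT (\1_(`[0%R, b]) : R -> R) by exact: measurable_indic.
rewrite int_scale; last 3 first.
- by rewrite mulr_ge0 ?fourier_sq_ge0 ?ew_ge0.
- by solve_measurable.
- by move=> s; rewrite mulr_ge0 ?expR_ge0// indicE.
by rewrite int_ew_s ?normr_gt0// -EFinM /ew.
Qed.

Lemma strip_mass_ge0 xi : (0 <= strip_mass xi)%E.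
Proof. by apply: integral_ge0 => s _; rewrite lee_fin. Qed.

(** By Tonelli the left side is 2 pi times the integral over s in [0, b] of the Poisson forms at
    heights t + s, and the two bounds on these do not deteriorate as t tends to 0. *)
Lemma int_strip_mass : (\int[mu]_xi strip_mass xi <= (2 * pi * cap_const)%:E)%E.
Proof.
rewrite (_ : (\int[mu]_xi strip_mass xi)%E = (\int[mu]_s \int[mu]_xi (EFin \o F) (xi, s))%E); last first.
  apply: (@fubini_tonelli _ _ _ _ _ mu mu (EFin \o F)); first by solve_measurable.
  by move=> z; rewrite /= lee_fin.
apply: (@le_trans _ _ (\int[mu]_s (2 * pi * (\1_(`[0%R, m]) s * m^-1 + \1_(`[m, b]) s * decay s))%:E)%E); last first.
  under eq_integral => s _ do rewrite EFinM.
  have mi (A : set R) : measurable A -> measurable_fun setT (\1_A : R -> R) by exact: measurable_indic.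
  have m1 := mi _ (measurable_itv `[0%R, m]); have m2 := mi _ (measurable_itv `[m, b]).
  have m3 := measurable_decay.
  rewrite ge0_integralZl_EFin//.
  + by rewrite int_profile EFinM.
  + move=> s _; rewrite lee_fin addr_ge0// mulr_ge0 ?invr_ge0 ?(ltW m0)// ?indicE//.
    by rewrite mulr_ge0 ?pi_ge0// le_max (ltW m0).
  + by solve_measurable.
  + by rewrite ltW// twopi_gt0.
apply: le_ge0_integralT => s; first by apply: integral_ge0 => xi _; rewrite /= lee_fin.
have [/andP[s0 sb]|sb] := boolP (0 <= s <= b); last first.
  rewrite (_ : (\int[mu]_xi _)%E = 0%E).
    rewrite lee_fin mulr_ge0 ?(ltW twopi_gt0)// addr_ge0// mulr_ge0 ?invr_ge0 ?(ltW m0)// ?indicE//.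
    by rewrite mulr_ge0 ?pi_ge0// le_max (ltW m0).
  apply: integral0_eq => xi _; rewrite /F /= indicE memNset ?mul0r ?mulr0//=.
  by rewrite in_itv/=; exact/negP.
have ts0 : 0 < t + s by rewrite ltr_pwDl.
have -> : (\int[mu]_xi (EFin \o F) (xi, s) = (2 * pi * poisson_form (t + s) unif unif)%:E)%E.
  rewrite -int_ew_fourier_sq//; last exact: unif_integrable.
  apply: eq_integral => xi _; rewrite /= /F /= indicE mem_set/=; last by rewrite in_itv/= s0.
  rewrite mul1r ewD /ew; congr EFin; ring.
rewrite lee_fin ler_wpM2l ?(ltW twopi_gt0)//.
have B0 : 0 <= m^-1 by rewrite invr_ge0 ltW.
have [sm|ms] := lerP s m.
  rewrite indicE mem_set/=; last by rewrite in_itv/= s0.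
  rewrite mul1r (le_trans (poisson_form_unif_le1 ts0))// lerDl mulr_ge0 ?indicE ?decay_ge0//.
rewrite [X in _ + X * _]indicE mem_set/=; last by rewrite in_itv/= (ltW ms).
have sp : 0 < s by exact: lt_trans ms.
rewrite mul1r decay_id ?(ltW ms)// (le_trans (poisson_form_unif_le2 ts0))//.
rewrite (@le_trans _ _ (pi * s)^-1)//.
  rewrite lef_pV2 ?posrE ?mulr_gt0 ?pi_gt0// ler_wpM2l ?pi_ge0//.
  by rewrite lerDr ltW.
by rewrite lerDr mulr_ge0// indicE.
Qed.

(** Young's inequality for q and X p, then X^2 <= X. The factor X stays with p, the transform of the
    density, because it tames the singularity of 1 / |xi| at the origin. *)
Lemma normM_weighted k p q (X : R) : 0 < k -> 0 <= X <= 1 ->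
  `|X * (p * q)| <= 2^-1 * (k * q ^+ 2) + 2^-1 * k^-1 * (X * p ^+ 2).
Proof.
move=> k0 /andP[X0 X1].
have h (r : R) : X * (r * q) <= 2^-1 * (k * q ^+ 2) + 2^-1 * k^-1 * (X * r ^+ 2).
  have k0' : 0 <= 2^-1 * k^-1 by rewrite mulr_ge0 ?invr_ge0 ?(ltW k0).
  rewrite (@le_trans _ _ (2^-1 * (k * q ^+ 2) + 2^-1 * k^-1 * (X ^+ 2 * r ^+ 2)))//.
    rewrite -subr_ge0 (_ : _ - _ = 2^-1 * k^-1 * (k * q - X * r) ^+ 2).
      by rewrite mulr_ge0 ?sqr_ge0.
    by field; rewrite gt_eqF.
  rewrite lerD2l ler_wpM2l// ler_wpM2r ?sqr_ge0// expr2 ler_piMl//.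
rewrite ler_norml; apply/andP; split; last exact: h.
by rewrite lerNl -mulrN -mulNr (le_trans (h (- p)))// sqrrN.
Qed.

Variable v : R -> R.
Hypothesis Lv : L12 v.

(** Difference of the multipliers at heights t and t + b, so [f] integrates to the drop of the
    Poisson form between these heights. *)
Let X xi := ew t xi * (1 - ew b xi).

Let X01 xi : 0 <= X xi <= 1.
Proof.
have h1 := ew_ge0 t xi; have h2 := ew_le1 xi (ltW t0).
have h3 := ew_ge0 b xi; have h4 := ew_le1 xi (ltW b0).
apply/andP; split; first by rewrite mulr_ge0// subr_ge0.
by rewrite -[leRHS]mul1r ler_pM// ?subr_ge0// gerBl.
Qed.

Let f xi := X xi * (cosT unif xi * cosT v xi + sinT unif xi * sinT v xi).

Let f_le k xi : 0 < k ->
  ((`|f xi|)%:E <= (2^-1 * k * (`|xi| * fourier_sq v xi))%:E + (2^-1 * k^-1)%:E * strip_mass xi)%E.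
Proof.
move=> k0; have [->|xi0] := eqVneq xi 0.
  rewrite (_ : f 0 = 0); last first.
    by rewrite /f /X /ew !normr0 !mulr0 oppr0 expR0 subrr mulr0 mul0r.
  rewrite normr0 adde_ge0// ?mule_ge0 ?strip_mass_ge0// lee_fin.
    by rewrite !mulr_ge0 ?fourier_sq_ge0 ?(ltW k0).
  by rewrite mulr_ge0 ?invr_ge0 ?(ltW k0).
have a0 : 0 < `|xi| by rewrite normr_gt0.
rewrite KintE// -EFinM -EFinD lee_fin /f mulrDr (le_trans (ler_normD _ _))//.
(* With weight k |xi| the term of [v] becomes its energy density, and that of the uniform density
   gains 1 / |xi| and becomes [strip_mass]. *)
have ka : 0 < k * `|xi| by rewrite mulr_gt0.
have h1 := normM_weighted (cosT unif xi) (cosT v xi) ka (X01 xi).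
have h2 := normM_weighted (sinT unif xi) (sinT v xi) ka (X01 xi).
apply: (le_trans (lerD h1 h2)); rewrite le_eqVlt; apply/orP; left; apply/eqP.
rewrite /fourier_sq /X invfM; move: (cosT v xi) (sinT v xi) (cosT unif xi) (sinT unif xi) (ew t xi) (ew b xi) (`|xi|^-1) (k^-1) => p1 p2 p3 p4 p5 p6 p7 p8.
by field.
Qed.

Let fE : \int[mu]_xi f xi = 2 * pi * (poisson_form t unif v - poisson_form (t + b) unif v).
Proof.
have tb0 : 0 < t + b by exact: addr_gt0.
rewrite mulrBr -(fourier_poisson t0 unif_integrable Lv.1) -(fourier_poisson tb0 unif_integrable Lv.1).
rewrite -RintegralB//; last 2 first.
- exact: fourier_poisson_integrable t0 unif_integrable Lv.1.
- exact: fourier_poisson_integrable tb0 unif_integrable Lv.1.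
by apply: eq_Rintegral => xi _; rewrite /f /X ewD; ring.
Qed.

Let fi : mu.-integrable setT (EFin \o f).
Proof.
have tb0 : 0 < t + b by exact: addr_gt0.
have := integrable_add (fourier_poisson_integrable t0 unif_integrable Lv.1)
  (integrable_scale (-1) (fourier_poisson_integrable tb0 unif_integrable Lv.1)).
by apply: eq_integrable => // xi _ /=; congr EFin; rewrite /f /X ewD; ring.
Qed.

Lemma capacity_poisson_form e k : 0 < k -> (gagliardo v <= (2 * pi * e)%:E)%E ->
  2 * (poisson_form t unif v - poisson_form (t + b) unif v) <= k * e + k^-1 * cap_const.
Proof.
move=> k0 ge.
have mv := measurable_fourier_sq Lv.1; have mK := measurable_strip_mass.
have k'0 : 0 <= 2^-1 * k^-1 by rewrite mulr_ge0 ?invr_ge0 ?(ltW k0).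
have k''0 : 0 <= 2^-1 * k by rewrite mulr_ge0 ?(ltW k0).
have h : ((2 * pi * (poisson_form t unif v - poisson_form (t + b) unif v))%:E <=
    (2^-1 * k * (2 * pi * e) + 2^-1 * k^-1 * (2 * pi * cap_const))%:E)%E.
  rewrite -fE -integrable_fune//.
  apply: (@le_trans _ _ (\int[mu]_xi (`|f xi|)%:E)%E).
    apply: le_integral => //; first exact: integrable_norm.
    by move=> xi _; rewrite lee_fin ler_norm.
  apply: (@le_trans _ _ (\int[mu]_xi ((2^-1 * k * (`|xi| * fourier_sq v xi))%:E + (2^-1 * k^-1)%:E * strip_mass xi))%E).
    by apply: le_ge0_integralT => xi; [rewrite lee_fin|exact: f_le].
  rewrite ge0_integralD//; last 4 first.
  - by move=> xi _; rewrite lee_fin mulr_ge0// mulr_ge0// fourier_sq_ge0.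
  - by solve_measurable.
  - by move=> xi _; rewrite mule_ge0 ?strip_mass_ge0// lee_fin.
  - exact: measurable_funeM.
  rewrite int_scale//; last 2 first.
  - by solve_measurable.
  - by move=> xi; rewrite mulr_ge0// fourier_sq_ge0.
  rewrite ge0_integralZl_EFin//; last by move=> xi _; exact: strip_mass_ge0.
  rewrite [leRHS](_ : _ = (2^-1 * k)%:E * (2 * pi * e)%:E + (2^-1 * k^-1)%:E * (2 * pi * cap_const)%:E)%E.
    apply: leeD; rewrite lee_wpmul2l ?lee_fin//; last exact: int_strip_mass.
    exact: le_trans (int_abs_fourier_sq_le Lv) ge.
  by rewrite -!EFinM -EFinD.
move: h; rewrite lee_fin => h.
rewrite -(ler_pM2l (pi_gt0 R)).
move: h; move: (poisson_form t unif v) (poisson_form (t + b) unif v) cap_const (pi : R) (k^-1) => p q r s k'; lra.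
Qed.

End tonelli.

(** The limit t to 0 of the regularized estimate, which compares heights t and t + b; hence [c] must
    bound the extension at every height from b on. *)
Lemma capacity_inner v e k c : L12 v -> 0 < k -> (gagliardo v <= (2 * pi * e)%:E)%E ->
  (forall t x, b <= t -> \int[mu]_y (v y * poisson t (x - y)) <= c) ->
  2 * (inner unif v - c) <= k * e + k^-1 * cap_const.
Proof.
move=> Lv k0 ge hc.
have cv := poisson_form_cvg_inner L12_unif Lv.
have h n : poisson_form (tn n) unif v <= c + 2^-1 * (k * e + k^-1 * cap_const).
  have t0 := @tn_gt0 R n; have tb0 : 0 < tn n + b by exact: addr_gt0.
  have h1 := capacity_poisson_form t0 Lv k0 ge.
  have h2 : poisson_form (tn n + b) unif v <= c.
    by apply: poisson_form_unif_le => // x; apply: hc; rewrite lerDr ltW.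
  by move: h1 h2; move: (poisson_form (tn n) unif v) (poisson_form (tn n + b) unif v) cap_const (k^-1) => p q r k'; lra.
have : inner unif v <= c + 2^-1 * (k * e + k^-1 * cap_const).
  rewrite -(cvg_lim _ cv)//; apply: limr_le; first by apply/cvg_ex; eexists; exact: cv.
  exact: nearW.
by move: (inner unif v) cap_const (k^-1) => p r k'; lra.
Qed.

Lemma inner_unif_cst v H : L12 v -> (forall x, E x -> v x = H) -> inner unif v = H.
Proof.
move=> Lv vH; rewrite -[RHS]mulr1 -Rint_unif -RintegralZl//; last exact: unif_integrable.
apply: eq_Rintegral => x _; rewrite /unif indicE.
by have [/set_mem/vH ->|_] := boolP (x \in E); [rewrite mulrC|rewrite !mulr0 mul0r].
Qed.

Lemma cap_const_ge1 : 1 <= cap_const.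
Proof.
rewrite lerDl mulr_ge0 ?invr_ge0 ?pi_ge0// ln_ge0//.
by rewrite ler_pdivlMr// mul1r.
Qed.

(* Optimize k in [capacity_inner], a Young inequality between the energy of v and
   that of the uniform density. *)
Lemma capacity v e c H : L12 v -> 0 <= e -> (gagliardo v <= (2 * pi * e)%:E)%E ->
  (forall x, E x -> v x = H) ->
  (forall t x, b <= t -> \int[mu]_y (v y * poisson t (x - y)) <= c) ->
  c <= H -> (H - c) ^+ 2 <= e * cap_const.
Proof.
move=> Lv e0 ge vH hc cH.
have l1 := cap_const_ge1.
have h k : 0 < k -> 2 * (H - c) <= k * e + k^-1 * cap_const.
  by move=> k0; rewrite -(inner_unif_cst Lv vH); exact: capacity_inner.
have [->|x0] := eqVneq (H - c) 0.
  by rewrite expr0n mulr_ge0//; lra.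
have {cH x0}x0 : 0 < H - c by rewrite lt_neqAle eq_sym x0 subr_ge0.
have [e0'|e0'] := eqVneq e 0.
  (* Without energy this weight gives 2 (H - c) <= H - c, which is absurd. *)
  have := h (cap_const / (H - c)); rewrite e0' mulr0 add0r invf_div.
  rewrite divfK; last by rewrite gt_eqF//; lra.
  have k0 : 0 < cap_const / (H - c) by rewrite divr_gt0//; lra.
  by move=> /(_ k0); lra.
have {e0'}e0 : 0 < e by rewrite lt_neqAle eq_sym e0'.
(* This weight makes k e equal to H - c, which is absorbed on the left. *)
have k0 : 0 < (H - c) / e by rewrite divr_gt0.
have := h _ k0; rewrite divfK ?gt_eqF// invf_div => h1.
have : (H - c) <= e / (H - c) * cap_const by lra.
by rewrite mulrAC ler_pdivlMr// expr2.
Qed.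

End capacity_estimate.

End capacity.

(** * Layers of a function *)

Section layers.
Context {R : realType}.
Notation mu := (@lebesgue_measure R).
Notation mu2 := (mu \x mu)%E.
Implicit Types (f g h w v : R -> R) (t d x y e a s : R).

Lemma gagliardo_mono f g : (forall x y, `|f x - f y| <= `|g x - g y|) -> (gagliardo f <= gagliardo g)%E.
Proof.
move=> fg; apply: le_ge0_integralT => z; rewrite lee_fin.
  by rewrite divr_ge0 ?sqr_ge0.
rewrite ler_wpM2r ?invr_ge0 ?sqr_ge0//.
by rewrite -[leLHS]real_normK ?num_real// -[leRHS]real_normK ?num_real// !expr2 ler_pM.
Qed.

Lemma gagliardo_ge0 f : (0 <= gagliardo f)%E.
Proof. by apply: integral_ge0 => z _; rewrite lee_fin divr_ge0 ?sqr_ge0. Qed.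

Lemma gagliardo_superadd f g h : measurable_fun setT f -> measurable_fun setT g ->
  (forall x y, (f x - f y) ^+ 2 + (g x - g y) ^+ 2 <= (h x - h y) ^+ 2) ->
  (gagliardo f + gagliardo g <= gagliardo h)%E.
Proof.
move=> mf mg fgh; rewrite /gagliardo -ge0_integralD//.
- apply: le_ge0_integralT => z; rewrite -?EFinD lee_fin.
    by rewrite addr_ge0// divr_ge0 ?sqr_ge0.
  by rewrite -mulrDl ler_wpM2r ?invr_ge0 ?sqr_ge0.
- by move=> z _; rewrite lee_fin divr_ge0 ?sqr_ge0.
- by apply/measurable_EFinP; exact: measurable_gagliardo.
- by move=> z _; rewrite lee_fin divr_ge0 ?sqr_ge0.
- by apply/measurable_EFinP; exact: measurable_gagliardo.
Qed.

Lemma sqnorm_mono f g : L2 f -> L2 g -> (forall x, `|f x| <= `|g x|) -> sqnorm f <= sqnorm g.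
Proof.
move=> [_ f2] [_ g2] fg; apply: le_Rintegral => // x _.
by rewrite -[leLHS]real_normK ?num_real// -[leRHS]real_normK ?num_real// !expr2 ler_pM.
Qed.

Lemma sqnorm_superadd f g h : L2 f -> L2 g -> L2 h ->
  (forall x, f x ^+ 2 + g x ^+ 2 <= h x ^+ 2) -> sqnorm f + sqnorm g <= sqnorm h.
Proof.
move=> [_ f2] [_ g2] [_ h2] fgh; rewrite /sqnorm -RintegralD//.
by apply: le_Rintegral => //; exact: integrable_add.
Qed.

(** Cauchy-Schwarz for the Poisson kernel as a probability density, which is at most 1 / pi for t >=
    1. It is obtained by integrating 2 c v <= c^2 + v^2 with c the average itself. *)
Lemma Pconv_le_sqnorm v t x : 1 <= t -> L12 v ->
  \int[mu]_y (v y * poisson t (x - y)) <= Num.sqrt (sqnorm v / pi).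
Proof.
move=> t1 [vi v2].
have t0 : 0 < t by exact: lt_le_trans t1.
have mv := measurable_integrable vi; have mp := measurable_poisson t0.
have pi1 := poisson_shift_integrable x t0.
have pci := poisson_conv_integrable x t0 vi.
set c := \int[mu]_y _.
have [c0|c0] := lerP c 0; first by rewrite (le_trans c0)// sqrtr_ge0.
have pt : forall y, poisson t (x - y) <= pi^-1.
  move=> y; rewrite (le_trans (poisson_le _ t0))// lef_pV2 ?posrE ?mulr_gt0 ?pi_gt0//.
  by rewrite ler_peMr ?pi_ge0.
have h : 2 * c * c <= c ^+ 2 + sqnorm v / pi.
  have -> : 2 * c * c = \int[mu]_y (2 * c * (v y * poisson t (x - y))) by rewrite RintegralZl.
  have -> : sqnorm v / pi = \int[mu]_y (pi^-1 * v y ^+ 2) by rewrite RintegralZl// mulrC.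
  have -> : c ^+ 2 = \int[mu]_y (c ^+ 2 * poisson t (x - y)).
    by rewrite RintegralZl// Rint_poisson// mulr1.
  rewrite -RintegralD//; [|exact: integrable_scale|exact: integrable_scale].
  apply: le_Rintegral => //; first exact: integrable_scale.
    by apply: integrable_add; exact: integrable_scale.
  move=> y _.
  rewrite (@le_trans _ _ ((c ^+ 2 + v y ^+ 2) * poisson t (x - y)))//.
    rewrite mulrA ler_wpM2r ?poisson_ge0//.
    rewrite -subr_ge0 (_ : _ - _ = (c - v y) ^+ 2); first exact: sqr_ge0.
    by ring.
  by rewrite mulrDl lerD2l mulrC ler_wpM2r ?sqr_ge0.
rewrite -[leLHS]ger0_norm ?(ltW c0)// -sqrtr_sqr ler_sqrt.
  by move: h; move: (sqnorm v / pi) => q; nra.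
by rewrite mulr_ge0 ?sqnorm_ge0 ?invr_ge0 ?pi_ge0.
Qed.

Variables (u : R -> R) (E : R).
Hypothesis u0 : forall x, 0 <= u x.
Hypothesis Lu : L2 u.
Hypothesis uE : (gagliardo u <= (2 * pi * E)%:E)%E.
Hypothesis norm1 : sqnorm u + E <= 1.

Let mu_ : measurable_fun setT u. Proof. by case: Lu. Qed.

Definition trunc_at s x := Num.min (u x) s.
Definition layer s s' x := Num.min (u x) s' - Num.min (u x) s.
Definition superlevel s : set R := [set x | s < u x].
Definition superlevel_measure s := fine (mu (superlevel s)).

Lemma measurable_trunc_at s : measurable_fun setT (trunc_at s).
Proof. by rewrite /trunc_at; solve_measurable. Qed.

Lemma measurable_layer s s' : measurable_fun setT (layer s s').
Proof. by rewrite /layer; solve_measurable. Qed.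

Lemma measurable_superlevel s : measurable (superlevel s).
Proof.
rewrite /superlevel -[X in measurable X]setTI.
rewrite (_ : [set x | s < u x] = u @^-1` `]s, +oo[); last first.
  by apply/seteqP; split => x /=; rewrite in_itv/= andbT.
by apply: mu_ => //; exact: measurable_itv.
Qed.

Lemma superlevel_chebyshev s : 0 < s -> ((s ^+ 2)%:E * mu (superlevel s) <= (sqnorm u)%:E)%E.
Proof.
move=> s0; have ml := measurable_superlevel s.
have -> : mu (superlevel s) = (\int[mu]_x (\1_(superlevel s) x)%:E)%E by rewrite integral_indic// setIT.
have m1 : measurable_fun setT (\1_(superlevel s) : R -> R) by exact: measurable_indic.
rewrite -int_scale ?sqr_ge0//.
rewrite -nrm2E//; apply: int_le_real => x.
  by rewrite mulr_ge0 ?sqr_ge0// indicE.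
rewrite indicE; have [|_] := boolP (x \in superlevel s); last by rewrite mulr0 sqr_ge0.
by move=> /set_mem /= sx; rewrite mulr1 !expr2 ler_pM// ltW.
Qed.

Let sqnorm_1 : sqnorm u <= 1.
Proof.
have E0 : 0 <= E.
  have := le_trans (gagliardo_ge0 u) uE.
  by rewrite lee_fin pmulr_rge0// twopi_gt0.
by rewrite (le_trans _ norm1)// lerDl.
Qed.

Lemma superlevel_fin s : 0 < s -> mu (superlevel s) = (superlevel_measure s)%:E.
Proof.
move=> s0; rewrite /superlevel_measure fineK// ge0_fin_numE//.
rewrite ltey; apply/eqP => h; have := superlevel_chebyshev s0; rewrite h.
by rewrite gt0_muley ?lte_fin ?exprn_gt0// leNgt ltry.
Qed.

Lemma superlevel_measure_ge0 s : 0 <= superlevel_measure s.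
Proof. by rewrite /superlevel_measure fine_ge0. Qed.

Lemma superlevel_measure_le s : 0 < s -> s ^+ 2 * superlevel_measure s <= 1.
Proof.
by move=> s0; rewrite -lee_fin EFinM -superlevel_fin// (le_trans (superlevel_chebyshev s0))// lee_fin.
Qed.

Lemma superlevel_measure_mono s s' : 0 < s -> s <= s' -> superlevel_measure s' <= superlevel_measure s.
Proof.
move=> s0 ss'; rewrite -lee_fin -!superlevel_fin//; last exact: lt_le_trans ss'.
apply: le_measure; rewrite ?inE; [exact: measurable_superlevel|exact: measurable_superlevel|].
by move=> x /=; exact: le_lt_trans.
Qed.

Lemma layer_ge0 s s' x : s <= s' -> 0 <= layer s s' x.
Proof. by move=> ss'; rewrite /layer; case: (lerP (u x) s) => ?; case: (lerP (u x) s') => ?; lra. Qed.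

Lemma layer_le s s' x : s <= s' -> layer s s' x <= s' - s.
Proof. by move=> ss'; rewrite /layer; case: (lerP (u x) s) => ?; case: (lerP (u x) s') => ?; lra. Qed.

Lemma layer_superlevel s s' x : s <= s' -> superlevel s' x -> layer s s' x = s' - s.
Proof.
rewrite /superlevel /= => ss' h; rewrite /layer !min_r//; last exact: ltW.
exact/ltW/(le_lt_trans ss').
Qed.

Lemma layer_out s s' x : s <= s' -> ~ superlevel s x -> layer s s' x = 0.
Proof.
move=> ss' /negP; rewrite /superlevel /= -leNgt => us.
by rewrite /layer !min_l ?subrr// (le_trans us).
Qed.

(** Integrability needs s > 0: the layer vanishes where u <= s, and where u > s one has u <= u^2 /
    s. *)
Lemma L12_layer s s' : 0 < s -> s <= s' -> L12 (layer s s').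
Proof.
move=> s0 ss'; have ml := measurable_layer s s'.
have lu x : `|layer s s' x| <= `|u x|.
  rewrite (ger0_norm (layer_ge0 _ ss')) (ger0_norm (u0 x)) /layer.
  by have := u0 x; case: (lerP (u x) s) => ?; case: (lerP (u x) s') => ?; lra.
split; last by case: (L2_le ml lu Lu).
apply: (@integrableP_real _ _ (fun x => s^-1 * u x ^+ 2)) => //; last first.
  by apply: integrable_scale; case: Lu.
move=> x; have [sx|sx] := ltrP s (u x).
  rewrite (le_trans (lu x))// ger0_norm// ler_pdivlMl// expr2.
  by rewrite ler_wpM2r// ltW.
rewrite layer_out//; last by apply/negP; rewrite /= -leNgt.
by rewrite normr0 mulr_ge0 ?invr_ge0 ?sqr_ge0// ltW.
Qed.

Lemma L2_trunc_at s : 0 < s -> L2 (trunc_at s).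
Proof.
move=> s0; apply: (L2_le (measurable_trunc_at s) _ Lu) => x.
by rewrite /trunc_at; have := u0 x; case: (lerP (u x) s) => ? ?; rewrite ?lexx//; rewrite !ger0_norm; lra.
Qed.

Let gagliardo_fin f : (gagliardo f <= gagliardo u)%E -> gagliardo f = (2 * pi * ((2 * pi)^-1 * fine (gagliardo f)))%:E.
Proof.
move=> h; rewrite mulrA mulfV ?gt_eqF ?twopi_gt0// mul1r fineK//.
by rewrite ge0_fin_numE ?gagliardo_ge0// (le_lt_trans h)// (le_lt_trans uE)// ltry.
Qed.

(** Divided by 2 pi to be on the scale of [E]. As [fine] sends an infinite value to 0, the number is
    meaningful for truncations and layers, whose Gagliardo integral is at most that of [u]. *)
Definition energy f := (2 * pi)^-1 * fine (gagliardo f).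

Lemma energy_ge0 f : 0 <= energy f.
Proof. by rewrite mulr_ge0 ?invr_ge0 ?(ltW twopi_gt0) ?fine_ge0 ?gagliardo_ge0. Qed.

Lemma lip_le (f : R -> R) : (forall x y, x <= y -> f x <= f y /\ f y - f x <= y - x) ->
  forall x y, `|f x - f y| <= `|x - y|.
Proof.
move=> h x y; have [xy|yx] := lerP x y.
  by have [h1 h2] := h _ _ xy; rewrite distrC ger0_norm ?subr_ge0.
by have [h1 h2] := h _ _ (ltW yx); rewrite ger0_norm ?subr_ge0// ltW.
Qed.

Lemma gagliardo_trunc_at s : (gagliardo (trunc_at s) <= gagliardo u)%E.
Proof.
apply: gagliardo_mono => x y; apply: (@lip_le (fun a => Num.min a s)) => a b ab.
by case: (lerP a s) => ?; case: (lerP b s) => ?; split; lra.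
Qed.

Lemma gagliardo_layer_trunc_at d s : d <= s -> (gagliardo (layer d s) <= gagliardo (trunc_at s))%E.
Proof.
move=> ds; apply: gagliardo_mono => x y; rewrite /layer /trunc_at.
wlog xy : x y / u x <= u y => [hw|].
  by have [/hw//|/ltW/hw] := leP (u x) (u y); rewrite distrC [leRHS]distrC.
rewrite distrC [leRHS]distrC.
case: (lerP (u x) d) => ?; case: (lerP (u y) d) => ?;
 case: (lerP (u x) s) => ?; case: (lerP (u y) s) => ?; rewrite !ger0_norm; lra.
Qed.

Definition total f := sqnorm f + energy f.

Lemma gagliardo_trunc_at_energy s : gagliardo (trunc_at s) = (2 * pi * energy (trunc_at s))%:E.
Proof. exact/gagliardo_fin/gagliardo_trunc_at. Qed.

Lemma gagliardo_layer_trunc_at_energy d s : d <= s -> (gagliardo (layer d s) <= (2 * pi * energy (trunc_at s))%:E)%E.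
Proof. by move=> ds; rewrite -gagliardo_trunc_at_energy; exact: gagliardo_layer_trunc_at. Qed.

Lemma gagliardo_layer_u d s : d <= s -> (gagliardo (layer d s) <= gagliardo u)%E.
Proof. by move=> ds; rewrite (le_trans (gagliardo_layer_trunc_at ds))// gagliardo_trunc_at. Qed.

Lemma gagliardo_layer_energy d s : d <= s -> gagliardo (layer d s) = (2 * pi * energy (layer d s))%:E.
Proof. by move=> ds; exact/gagliardo_fin/gagliardo_layer_u. Qed.

(** The truncation and the layer are nonnegative nondecreasing functions of [u], and their sum is a
    truncation of [u]. Values and increments thus have equal signs, and the squares are
    superadditive pointwise. *)
Lemma total_add s s' : 0 < s -> s <= s' -> total (trunc_at s) + total (layer s s') <= 1.
Proof.
move=> s0 ss'.
have h1 : sqnorm (trunc_at s) + sqnorm (layer s s') <= sqnorm u.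
  apply: sqnorm_superadd => //; [exact: L2_trunc_at|exact/L12_L2/L12_layer|].
  move=> x; have := u0 x; rewrite /trunc_at /layer.
  by case: (lerP (u x) s) => ?; case: (lerP (u x) s') => ?; nra.
have h2 : (gagliardo (trunc_at s) + gagliardo (layer s s') <= gagliardo u)%E.
  apply: gagliardo_superadd; [exact: measurable_trunc_at|exact: measurable_layer|].
  move=> x y; rewrite /trunc_at /layer.
  wlog xy : x y / u x <= u y => [hw|].
    have [/hw//|/ltW/hw] := leP (u x) (u y).
    by rewrite -(sqrrN (_ - u x)) -(sqrrN (_ - Num.min (u x) s)) -(sqrrN (_ - (_ - Num.min (u x) s))) !opprB.
  rewrite -(sqrrN (u x - _)) -(sqrrN (Num.min (u x) s - _)) -(sqrrN (_ - _ - (_ - Num.min (u y) s))) !opprB.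
  case: (lerP (u x) s) => ?; case: (lerP (u y) s) => ?;
   case: (lerP (u x) s') => ?; case: (lerP (u y) s') => ?; nra.
have h3 : energy (trunc_at s) + energy (layer s s') <= E.
  have := le_trans h2 uE; rewrite gagliardo_trunc_at_energy gagliardo_layer_energy// -EFinD lee_fin -mulrDr.
  by rewrite ler_pM2l// twopi_gt0.
by rewrite /total; have := norm1; lra.
Qed.

Lemma total_ge0 f : 0 <= total f.
Proof. by rewrite addr_ge0 ?sqnorm_ge0 ?energy_ge0. Qed.

(* The cut at d > 0 only makes the layer integrable, and is removed afterwards. *)
Lemma first_estimate_aux s d : 0 < d -> d < s -> 0 < superlevel_measure s -> superlevel_measure s <= 1 ->
  (s - d) ^+ 2 <= total (trunc_at s) * (pi^-1 + cap_const (superlevel_measure s) 1).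
Proof.
move=> d0 ds m0 m1.
have s0 : 0 < s by exact: lt_trans ds.
have Ll := L12_layer d0 (ltW ds).
have l1 := cap_const_ge1 m0 m1.
set c := Num.sqrt (sqnorm (trunc_at s) / pi).
have cle : forall t x, 1 <= t -> \int[mu]_y (layer d s y * poisson t (x - y)) <= c.
  move=> t x t1; rewrite (le_trans (Pconv_le_sqnorm x t1 Ll))// ler_sqrt; last first.
    by rewrite mulr_ge0 ?sqnorm_ge0 ?invr_ge0 ?pi_ge0.
  rewrite ler_pM2r ?invr_gt0 ?pi_gt0//.
  apply: sqnorm_mono; [exact: L12_L2|exact: L2_trunc_at|] => x'.
  rewrite (ger0_norm (layer_ge0 _ (ltW ds))) /layer /trunc_at ger0_norm.
    by have := u0 x'; case: (lerP (u x') d) => ?; case: (lerP (u x') s) => ?; lra.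
  by have := u0 x'; case: (lerP (u x') s) => ?; lra.
(* [capacity] with b = 1: from height 1 on, the extension is controlled by the L^2 norm, the part of
   the budget not spent on energy. *)
have h : s - d <= c + Num.sqrt (energy (trunc_at s) * cap_const (superlevel_measure s) 1).
  have [cs|cs] := lerP c (s - d); last first.
    by rewrite (le_trans (ltW cs))// lerDl sqrtr_ge0.
  rewrite -lerBlDl -[leLHS]ger0_norm ?subr_ge0// -sqrtr_sqr ler_sqrt; last first.
    by rewrite mulr_ge0 ?energy_ge0//; lra.
  apply: (capacity (measurable_superlevel s) m0 (superlevel_fin s0) m1 Ll (energy_ge0 _)
     (gagliardo_layer_trunc_at_energy (ltW ds)) _ cle cs) => x.
  exact: layer_superlevel (ltW ds).
rewrite /total; move: h; rewrite /c.
have := sqnorm_ge0 (trunc_at s); have := energy_ge0 (trunc_at s).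
move: (sqnorm (trunc_at s)) (energy (trunc_at s)) (cap_const _ _) l1 => p q l l1 q0 p0.
have i0 : 0 <= pi^-1 :> R by rewrite invr_ge0 pi_ge0.
move: (pi^-1) i0 => i i0 h.
have sd : 0 <= s - d by rewrite subr_ge0 ltW.
have pi0 : 0 <= p * i by rewrite mulr_ge0.
have ql0 : 0 <= q * l by rewrite mulr_ge0//; lra.
have := sqr_sqrtr pi0; have := sqr_sqrtr ql0.
have := sqrtr_ge0 (p * i); have := sqrtr_ge0 (q * l).
move: h; set A := Num.sqrt (p * i); set B := Num.sqrt (q * l) => h B0 A0 B2 A2.
have h2 : (s - d) ^+ 2 <= (A + B) ^+ 2 by rewrite !expr2 ler_pM.
apply: (le_trans h2).
(* Cauchy-Schwarz: (A + B)^2 <= (p + q) (i + l), so norm and energy enter only through their sum,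
   [total]. *)
have : (2 * (A * B)) <= p * l + q * i.
  have AB : (A * B) ^+ 2 = (p * l) * (q * i) by rewrite exprMn B2 A2; ring.
  have x0 : 0 <= p * l by rewrite mulr_ge0//; lra.
  have y0 : 0 <= q * i by rewrite mulr_ge0.
  rewrite -(ler_pXn2r (n := 2)) ?nnegrE ?mulr_ge0 ?addr_ge0//.
  rewrite exprMn AB -subr_ge0 (_ : _ - _ = (p * l - q * i) ^+ 2); first exact: sqr_ge0.
  by ring.
rewrite (_ : (A + B) ^+ 2 = A ^+ 2 + B ^+ 2 + 2 * (A * B)); last by ring.
by rewrite A2 B2; lra.
Qed.

(** After multiplication by pi the coefficient of - ln of the measure is exactly 1: here the sharp
    exponent pi enters. *)
Lemma first_estimate s : 0 < s -> 0 < superlevel_measure s -> superlevel_measure s <= 1 ->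
  pi * s ^+ 2 <= total (trunc_at s) * (1 + pi - ln (superlevel_measure s)).
Proof.
move=> s0 m0 m1.
have -> : total (trunc_at s) * (1 + pi - ln (superlevel_measure s)) = pi * (total (trunc_at s) * (pi^-1 + cap_const (superlevel_measure s) 1)).
  rewrite /cap_const div1r lnV ?posrE//.
  have := @pi_neq0 R; move: (total _) (ln _) (pi : R) => a b p p0; field.
  by rewrite p0.
rewrite ler_pM2l ?pi_gt0//.
have := @first_estimate_aux s; move: (total _ * _) => K h.
have {}h d : 0 < d -> d < s -> (s - d) ^+ 2 <= K by move=> d0 ds; exact: h.
rewrite leNgt; apply/negP => Ks.
have K0 : 0 <= K by rewrite (le_trans (sqr_ge0 (s - s / 2)))// h ?divr_gt0//; lra.
(* If K < s^2, then 2 s d <= (s^2 - K) / 2, so (s - d)^2 still exceeds K. *)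
pose d := Num.min (s / 2) ((s ^+ 2 - K) / (4 * s)).
have d0 : 0 < d by rewrite lt_min !divr_gt0// ?subr_gt0// mulr_gt0.
have d1 : d <= s / 2 by rewrite ge_min lexx.
have d2 : d * (4 * s) <= s ^+ 2 - K.
  by rewrite -ler_pdivlMr ?ge_min ?lexx ?orbT// mulr_gt0.
have := h d d0 ltac:(lra).
by nra.
Qed.

(* A Poisson extension at height at least |{u > s}| sees at most the fraction
   1 / pi of the layer, so at least half of the jump s' - s costs energy. *)
Lemma second_estimate s s' : 0 < s -> s < s' -> 0 < superlevel_measure s' ->
  (s' - s) ^+ 2 <= 4 * (1 - total (trunc_at s)) * (1 + ln (superlevel_measure s) - ln (superlevel_measure s')).
Proof.
move=> s0 ss' m'0.
have s'0 : 0 < s' by exact: lt_trans ss'.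
have mm := superlevel_measure_mono s0 (ltW ss').
have m0 : 0 < superlevel_measure s by exact: lt_le_trans mm.
have Ll := L12_layer s0 (ltW ss').
have l1 := cap_const_ge1 m'0 mm.
have H0 : 0 < s' - s by rewrite subr_gt0.
set H := s' - s in H0 *.
have p2 := pi_ge2 R.
have cH : H / pi <= H by rewrite ler_pdivrMr ?pi_gt0// ler_peMr ?(ltW H0)//; lra.
(* The layer is at most H times the indicator of {u > s}, and the kernel is at most 1 / (pi t). *)
have cle : forall t x, superlevel_measure s <= t -> \int[mu]_y (layer s s' y * poisson t (x - y)) <= H / pi.
  move=> t x mt.
  have t0 : 0 < t by exact: lt_le_trans mt.
  have ii : mu.-integrable setT (EFin \o (\1_(superlevel s) : R -> R)).
    exact: (indE_integrable (measurable_superlevel s) (superlevel_fin s0)).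
  apply: (@le_trans _ _ (\int[mu]_y (H / (pi * t) * \1_(superlevel s) y))).
    apply: le_Rintegral => //.
    - exact: poisson_conv_integrable Ll.1.
    - exact: integrable_scale.
    - move=> y _; rewrite indicE; have [yl|yl] := boolP (y \in superlevel s).
        rewrite mulr1 ler_pM ?poisson_ge0 ?layer_ge0 ?(ltW ss')//.
          exact: layer_le (ltW ss').
        exact: poisson_le.
      rewrite mulr0 layer_out ?mul0r//; first exact: ltW.
      by move/mem_set; exact/negP.
  rewrite RintegralZl//.
  have -> : \int[mu]_x (\1_(superlevel s) x) = superlevel_measure s.
    by apply: EFin_inj; rewrite -integrable_fune// (int_indE (measurable_superlevel s) (superlevel_fin s0)).
  rewrite invfM mulrA -mulrA ler_piMr//.
    by rewrite divr_ge0 ?pi_ge0// ltW.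
  by rewrite mulrC ler_pdivrMr// mul1r.
have ge : (gagliardo (layer s s') <= (2 * pi * energy (layer s s'))%:E)%E by rewrite -gagliardo_layer_energy// ltW.
have h := capacity (measurable_superlevel s') m'0 (superlevel_fin s'0) mm Ll (energy_ge0 _) ge
  (fun x => @layer_superlevel s s' x (ltW ss')) cle cH.
have t1 := total_add s0 (ltW ss').
have n0 := sqnorm_ge0 (layer s s'); have e0 := energy_ge0 (layer s s').
have eT : energy (layer s s') <= 1 - total (trunc_at s) by rewrite /total in t1 *; lra.
(* The coefficient 1 / pi of the logarithm is replaced by 1; sharpness matters only in
   [first_estimate]. *)
have hl : cap_const (superlevel_measure s') (superlevel_measure s) <= 1 + ln (superlevel_measure s) - ln (superlevel_measure s').
  rewrite /cap_const lnM ?posrE ?invr_gt0// lnV ?posrE// -addrA lerD2l ler_piMl//.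
    by rewrite subr_ge0 ler_ln ?posrE.
  by rewrite invf_le1 ?pi_gt0//; lra.
(* Uses pi >= 2; squaring the half jump gives the factor 4. *)
have hq : H / 2 <= H - H / pi.
  have : H / pi <= H / 2 by rewrite ler_pM2l// lef_pV2 ?posrE ?pi_gt0.
  lra.
have h4 : (H / 2) ^+ 2 <= (H - H / pi) ^+ 2 by rewrite !expr2 ler_pM//; lra.
have h5 : energy (layer s s') * cap_const (superlevel_measure s') (superlevel_measure s) <= (1 - total (trunc_at s)) * (1 + ln (superlevel_measure s) - ln (superlevel_measure s')).
  by apply: ler_pM => //; lra.
have := le_trans h4 (le_trans h h5).
rewrite -mulrA (_ : (H / 2) ^+ 2 = H ^+ 2 / 4); last by field.
by move: ((1 - total (trunc_at s)) * _) (H ^+ 2) => K H2; lra.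
Qed.

End layers.

(** * Garsia's argument *)

Section garsia.
Context {R : realType}.
Implicit Types (q x : R) (n k j : nat).

Lemma sum_geom q n : 0 <= q -> q < 1 -> \sum_(i < n) q ^+ i <= (1 - q)^-1.
Proof.
move=> q0 q1; have q10 : 0 < 1 - q by rewrite subr_gt0.
rewrite -[leRHS]mul1r ler_pdivlMr//.
have -> : (\sum_(i < n) q ^+ i) * (1 - q) = 1 - q ^+ n.
  elim: n => [|n IH]; first by rewrite big_ord0 mul0r expr0 subrr.
  by rewrite big_ord_recr /= mulrDl IH exprS; ring.
by rewrite gerBl exprn_ge0.
Qed.

(** With truncated subtraction the exponent is the distance |i - j|; splitting at j leaves two
    geometric sums. *)
Lemma sum_geom_dist q n j : 0 <= q -> q < 1 ->
  \sum_(i < n) q ^+ ((i - j) + (j - i)) <= 2 * (1 - q)^-1.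
Proof.
move=> q0 q1.
apply: (@le_trans _ _ (\sum_(i < n) (if (i < j)%N then q ^+ (j - i) else 0) +
   \sum_(i < n) (if (j <= i)%N then q ^+ (i - j) else 0))).
  rewrite -big_split /=; apply: ler_sum => i _.
  case: (ltnP i j) => ij.
    by rewrite addr0; have /eqP -> : (i - j == 0)%N by rewrite subn_eq0 ltnW.
  by rewrite add0r; have /eqP -> : (j - i == 0)%N by [rewrite subn_eq0]; rewrite addn0.
rewrite mulr_natl mulr2n; apply: lerD.
  apply: (le_trans _ (sum_geom j.+1 q0 q1)).
  elim: n j => [|n IH] j; first by rewrite big_ord0 sumr_ge0// => i _; rewrite exprn_ge0.
  case: j => [|j]; first by rewrite big1 ?sumr_ge0// => i _; rewrite exprn_ge0.
  rewrite big_ord_recl [leRHS]big_ord_recr /= subn0 addrC; apply: lerD => //.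
  exact: IH.
apply: (le_trans _ (sum_geom (n - j) q0 q1)).
elim: n => [|n IH]; first by rewrite big_ord0 sumr_ge0// => i _; rewrite exprn_ge0.
rewrite big_ord_recr /=; case: leqP => jn.
  by rewrite subSn// [leRHS]big_ord_recr /= lerD2r.
rewrite addr0; have /eqP e : (n.+1 - j == 0)%N by rewrite subn_eq0.
rewrite e big_ord0; apply: (le_trans IH).
have /eqP -> : (n - j == 0)%N by rewrite subn_eq0 ltnW.
by rewrite big_ord0.
Qed.

Section garsia_sum.
Variables (n : nat) (P : pred nat) (G : nat -> R) (c e : R).
Hypotheses (c0 : 0 < c) (c256 : c * 256 <= 1) (e0 : 0 < e) (e512 : e * 512 <= 1).
Hypothesis P1 : forall k, P k -> (0 < k)%N.
Hypothesis G0 : forall k, P k -> 0 <= G k.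
Hypothesis GI : forall a b, P a -> P b -> (a < b)%N ->
  (b%:R - a%:R) ^+ 2 <= 64 * b%:R * (G a / a%:R) * (1 + (b%:R - a%:R) + G b).

(** Indices with a small relative loss. For the others exp (- G k) is below a geometric sequence in
    k. *)
Let good k := P k && (G k <= e * k%:R).

(* Otherwise G b <= d for the distance d of the indices, and the hypothesis fails
   both for d <= a and for d > a. *)
Let pair_good a b : good a -> good b -> (a < b)%N ->
  c * (b%:R - a%:R) <= 1 + Num.max (G a) (G b).
Proof.
move=> /andP[Pa ga] /andP[Pb gb] ab; rewrite leNgt; apply/negP => h.
have := GI Pa Pb ab.
have a0 : 0 < a%:R :> R by rewrite ltr0n P1.
have Ga := G0 Pa; have Gb := G0 Pb.
have abR : a%:R < b%:R :> R by rewrite ltr_nat.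
have d1 : 1 <= b%:R - a%:R :> R by rewrite lerBrDr addrC natr1 ler_nat.
move: h; rewrite -[b%:R](subrK a%:R) addrK; move: (b%:R - a%:R) d1 => d d1.
have ma : G a <= Num.max (G a) (G b) by rewrite le_max lexx.
have mb : G b <= Num.max (G a) (G b) by rewrite le_max lexx orbT.
move: (Num.max _ _) ma mb => M ma mb h.
have cd : c * d * 256 <= d by rewrite mulrAC ler_piMl//; lra.
have Gbd : 1 + d + G b <= 2 * d by lra.
set r := G a / a%:R.
have r0 : 0 <= r by rewrite /r divr_ge0// ltW.
have Gr : G a = r * a%:R by rewrite /r divfK// gt_eqF.
have re : r <= e by rewrite /r ler_pdivrMr.
have r512 : r * 512 <= 1 by exact: le_trans (ler_wpM2r (ler0n _ _) re) e512.
move: (a%:R) a0 Gr => A A0 Gr h2 {ga gb}.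
have h3 : d ^+ 2 <= 128 * (d + A) * r * d.
  apply: (le_trans h2).
  rewrite (_ : 128 * (d + A) * r * d = 64 * (d + A) * r * (2 * d)); last by ring.
  by rewrite ler_wpM2l// !mulr_ge0//; lra.
have d0 : 0 < d by lra.
have {h3} : d <= 128 * (d + A) * r by rewrite -(ler_pM2r d0) -expr2.
have rd0 : 0 <= r * d by rewrite mulr_ge0// ltW.
have rA0 : 0 <= r * A by rewrite mulr_ge0// ltW.
(* For d <= A this gives d <= 256 G a, against 256 (1 + G a) < d. For d > A it gives d <= 256 r d <=
   d / 2. Hence the constants 256 and 512. *)
have [dA|dA] := leP d A => h3.
  have : r * d <= r * A by rewrite ler_wpM2l.
  by lra.
have : r * A <= r * d by rewrite ler_wpM2l// ltW.
have : r * d * 512 <= d by rewrite mulrAC ler_piMl// ltW.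
by lra.
Qed.

Let C : R := 2 * (1 - expR (- c))^-1.
Let K : R := (1 - expR (- e))^-1.

Let q_bounds (s : R) : 0 < s -> 0 <= expR (- s) /\ expR (- s) < 1.
Proof. by move=> s0; split; rewrite ?expR_ge0// expR_lt1 oppr_lt0. Qed.

Let sum_bad : \sum_(k < n | P k && ~~ good k) expR (- G k) <= K.
Proof.
have [q0 q1] := q_bounds e0.
apply: (le_trans _ (sum_geom n q0 q1)).
rewrite big_mkcond; apply: ler_sum => k _.
case: ifPn => [/andP[Pk]|_]; last by rewrite exprn_ge0.
rewrite /good Pk /= -ltNge => h.
by rewrite -expRM_natl ler_expR mulrN mulrC lerN2 ltW.
Qed.

(** Compare with a good index j that minimizes [G]: the maximum in [pair_good] is then G k, so G k
    >= c |k - j| - 1 and the sum is geometric around j. *)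
Let sum_good : \sum_(k < n | good k) expR (- G k) <= expR 1 * C.
Proof.
have [q0 q1] := q_bounds c0.
have C0 : 0 <= C by rewrite /C mulr_ge0// invr_ge0 subr_ge0 ltW.
have [[i0 gi0]|none] := pselect (exists i : 'I_n, good i); last first.
  rewrite big1; first exact: mulr_ge0 (expR_ge0 _) C0.
  by move=> i gi; exfalso; apply: none; exists i.
have [j gj jmin] := @Order.TotalTheory.arg_minP _ R _ i0 (fun i : 'I_n => good i) (fun i : 'I_n => G i) gi0.
apply: (@le_trans _ _ (expR 1 * \sum_(i < n) expR (- c) ^+ ((i - j) + (j - i)))); last first.
  by rewrite ler_wpM2l ?expR_ge0//; exact: sum_geom_dist.
rewrite big_distrr /= big_mkcond; apply: ler_sum => k _.
case: ifPn => [gk|_]; last by rewrite mulr_ge0 ?expR_ge0// exprn_ge0.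
rewrite -expRM_natl -expRD ler_expR.
have jk := jmin k gk.
have [kj|jk'|/ord_inj ->] := ltngtP k j.
- have := pair_good gk gj kj; rewrite max_l//.
  have /eqP -> : (k - j == 0)%N by rewrite subn_eq0 ltnW.
  by rewrite add0n natrB ?(ltnW kj)// mulrN mulrC; lra.
- have := pair_good gj gk jk'; rewrite max_r//.
  have /eqP -> : (j - k == 0)%N by rewrite subn_eq0 ltnW.
  by rewrite addn0 natrB ?(ltnW jk')// mulrN mulrC; lra.
- rewrite subnn addn0 mul0r addr0.
  by have := G0 (proj1 (andP gj)); lra.
Qed.

Lemma garsia_sum : \sum_(k < n | P k) expR (- G k) <=
  expR 1 * (2 * (1 - expR (- c))^-1) + (1 - expR (- e))^-1.
Proof.
rewrite (bigID (fun k : 'I_n => good k)) /=; apply: lerD => //.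
rewrite (eq_bigl (fun k : 'I_n => good k)); first exact: sum_good.
by move=> k; rewrite /good andbA andbb.
Qed.

End garsia_sum.

(** One K serves all n, P and G, hence all functions of the unit ball. *)
Lemma garsia_bound : exists K : R, forall (n : nat) (P : pred nat) (G : nat -> R),
  (forall k, P k -> (0 < k)%N) -> (forall k, P k -> 0 <= G k) ->
  (forall a b, P a -> P b -> (a < b)%N ->
    (b%:R - a%:R) ^+ 2 <= 64 * b%:R * (G a / a%:R) * (1 + (b%:R - a%:R) + G b)) ->
  \sum_(k < n | P k) expR (- G k) <= K.
Proof.
have inv (x : R) : 0 < x -> exists2 c : R, 0 < c & c * x <= 1.
  by move=> x0; exists x^-1; rewrite ?invr_gt0// mulVf// gt_eqF.
have h1 : 0 < 256 :> R by rewrite ltr0n.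
have h2 : 0 < 512 :> R by rewrite ltr0n.
have [c c0 c1] := inv _ h1; have [e e0 e1] := inv _ h2.
exists (expR 1 * (2 * (1 - expR (- c))^-1) + (1 - expR (- e))^-1) => n P G P1 G0 GI.
exact: garsia_sum c0 c1 e0 e1 P1 G0 GI.
Qed.

End garsia.

(** * The exponential integral over the levels s_k *)

Section exponential_integral.
Context {R : realType}.
Notation mu := (@lebesgue_measure R).
Variables (u : R -> R) (E : R).
Hypothesis u0 : forall x, 0 <= u x.
Hypothesis Lu : L2 u.
Hypothesis uE : (gagliardo u <= (2 * pi * E)%:E)%E.
Hypothesis norm1 : sqnorm u + E <= 1.

Let s (k : nat) : R := Num.sqrt (k%:R / pi).
Let m k := superlevel_measure u (s k).
(** From k = 4 on, s_k >= 1 because pi <= 4, so Chebyshev gives the measure bound 1 that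
    [first_estimate] asks for. Null levels are left out: they contribute nothing, and their
    logarithm would be a default value. *)
Let P k := (4 <= k)%N && (0 < m k).
(** The shift 1 + pi is the additive constant of [first_estimate]; with it, m k = exp (1 + pi - k -
    G k) and k <= total (G k + k). *)
Let G k := - ln (m k) - k%:R + 1 + pi.

Let s_sq k : pi * s k ^+ 2 = k%:R.
Proof.
by rewrite sqr_sqrtr ?divr_ge0 ?pi_ge0// mulrC divfK// pi_neq0.
Qed.

Let s_gt0 k : (0 < k)%N -> 0 < s k.
Proof. by move=> k0; rewrite sqrtr_gt0 divr_gt0 ?pi_gt0// ltr0n. Qed.

Let pi_le4 : pi <= 4 :> R.
Proof. by have := pihalf_lt2 R; lra. Qed.

Let m_le1 k : (4 <= k)%N -> m k <= 1.
Proof.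
move=> k4; have sk := s_gt0 (leq_trans (isT : (0 < 4)%N) k4).
apply: le_trans (superlevel_measure_le Lu uE norm1 sk).
rewrite ler_peMl ?superlevel_measure_ge0// -(ler_pM2l (pi_gt0 R)) s_sq mulr1.
by apply: (le_trans pi_le4); rewrite ler_nat.
Qed.

Let first k : P k -> k%:R <= total (trunc_at u (s k)) * (G k + k%:R).
Proof.
move=> /andP[k4 mk]; rewrite -s_sq.
apply: (le_trans (first_estimate u0 Lu uE (s_gt0 (leq_trans (isT : (0 < 4)%N) k4)) mk (m_le1 k4))).
rewrite le_eqVlt; apply/orP; left; apply/eqP.
by rewrite s_sq /G -/(m k); ring.
Qed.

Let total_le1 k : (0 < k)%N -> total (trunc_at u (s k)) <= 1.
Proof.
move=> k0; have := total_add u0 Lu uE norm1 (s_gt0 k0) (lexx _).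
by have := total_ge0 (layer u (s k) (s k)); lra.
Qed.

Let P_gt0 k : P k -> (0 < k)%N.
Proof. by case/andP => k4 _; exact: leq_trans k4. Qed.

Let G_ge0 k : P k -> 0 <= G k.
Proof.
move=> Pk; have := first Pk; have /andP[k4 mk] := Pk.
have := total_le1 (P_gt0 Pk).
have : 0 <= G k + k%:R.
  have := ln_le0 (m_le1 k4); rewrite /G; have := pi_ge0 R; lra.
by nra.
Qed.

(** With T the total, k <= T (G + k) rearranges to (1 - T) k <= T G <= G. *)
Let defect k : P k -> 1 - total (trunc_at u (s k)) <= G k / k%:R.
Proof.
move=> Pk; have k0 := P_gt0 Pk; rewrite ler_pdivlMr ?ltr0n//.
by have := first Pk; have := total_le1 k0; have := G_ge0 Pk; nra.
Qed.

Let garsia_hyp a b : P a -> P b -> (a < b)%N ->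
  (b%:R - a%:R) ^+ 2 <= 64 * b%:R * (G a / a%:R) * (1 + (b%:R - a%:R) + G b).
Proof.
move=> Pa Pb ab.
have a0 := s_gt0 (P_gt0 Pa); have b0 := s_gt0 (P_gt0 Pb).
have sab : s a < s b.
  by rewrite ltr_sqrt ?divr_gt0 ?pi_gt0 ?ltr0n ?(P_gt0 Pb)// ltr_pM2r ?invr_gt0 ?pi_gt0// ltr_nat.
have mb : 0 < m b by case/andP: Pb.
have := second_estimate u0 Lu uE norm1 a0 sab mb.
have -> : 1 + ln (superlevel_measure u (s a)) - ln (superlevel_measure u (s b)) = 1 + (b%:R - a%:R) + (G b - G a).
  by rewrite /G -/(m a) -/(m b); ring.
have d := defect Pa; have Ga := G_ge0 Pa; have Gb := G_ge0 Pb.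
have t1 : 0 <= 1 - total (trunc_at u (s a)) by rewrite subr_ge0 total_le1// P_gt0.
have abR : 0 <= b%:R - a%:R :> R by rewrite subr_ge0 ler_nat ltnW.
(* b - a = pi (s_b - s_a) (s_b + s_a), and s_a + s_b <= 2 s_b. *)
have e1 : (b%:R - a%:R) ^+ 2 <= 4 * pi * b%:R * (s b - s a) ^+ 2 :> R.
  rewrite -(s_sq a) -(s_sq b) -mulrBr subr_sqr.
  have -> : (pi * ((s b - s a) * (s b + s a))) ^+ 2 =
    pi ^+ 2 * (s b - s a) ^+ 2 * (s b + s a) ^+ 2 by ring.
  have -> : 4 * pi * (pi * s b ^+ 2) * (s b - s a) ^+ 2 =
    pi ^+ 2 * (s b - s a) ^+ 2 * (2 * s b) ^+ 2 by ring.
  apply: ler_wpM2l; first by rewrite mulr_ge0 ?sqr_ge0.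
  by rewrite expr2 [leRHS]expr2; apply: ler_pM; lra.
have b0R : 0 <= b%:R :> R by rewrite ler0n.
move: t1 d Ga Gb abR e1 => {a0 b0 sab}.
move: (1 - total _) (G a) (G b) (b%:R - a%:R) (G a / a%:R) => t ga gb d r t0 tr ga0 gb0 d0 e1 h.
apply: (le_trans e1).
have h2 : (s b - s a) ^+ 2 <= 4 * r * (1 + d + gb).
  apply: (@le_trans _ _ (4 * t * (1 + d + gb))).
    by apply: (le_trans h); apply: ler_wpM2l; lra.
  by apply: ler_wpM2r; lra.
(* Here 4 pi <= 16; with the 4 of [second_estimate] this makes 64. *)
apply: (@le_trans _ _ (16 * b%:R * (4 * r * (1 + d + gb)))).
  apply: ler_pM => //; [by rewrite !mulr_ge0 ?pi_ge0|exact: sqr_ge0|].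
  by rewrite ler_wpM2r//; have := pi_le4; lra.
by rewrite le_eqVlt; apply/orP; left; apply/eqP; ring.
Qed.

Variable K : R.
Hypothesis garsiaK : forall (n : nat) (P : pred nat) (G : nat -> R),
  (forall k, P k -> (0 < k)%N) -> (forall k, P k -> 0 <= G k) ->
  (forall a b, P a -> P b -> (a < b)%N ->
    (b%:R - a%:R) ^+ 2 <= 64 * b%:R * (G a / a%:R) * (1 + (b%:R - a%:R) + G b)) ->
  \sum_(k < n | P k) expR (- G k) <= K.

(** By the choice of [G], exp (k + 1) m k = exp (2 + pi) exp (- G k). *)
Let layer_sum n : \sum_(k < n | (4 <= k)%N) expR (k.+1%:R) * m k <= expR (2 + pi) * K.
Proof.
apply: (@le_trans _ _ (\sum_(k < n | P k) expR (2 + pi) * expR (- G k))).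
  rewrite big_mkcond [leRHS]big_mkcond; apply: ler_sum => k _.
  rewrite /P; case: (4 <= k)%N => //=.
  case: ifPn => [mk|]; last first.
    by rewrite -leNgt => mk; rewrite pmulr_rle0 ?expR_gt0.
  rewrite -[X in _ * X](lnK mk) -!expRD ler_expR.
  by rewrite /G -natr1; lra.
rewrite -big_distrr /= ler_wpM2l ?expR_ge0//.
exact: garsiaK P_gt0 G_ge0 garsia_hyp.
Qed.

(** Cutting the integrand off at level n leaves finitely many layers; Fatou removes the cut in the
    end. *)
Let f n x : R := if pi * u x ^+ 2 <= n%:R then expR (pi * u x ^+ 2) - 1 else 0.

Let y0 x : 0 <= pi * u x ^+ 2.
Proof. by rewrite mulr_ge0 ?pi_ge0 ?sqr_ge0. Qed.

(** Put y = pi u^2. For y <= 4, exp y - 1 <= y exp y is paid by the L^2 norm. For k < y <= k + 1 the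
    point lies in the superlevel set of s_k, whose term exp (k + 1) suffices. *)
Let pointwise n x : f n x <=
  expR 4 * pi * u x ^+ 2 + \sum_(k < n | (4 <= k)%N) expR (k.+1%:R) * \1_(superlevel u (s k)) x.
Proof.
have S0 : 0 <= \sum_(k < n | (4 <= k)%N) expR (k.+1%:R) * (\1_(superlevel u (s k)) x : R).
  by apply: sumr_ge0 => k _; rewrite mulr_ge0 ?expR_ge0// indicE.
have q0 : 0 <= expR 4 * pi * u x ^+ 2 by rewrite -mulrA mulr_ge0 ?expR_ge0.
rewrite /f; case: ifPn => [yn|_]; last by rewrite addr_ge0.
have [y4|y4] := leP (pi * u x ^+ 2) 4.
  apply: (@le_trans _ _ (expR 4 * pi * u x ^+ 2)); last by rewrite lerDl.
  rewrite -mulrA; move: (pi * u x ^+ 2) (y0 x) y4 => y yy0 y4.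
  apply: (@le_trans _ _ (expR y * y)); last by rewrite ler_wpM2r// ler_expR.
  have := expR_ge1Dx (- y); have := expR_gt0 y; have := expRxMexpNx_1 y.
  by move: (expR y) (expR (- y)) => p q pq p0 q1; nra.
apply: (@le_trans _ _ (\sum_(k < n | (4 <= k)%N) expR (k.+1%:R) * \1_(superlevel u (s k)) x)); last by rewrite lerDr.
have [k [k4 kn ky yk]] : exists k : nat, [/\ (4 <= k)%N, (k < n)%N, k%:R < pi * u x ^+ 2 & pi * u x ^+ 2 <= k.+1%:R].
  have ex : exists j : nat, pi * u x ^+ 2 <= j%:R by exists n.
  (* The required k is the predecessor of the least integer above y. *)
  case: (ex_minnP ex) => -[|j] yj jmin.
    by exfalso; move: yj; rewrite leNgt (lt_trans _ y4).
  have jy : j%:R < pi * u x ^+ 2.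
    by rewrite ltNge; apply/negP => /jmin; rewrite ltnn.
  exists j; split=> //; last by rewrite -ltnS ltnS; exact: jmin.
  have : 4 < j.+1%:R :> R by exact: lt_le_trans yj.
  by rewrite ltr_nat.
rewrite (bigD1 (Ordinal kn)) //= (_ : \1_(superlevel u (s k)) x = 1); last first.
  rewrite indicE mem_set// /superlevel /=.
  rewrite -[ltRHS]ger0_norm// -sqrtr_sqr ltr_sqrt.
    by rewrite ltr_pdivrMr ?pi_gt0// mulrC.
  by rewrite -(pmulr_rgt0 _ (pi_gt0 R)) (lt_trans _ y4).
rewrite mulr1 (@le_trans _ _ (expR k.+1%:R))//.
  by rewrite lerBlDr (@le_trans _ _ (expR k.+1%:R)) ?ler_expR// lerDl.
by rewrite lerDl; apply: sumr_ge0 => j _; rewrite mulr_ge0 ?expR_ge0// indicE.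
Qed.

Lemma exponential_integral_nonneg :
  (\int[mu]_x (expR (pi * u x ^+ 2) - 1)%:E <=
    (expR 4 * pi + expR (2 + pi) * K)%:E)%E.
Proof.
have mu_ : measurable_fun setT u by case: Lu.
have nu1 : sqnorm u <= 1.
  have : 0 <= E.
    by have := le_trans (gagliardo_ge0 u) uE; rewrite lee_fin pmulr_rge0// twopi_gt0.
  by have := norm1; lra.
apply: (@fatou_le _ _ _ mu f).
- move=> n; rewrite /f; apply: measurable_fun_ifT.
  + by apply: measurable_fun_ler; solve_measurable.
  + by solve_measurable.
  + by solve_measurable.
- by move=> n x; rewrite /f; case: ifPn => // _; rewrite subr_ge0 -expR0 ler_expR.
- move=> x; apply: cvg_near_cst.
  near=> n; rewrite /f ifT//.
  by near: n; exact: nbhs_infty_ger.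
near=> n.
(* The condition 4 <= k is moved into the index list, so that the integral of the sum can be split
   termwise. *)
pose B x : \bar R := (\sum_(k <- [seq k : 'I_n <- index_enum 'I_n | (4 <= k)%N])
       (expR (k.+1%:R) * \1_(superlevel u (s k)) x)%:E)%E.
apply: (@le_trans _ _ (\int[mu]_x ((expR 4 * pi * u x ^+ 2)%:E + B x))%E).
  apply: le_ge0_integralT => x.
    by rewrite lee_fin /f; case: ifPn => // _; rewrite subr_ge0 -expR0 ler_expR.
  by rewrite /B big_filter sumEFin -EFinD lee_fin.
have ml k : measurable_fun setT (\1_(superlevel u (s k)) : R -> R).
  by apply: measurable_indic; exact: (measurable_superlevel Lu).
have mt (k : 'I_n) : measurable_fun setT (fun x => (expR (k.+1%:R) * \1_(superlevel u (s k)) x : R)%:E).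
  by have := ml k => ?; solve_measurable.
have t0 (k : 'I_n) x : (0 <= (expR (k.+1%:R) * \1_(superlevel u (s k)) x : R)%:E)%E.
  by rewrite lee_fin mulr_ge0 ?expR_ge0// indicE.
rewrite /B ge0_integralD//.
- rewrite EFinD; apply: leeD.
    rewrite int_scale ?mulr_ge0 ?expR_ge0 ?pi_ge0//; last 2 first.
    + by solve_measurable.
    + by move=> x; exact: sqr_ge0.
    by rewrite nrm2E// -EFinM lee_fin ler_piMr// mulr_ge0 ?expR_ge0 ?pi_ge0.
  rewrite ge0_integral_sum//.
  rewrite big_filter.
  apply: (@le_trans _ _ (\sum_(k < n | (4 <= k)%N) (expR (k.+1%:R) * m k)%:E)%E).
    apply: lee_sum => k k4.
    rewrite int_scale ?expR_ge0//.
    have s0 : 0 < s k by apply: s_gt0; exact: leq_trans k4.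
    by rewrite (int_indE (measurable_superlevel Lu _) (superlevel_fin Lu s0)) -EFinM.
  by rewrite sumEFin lee_fin layer_sum.
- by move=> x _; rewrite lee_fin -mulrA mulr_ge0 ?expR_ge0.
- by solve_measurable.
- by move=> x _; apply: sume_ge0 => k _; exact: t0.
- by apply: emeasurable_sum => k; exact: mt.
Unshelve. all: by end_near. Qed.

End exponential_integral.

Section first_claim.
Context {R : realType}.
Notation mu := (@lebesgue_measure R).

Lemma exponential_integral_bounded : exists C : R, forall u : R -> R,
  H12_unit_ball u -> (\int[mu]_x (expR (pi * u x ^+ 2) - 1)%:E <= C%:E)%E.
Proof.
have [K garsiaK] := @garsia_bound R.
exists (expR 4 * pi + expR (2 + pi) * K) => u /unit_ball_gagliardo[E [Lu E0 uE1 gu]].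
(* Taking the modulus preserves the L^2 norm and the exponential integral and does not increase the
   Gagliardo integral. *)
pose v x := `|u x|.
have mu_ : measurable_fun setT u by case: Lu.
have mv : measurable_fun setT v by rewrite /v; solve_measurable.
have v2 x : v x ^+ 2 = u x ^+ 2 by rewrite /v real_normK ?num_real.
have Lv : L2 v by apply: (L2_le mv _ Lu) => x; rewrite /v normr_id.
have nv : sqnorm v = sqnorm u by apply: eq_Rintegral => x _.
under eq_integral => x _ do rewrite -v2.
apply: (@exponential_integral_nonneg _ v E) => //.
- by move=> x; exact: normr_ge0.
- apply: le_trans gu; apply: gagliardo_mono => x y; exact: ler_dist_dist.
- by rewrite nv.
Qed.

End first_claim.

(** * The extremal example *)

Section fourier_of_even.
Context {R : realType}.
Notation mu := (@lebesgue_measure R).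
Implicit Types (f g : R -> R).

Lemma integral_reflect_ge0 (f : R -> \bar R) : measurable_fun setT f ->
  (forall x, (0 <= f x)%E) -> (\int[mu]_x f (- x)%R = \int[mu]_x f x)%E.
Proof.
move=> mf f0.
transitivity (\int[mu]_(x in (-%R : R -> measurableTypeR R) @^-1` setT) (f \o -%R) x)%E.
  by rewrite preimage_setT.
rewrite -ge0_integral_pushforward//=.
by apply: eq_measure_integral => //= A mA AS; exact: lebesgue_measureN.
Qed.

Lemma Rintegral_reflect f : measurable_fun setT f ->
  \int[mu]_x f (- x) = \int[mu]_x f x.
Proof.
move=> /measurable_EFinP mf; rewrite /Rintegral; congr fine.
have h1 := integral_reflect_ge0 (measurable_funepos mf) (fun x => funepos_ge0 _ _).
have h2 := integral_reflect_ge0 (measurable_funeneg mf) (fun x => funeneg_ge0 _ _).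
rewrite [LHS]integralE [RHS]integralE -h1 -h2.
by congr (_ - _)%E; apply: eq_integral => x _; rewrite ?funeposE ?funenegE.
Qed.

Lemma sinT_even g xi : mu.-integrable setT (EFin \o g) -> (forall x, g (- x) = g x) ->
  sinT g xi = 0.
Proof.
move=> gi ge; have mg := measurable_integrable gi.
have : sinT g xi = - 1 * sinT g xi; last by lra.
have mh : measurable_fun setT (fun x => g x * sin (x * xi)) by solve_measurable.
rewrite {1}/sinT -(Rintegral_reflect mh) -RintegralZl//; last first.
  by apply: integrableMb => //; [solve_measurable|move=> x; exact: normr_sin].
by apply: eq_Rintegral => x _; rewrite ge [in - x * xi]mulNr sinN; ring.
Qed.

Lemma sqnorm_cut_cvg (v : R -> R) : L2 v -> (fun n => sqnorm (cut n v)) @ \oo --> sqnorm v.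
Proof.
move=> [mv v2].
apply: (@dominated_cvg_Rintegral _ (fun n x => cut n v x ^+ 2) _ (fun x => v x ^+ 2)) => //.
- by move=> n; have mc := measurable_cut n mv; solve_measurable.
- move=> x; apply: (@cvg_comp _ _ _ (fun n => cut n v x) (fun y => y ^+ 2)); first exact: cut_cvg.
  exact: exprn_continuous.
- move=> n x; rewrite ger0_norm ?sqr_ge0// -[leLHS]real_normK ?num_real//.
  by rewrite -[leRHS]real_normK ?num_real// !expr2 ler_pM// cut_le.
Qed.

Section even.
Variable g : R -> R.
Hypothesis Lg : L12 g.
Hypothesis ge : forall x, g (- x) = g x.

Let c : R := (Num.sqrt (2 * pi))^-1.

(** Unitary transform of the even function [g]: it is real, and its own transform is [g] again,
    which makes membership in the unit ball computable from [g]. *)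
Definition cosine_transform x : R := (Num.sqrt (2 * pi))^-1 * cosT g x.

Lemma measurable_cosine_transform : measurable_fun setT cosine_transform.
Proof. by have mc := measurable_cosT Lg.1; rewrite /cosine_transform; solve_measurable. Qed.

Lemma cosine_transform_sq x : cosine_transform x ^+ 2 = (2 * pi)^-1 * fourier_sq g x.
Proof.
by rewrite /cosine_transform exprMn sqrt2pi_sq /fourier_sq (sinT_even x Lg.1 ge) expr0n addr0.
Qed.

Lemma int_cosine_transform_sq : (\int[mu]_x (cosine_transform x ^+ 2)%:E = (sqnorm g)%:E)%E.
Proof.
under eq_integral => x _ do rewrite cosine_transform_sq.
rewrite int_scale.
- rewrite plancherel// -EFinM mulrA mulVf ?mul1r//.
  by rewrite gt_eqF// twopi_gt0.
- by rewrite invr_ge0; apply/ltW/twopi_gt0.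
- exact: measurable_fourier_sq Lg.1.
- by move=> x; exact: fourier_sq_ge0.
Qed.

Lemma L2_cosine_transform : L2 cosine_transform.
Proof. by apply: L2P; [exact: measurable_cosine_transform|rewrite int_cosine_transform_sq ltry]. Qed.

Lemma sqnorm_cosine_transform : sqnorm cosine_transform = sqnorm g.
Proof. by apply: EFin_inj; rewrite -(nrm2E L2_cosine_transform) int_cosine_transform_sq. Qed.

Let un n := cut n cosine_transform.
Let Lun n : L12 (un n) := L12_cut n L2_cosine_transform.
Let mun n : measurable_fun setT (un n) := measurable_integrable (Lun n).1.

(** The cosine kernel is symmetric, so the transform moves from one factor to the other. *)
Let pairing n : \int[mu]_xi (g xi * cosT (un n) xi) = \int[mu]_x (un n x * cosT g x).
Proof.
have mU := mun n.
have mk : measurable_fun setT (fun z : R * R => un n z.2 * cos (z.2 * z.1)) by solve_measurable.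
have kw x y : `|un n y * cos (y * x)| <= `|un n y|.
  by rewrite normrM ler_piMr// normr_cos.
rewrite (swap_Rintegral Lg.1 (integrable_norm (Lun n).1) mk kw).
apply: eq_Rintegral => y _ /=; rewrite /cosT -RintegralZl//.
  by apply: eq_Rintegral => x _; rewrite [y * x]mulrC; ring.
by apply: integrableMb; [exact: Lg.1|solve_measurable|move=> x; exact: normr_cos].
Qed.

Let pairing_integrable n : mu.-integrable setT (EFin \o (fun xi => g xi * cosT (un n) xi)).
Proof.
have mU := mun n.
have mk : measurable_fun setT (fun z : R * R => un n z.2 * cos (z.2 * z.1)) by solve_measurable.
have kw x y : `|un n y * cos (y * x)| <= `|un n y|.
  by rewrite normrM ler_piMr// normr_cos.
exact: swap_integrable1 Lg.1 (integrable_norm (Lun n).1) mk kw.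
Qed.

(** L^2 inversion by expanding a square: by [pairing] the mixed term is - 2 [sqnorm (un n)], and by
    Plancherel the last square contributes [sqnorm (un n)] once. *)
Let err n : (\int[mu]_xi ((g xi - ft_re cosine_transform n xi) ^+ 2 + (0 - ft_im cosine_transform n xi) ^+ 2)%:E =
  (sqnorm g - sqnorm (un n))%:E)%E.
Proof.
have Ln := Lun n.
have fi := integrable_fourier_sq Ln.
have pgi := pairing_integrable n.
have E xi : (g xi - ft_re cosine_transform n xi) ^+ 2 + (0 - ft_im cosine_transform n xi) ^+ 2 =
   g xi ^+ 2 + (- (2 * c) * (g xi * cosT (un n) xi) + (2 * pi)^-1 * fourier_sq (un n) xi).
  rewrite -ft_sq ft_reE -/c -/(un n); ring.
under eq_integral => xi _ do rewrite E.
have i2 := integrable_scale (- (2 * c)) pgi.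
have i3 := integrable_scale (2 * pi)^-1 fi.
have i23 := integrable_add i2 i3.
rewrite integrable_fune; last exact: integrable_add Lg.2 i23.
congr EFin; rewrite RintegralD//; last exact: Lg.2.
rewrite RintegralD// !RintegralZl// pairing.
have -> : \int[mu]_x (un n x * cosT g x) = c^-1 * sqnorm (un n).
  rewrite /sqnorm -RintegralZl//; last exact: Ln.2.
  apply: eq_Rintegral => x _.
  have c0 : c != 0 by rewrite invr_eq0 gt_eqF// sqrtr_gt0 twopi_gt0.
  have -> : cosT g x = c^-1 * cosine_transform x by rewrite /cosine_transform mulrA mulVf ?mul1r.
  rewrite /un /cut indicE; case: (x \in _); rewrite ?mul0r ?expr0n ?mulr0//.
  by rewrite !mul1r mulrCA expr2.
have -> : \int[mu]_x fourier_sq (un n) x = 2 * pi * sqnorm (un n).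
  by apply: EFin_inj; rewrite -integrable_fune// plancherel.
have c0 : c != 0 by rewrite invr_eq0 gt_eqF// sqrtr_gt0 twopi_gt0.
rewrite -/(sqnorm g); have := @pi_neq0 R.
by move: (sqnorm g) (sqnorm _) (pi : R) c c0 => a b p k k0 p0; field; rewrite p0 k0.
Qed.

Lemma cosine_transform_fourier : is_L2_fourier cosine_transform g (fun=> 0).
Proof.
split; first exact: measurable_integrable Lg.1.
split; first exact: measurable_cst.
under eq_fun do rewrite err.
apply: cvg_EFin; first exact: nearW.
rewrite -[X in _ --> X](subrr (sqnorm g)); apply: cvgB; first exact: cvg_cst.
by rewrite -sqnorm_cosine_transform; exact: sqnorm_cut_cvg L2_cosine_transform.
Qed.

End even.
End fourier_of_even.

Section logarithmic_example.
Context {R : realType}.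
Notation mu := (@lebesgue_measure R).

Lemma cos_ge (y : R) : 1 - `|y| <= cos y.
Proof.
wlog y0 : y / 0 <= y => [hw|].
  have [/hw//|/ltW y0] := leP 0 y.
  by rewrite -cosN -normrN hw// oppr_ge0.
have [c _] := MVT_segment y0 (fun x _ => is_derive_cos x)
  (continuous_subspaceT (@continuous_cos R)).
rewrite cos0 subr0 ger0_norm// => e.
have : sin c * y <= 1 * y by rewrite ler_wpM2r ?sin_le1.
by lra.
Qed.

Variable N : R.
Hypothesis N1 : 1 < N.

(** The maximum equals x on [1, N] and makes the second factor continuous on the whole line. *)
Definition log_half x : R := \1_(`[1, N]) x * (Num.max 1 x)^-1.
(** For g = 1 / |xi| on 1 <= |xi| <= N one has |xi| g^2 = g. The energy of its transform and the
    value of the transform at 0 are thus both given by the integral 2 ln N: equality in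
    Cauchy-Schwarz. *)
Definition log_profile x : R := log_half x + log_half (- x).

Lemma measurable_log_half : measurable_fun setT log_half.
Proof.
have m1 : measurable_fun setT (\1_(`[1, N]) : R -> R) by exact: measurable_indic.
have m2 : measurable_fun setT (fun x : R => (Num.max 1 x)^-1).
  apply: continuous_measurable_fun => s; apply: cvgV.
    by rewrite gt_eqF// lt_max ltr01.
  apply: (@continuous_max _ _ (cst 1) id); first exact: cst_continuous.
  exact: cvg_id.
exact: measurable_funM.
Qed.

Lemma log_half_in x : 1 <= x <= N -> log_half x = x^-1.
Proof.
move=> /andP[x1 xN]; rewrite /log_half indicE mem_set ?mul1r ?max_r//=.
by rewrite in_itv /= x1.
Qed.

Lemma log_half_out x : ~~ (1 <= x <= N) -> log_half x = 0.
Proof. by move=> h; rewrite /log_half indicE memNset ?mul0r//=; apply/negP; rewrite in_itv. Qed.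

Lemma log_half_ge0 x : 0 <= log_half x.
Proof. by rewrite /log_half indicE mulr_ge0// invr_ge0 le_max ler01. Qed.

Lemma log_half_le1 x : log_half x <= 1.
Proof.
have [h|h] := boolP (1 <= x <= N); last by rewrite log_half_out.
rewrite log_half_in//; case/andP: h => x1 _.
by rewrite invf_le1//; exact: lt_le_trans x1.
Qed.

Lemma log_half_disjoint x : log_half x * log_half (- x) = 0.
Proof.
have [/andP[x1 xN]|h] := boolP (1 <= x <= N); last by rewrite log_half_out ?mul0r.
rewrite (@log_half_out (- x)) ?mulr0//; apply/negP => /andP[]; lra.
Qed.

Lemma log_half_mul x : x * log_half x ^+ 2 = log_half x.
Proof.
have [h|h] := boolP (1 <= x <= N); last by rewrite log_half_out ?expr0n ?mulr0.
rewrite log_half_in// expr2 mulrA divff ?mul1r// gt_eqF//.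
by case/andP: h => h _; exact: lt_le_trans h.
Qed.

Lemma int_log_half : (\int[mu]_x (log_half x)%:E = (ln N)%:E)%E.
Proof.
rewrite int_mkind.
have -> : (\int[mu]_(x in `[1%R, N]) ((Num.max 1 x)^-1)%:E = \int[mu]_(x in `[1%R, N]) (x^-1)%:E)%E.
  by apply: eq_integral => x; rewrite inE/= in_itv/= => /andP[x1 _]; rewrite max_r.
have cl (s : R) : 1 <= s -> {for s, continuous (@ln R)}.
  by move=> s1; apply: continuous_ln; exact: lt_le_trans s1.
rewrite (@continuous_FTC2 _ (fun s => s^-1) (@ln R) 1 N)//.
- by rewrite ln1 sube0.
- apply: continuous_in_subspaceT => s; rewrite inE/= in_itv/= => /andP[s1 _].
  by apply: cvgV; [rewrite gt_eqF//; exact: lt_le_trans s1|exact: cvg_id].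
- split.
  + move=> s; rewrite in_itv/= => /andP[s1 _].
    by have := is_derive1_ln (lt_trans ltr01 s1) => ?; exact: ex_derive.
  + exact/cvg_at_right_filter/cl.
  + by apply/cvg_at_left_filter/cl; exact: ltW.
- move=> s; rewrite in_itv/= => /andP[s1 _].
  by have := is_derive1_ln (lt_trans ltr01 s1) => ?; rewrite derive1E derive_val.
Qed.

Lemma int_log_half_sq : (\int[mu]_x (log_half x ^+ 2)%:E <= 1%:E)%E.
Proof.
have N0 : 0 < N by exact: lt_trans N1.
have -> : (\int[mu]_x (log_half x ^+ 2)%:E = \int[mu]_(x in `[1%R, N]) ((x ^+ 2)^-1)%:E)%E.
  rewrite [RHS]integral_mkcond; apply: eq_integral => x _; rewrite /patch mem_setE in_itv/=.
  by case: ifPn => h; [rewrite log_half_in// exprVn|rewrite log_half_out// expr0n].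
have dF (s : R) : 0 < s -> is_derive s 1 (fun s => - s^-1) ((s ^+ 2)^-1).
  move=> s0; have h := is_deriveN (is_deriveV (lt0r_neq0 s0) (is_derive_id s 1)).
  by apply: (is_derive_eq h); rewrite /GRing.scale /= mulr1 opprK.
have cF (s : R) : 0 < s -> {for s, continuous (fun s : R => - s^-1)}.
  by move=> s0; apply: cvgN; apply: cvgV; [rewrite gt_eqF|exact: cvg_id].
rewrite (@continuous_FTC2 _ (fun s => (s ^+ 2)^-1) (fun s => - s^-1) 1 N)//.
- have Ni : 0 < N^-1 by rewrite invr_gt0.
  by rewrite -EFinB lee_fin invr1 opprK; lra.
- apply: continuous_in_subspaceT => s; rewrite inE/= in_itv/= => /andP[s1 _].
  apply: cvgV; last exact: exprn_continuous.
  by rewrite gt_eqF// exprn_gt0//; exact: lt_le_trans s1.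
- split.
  + move=> s; rewrite in_itv/= => /andP[s1 _].
    by have := dF _ (lt_trans ltr01 s1) => ?; exact: ex_derive.
  + exact/cvg_at_right_filter/cF.
  + exact/cvg_at_left_filter/cF.
- move=> s; rewrite in_itv/= => /andP[s1 _].
  by have := dF _ (lt_trans ltr01 s1) => ?; rewrite derive1E derive_val.
Qed.

Lemma log_profile_even x : log_profile (- x) = log_profile x.
Proof. by rewrite /log_profile opprK addrC. Qed.

Lemma log_profile_ge0 x : 0 <= log_profile x.
Proof. by rewrite addr_ge0 ?log_half_ge0. Qed.

Lemma log_profile_sq x : log_profile x ^+ 2 = log_half x ^+ 2 + log_half (- x) ^+ 2.
Proof. by rewrite /log_profile sqrrD log_half_disjoint mul0rn addr0. Qed.

Lemma log_profile_out x : N < `|x| -> log_profile x = 0.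
Proof.
move=> Nx; rewrite /log_profile !log_half_out ?addr0//; apply/negP => /andP[h1 h2]; move: Nx.
- by rewrite ler0_norm; lra.
- by rewrite ger0_norm; lra.
Qed.

Lemma log_profile_le2 x : log_profile x <= 2.
Proof. by have := log_half_le1 x; have := log_half_le1 (- x); rewrite /log_profile; lra. Qed.

Lemma log_profile_mul x : `|x| * log_profile x ^+ 2 = log_profile x.
Proof.
rewrite log_profile_sq mulrDr /log_profile; congr (_ + _).
- have [h|h] := boolP (1 <= x <= N); last by rewrite log_half_out// expr0n mulr0.
  by rewrite ger0_norm ?log_half_mul//; lra.
- have [h|h] := boolP (1 <= - x <= N); last by rewrite log_half_out// expr0n mulr0.
  by rewrite ler0_norm ?log_half_mul//; lra.
Qed.

Lemma log_profile_norm_le x : `|x| * log_profile x <= \1_(`[- N, N]) x.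
Proof.
have [/log_profile_out ->|xN] := ltP N `|x|; first by rewrite mulr0 indicE.
rewrite indicE mem_set/=; last by rewrite in_itv/= -ler_norml.
rewrite mulr1n.
have [h|h] := boolP (1 <= x <= N).
  have x0 : 0 < x by case/andP: h => + _; exact: lt_le_trans.
  rewrite /log_profile log_half_in// (@log_half_out (- x)) ?addr0; last by apply/negP => /andP[]; lra.
  by rewrite gtr0_norm// divff// gt_eqF.
have [h'|h'] := boolP (1 <= - x <= N); last by rewrite /log_profile !log_half_out// addr0 mulr0.
have x0 : 0 < - x by case/andP: h' => + _; exact: lt_le_trans.
by rewrite /log_profile log_half_out// log_half_in// add0r -normrN gtr0_norm// divff// gt_eqF.
Qed.

Lemma measurable_log_profile : measurable_fun setT log_profile.
Proof.
have mh := measurable_log_half; have mn : measurable_fun setT (fun x : R => log_half (- x)) by solve_measurable.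
by rewrite /log_profile; solve_measurable.
Qed.

Lemma L12_log_profile : L12 log_profile.
Proof.
apply: (@L12_bounded_support _ _ N 2) => //; first exact: measurable_log_profile.
- by move=> x; rewrite ger0_norm ?log_profile_ge0// log_profile_le2.
- exact: log_profile_out.
Qed.

Lemma int_sum_reflect (f : R -> R) : measurable_fun setT f -> (forall x, 0 <= f x) ->
  (\int[mu]_x (f x + f (- x))%:E = \int[mu]_x (f x)%:E + \int[mu]_x (f x)%:E)%E.
Proof.
move=> mf f0; under eq_integral => x _ do rewrite EFinD.
have mn : measurable_fun setT (fun x : R => f (- x)) by solve_measurable.
rewrite ge0_integralD//.
- congr (_ + _)%E; apply: (@integral_reflect_ge0 _ (EFin \o f)); first by solve_measurable.
  by move=> x; rewrite lee_fin.
- by move=> x _; rewrite lee_fin.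
- by solve_measurable.
- by move=> x _; rewrite lee_fin.
- by solve_measurable.
Qed.

Lemma int_log_profile : (\int[mu]_x (log_profile x)%:E = (2 * ln N)%:E)%E.
Proof.
rewrite int_sum_reflect ?int_log_half; [|exact: measurable_log_half|exact: log_half_ge0].
by rewrite -EFinD; congr EFin; ring.
Qed.

Lemma sqnorm_log_profile : sqnorm log_profile <= 2.
Proof.
rewrite -lee_fin -nrm2E; last exact/L12_L2/L12_log_profile.
under eq_integral => x _ do rewrite log_profile_sq.
rewrite (@int_sum_reflect (fun x => log_half x ^+ 2)).
- by rewrite (_ : 2 = 1 + 1)// EFinD; apply: leeD; exact: int_log_half_sq.
- by have mh := measurable_log_half; solve_measurable.
- by move=> x; exact: sqr_ge0.
Qed.

(** By cos y >= 1 - |y| the loss against x = 0 is at most |x| times the integral of |xi| g, which is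
    at most 2 N; for |x| <= 1 / N it is at most 2. *)
Lemma cosT_log_profile_ge x : `|x| <= N^-1 -> 2 * ln N - 2 <= cosT log_profile x.
Proof.
move=> xN; have N0 : 0 < N by exact: lt_trans N1.
have pi1 := L12_log_profile.1; have mp := measurable_log_profile.
have ii : mu.-integrable setT (EFin \o (\1_(`[- N, N]) : R -> R)).
  apply: (@integrable_bounded_support _ _ N 1) => //.
  - by move=> y; rewrite indicE; case: (y \in _); rewrite ?normr1 ?normr0.
  - by move=> y Ny; rewrite indicE memNset//= in_itv/= -ler_norml; apply/negP; rewrite -ltNge.
have e1 : \int[mu]_y log_profile y = 2 * ln N.
  by apply: EFin_inj; rewrite -integrable_fune// int_log_profile.
have e2 : \int[mu]_y (- N^-1 * \1_(`[- N, N]) y) = - 2.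
  rewrite RintegralZl//.
  have -> : \int[mu]_y (\1_(`[- N, N]) y) = 2 * N.
    apply: EFin_inj; rewrite -integrable_fune//; apply: int_indE => //.
    by rewrite lebesgue_measure_itv /= lte_fin gtrN// -EFinB; congr EFin; ring.
  by field; rewrite gt_eqF.
have i2 := integrable_scale (- N^-1) ii.
rewrite -e1 -e2 -RintegralD//.
apply: le_Rintegral => //; first exact: integrable_add.
  by apply: integrableMb => //; [solve_measurable|move=> y; exact: normr_cos].
move=> y _.
have h1 : log_profile y * (1 - `|y * x|) <= log_profile y * cos (y * x).
  by rewrite ler_wpM2l ?log_profile_ge0 ?cos_ge.
apply: le_trans h1; rewrite mulrBr mulr1 lerD2l mulNr lerN2 normrM mulrA.
rewrite mulrC; apply: ler_pM => //.
  by rewrite mulr_ge0 ?log_profile_ge0.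
by rewrite mulrC log_profile_norm_le.
Qed.

End logarithmic_example.

(** * Divergence for faster growing weights *)

Section second_claim.
Context {R : realType}.
Notation mu := (@lebesgue_measure R).

Lemma extremal_exists (L : R) : 1 < L -> exists u : R -> R, H12_unit_ball u /\
  forall x, `|x| <= expR (- L) -> L - 3 <= pi * u x ^+ 2.
Proof.
move=> L1; pose N := expR L; have N1 : 1 < N by rewrite expR_gt1; lra.
have lnN : ln N = L by rewrite expRK.
(* The profile has squared norm at most 2 and energy 2 L, so this factor brings it into the unit
   ball. *)
pose k : R := Num.sqrt (2 * L + 2)^-1.
have L22 : 0 < 2 * L + 2 by lra.
have k2 : k ^+ 2 = (2 * L + 2)^-1 by rewrite sqr_sqrtr// invr_ge0 ltW.
pose g x := k * log_profile N x.
have mp : measurable_fun setT (log_profile N) by apply: measurable_log_profile.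
have Lp : L12 (log_profile N) by apply: L12_log_profile.
have Lg : L12 g.
  split; first exact: integrable_scale Lp.1.
  have := integrable_scale (k ^+ 2) Lp.2; apply: eq_integrable => // x _.
  by rewrite /= /g exprMn.
have ge x : g (- x) = g x by rewrite /g log_profile_even.
exists (cosine_transform g); split.
  split; first exact: measurable_cosine_transform.
  exists g, (fun=> 0); split; first exact: cosine_transform_fourier.
  rewrite /H12_sqnorm int_cosine_transform_sq//.
  have -> : sqnorm g = k ^+ 2 * sqnorm (log_profile N).
    rewrite /sqnorm -RintegralZl//; last exact: Lp.2.
    by apply: eq_Rintegral => x _; rewrite /g exprMn.
  have E x : `|x| * (g x ^+ 2 + 0 ^+ 2) = k ^+ 2 * log_profile N x.
    by rewrite expr0n addr0 /g exprMn mulrCA log_profile_mul.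
  under eq_integral => x _ do rewrite E.
  rewrite int_scale ?sqr_ge0//; last by move=> x; exact: log_profile_ge0.
  rewrite int_log_profile// -EFinM -EFinD lee_fin -mulrDr k2 mulrC ler_pdivrMr// mul1r lnN.
  by have := sqnorm_log_profile N1; lra.
move=> x xL.
have xN : `|x| <= N^-1 by rewrite -expRN.
have h := cosT_log_profile_ge N1 xN; rewrite lnN in h.
have -> : pi * cosine_transform g x ^+ 2 = k ^+ 2 * cosT (log_profile N) x ^+ 2 / 2.
  rewrite /cosine_transform exprMn sqrt2pi_sq.
  have -> : cosT g x = k * cosT (log_profile N) x.
    rewrite /cosT -RintegralZl//; first by apply: eq_Rintegral => y _; rewrite /g mulrA.
    by apply: integrableMb; [exact: Lp.1|solve_measurable|move=> y; exact: normr_cos].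
  have := @pi_neq0 R; move: (pi : R) (cosT _ _) => p q p0; field.
  by rewrite p0.
(* The bound is (2 L - 2)^2 / (2 (2 L + 2)) = L - 3 + 4 / (L + 1). *)
rewrite k2 ler_pdivlMr// ler_pdivlMl//.
by move: (cosT _ _) h => q h; nra.
Qed.

Lemma weighted_integral_large (h : R -> R) (A : R) :
  (forall t, 0 <= t -> 0 <= h t) ->
  (fun t => h t / t ^+ 2) @ +oo --> +oo -> 0 < A ->
  exists2 u, H12_unit_ball u &
    ((A * expR (- 3))%:E <= \int[mu]_x (h `|u x| * (expR (pi * u x ^+ 2) - 1))%:E)%E.
Proof.
move=> h0 hoo A0.
have [T [T1 hT]] : exists T : R, 1 <= T /\ forall t, T <= t -> A <= h t.
  have /cvgryPge/(_ A)[T [_ hT]] := hoo.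
  exists (Num.max 1 (T + 1)); split; first by rewrite le_max lexx.
  move=> t; rewrite ge_max => /andP[t1 tT].
  have t0 : 0 < t by lra.
  have := hT t ltac:(lra); rewrite /= ler_pdivlMr ?exprn_gt0//.
  apply: le_trans; rewrite ler_peMr ?(ltW A0)//.
  by rewrite expr_ge1// ltW.
(* Then pi u^2 >= L - 3 = 1 + pi T^2 near 0: so |u| >= T, and exp (L - 3) >= 2 by exp x >= 1 + x. *)
pose L := 4 + pi * T ^+ 2.
have piT : 0 <= pi * T ^+ 2 by rewrite mulr_ge0 ?pi_ge0 ?sqr_ge0.
have [u [bu hu]] := @extremal_exists L ltac:(rewrite /L; lra).
exists u => //.
pose D : set R := `[- expR (- L), expR (- L)]%classic.
(* As exp (L - 3) >= 2, subtracting 1 costs at most half. Since D has length 2 exp (- L), the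
   integral of K over D is A exp (- 3), whatever L is. *)
pose K := A * (expR (L - 3) / 2).
have K0 : 0 <= K by rewrite mulr_ge0 ?(ltW A0)// divr_ge0 ?expR_ge0.
have -> : (A * expR (- 3))%:E = (\int[mu]_x (K * \1_D x)%:E)%E.
  rewrite int_scale//; last by apply: measurable_indic; exact: measurable_itv.
  have mD : mu D = (expR (- L) * 2)%:E.
    by rewrite lebesgue_measure_itv /= lte_fin gtrN ?expR_gt0// -EFinB; congr EFin; ring.
  rewrite (int_indE _ mD) -?EFinM; last exact: measurable_itv.
  congr EFin; rewrite /K.
  have -> : expR (- 3) = expR (L - 3) * expR (- L).
    by rewrite -expRD; congr expR; ring.
  by field.
apply: le_ge0_integralT => x; rewrite lee_fin.
  by rewrite mulr_ge0// indicE.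
rewrite indicE; have [xD|_] := boolP (x \in D); last first.
  rewrite mulr0 mulr_ge0 ?h0// subr_ge0 -expR0 ler_expR mulr_ge0 ?pi_ge0 ?sqr_ge0//.
rewrite mulr1; have xL : `|x| <= expR (- L).
  by move/set_mem: xD; rewrite /D /= in_itv/= -ler_norml.
have {}hu := hu x xL.
apply: ler_pM; [exact: ltW|by rewrite divr_ge0 ?expR_ge0| |].
  apply: hT; rewrite -[leLHS]ger0_norm; last by lra.
  rewrite -(ler_pXn2r (n := 2)) ?nnegrE ?normr_ge0// !real_normK ?num_real//.
  by rewrite -(ler_pM2l (pi_gt0 R)); move: hu; rewrite /L; lra.
have h2 : expR (L - 3) <= expR (pi * u x ^+ 2) by rewrite ler_expR.
have h3 : 2 <= expR (L - 3).
  by apply: le_trans (expR_ge1Dx _); rewrite /L; lra.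
by lra.
Qed.

End second_claim.

Unset Implicit Arguments.

Theorem theorem1p6 (R : realType) :
  (ereal_sup [set (\int[@lebesgue_measure R]_x ((expR (pi * u x ^+ 2) - 1)%:E))%E
              | u in @H12_unit_ball R] < +oo)%E /\
  (forall h : R -> R,
     (forall t : R, 0 <= t -> 0 <= h t) ->
     (fun t : R => h t / t ^+ 2) @ +oo --> +oo ->
     ereal_sup [set (\int[@lebesgue_measure R]_x
                      ((h `|u x| * (expR (pi * u x ^+ 2) - 1))%:E))%E
                | u in @H12_unit_ball R] = +oo%E).
Proof.
split=> [|h h0 hoo].
  have [C hC] := @exponential_integral_bounded R.
  apply: (@le_lt_trans _ _ C%:E); last exact: ltry.
  by apply: ge_ereal_sup => _ [u bu <-]; exact: hC.
apply/eqyP => A A0.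
(* The factor exp (- 3) lost in the example is compensated in advance. *)
have [u bu hu] := weighted_integral_large h0 hoo (divr_gt0 A0 (expR_gt0 (- 3))).
apply: (@le_trans _ _ (A / expR (- 3) * expR (- 3))%:E).
  by rewrite divfK// gt_eqF ?expR_gt0.
apply: (le_trans hu); apply: ereal_sup_ubound.
by exists u.
Qed.
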